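(* Let $\tilde w\in\tilde S_{n,k}$ be a decorated permutation with associated Grassmann interval $[u,v]$ and positroid $\mathcal M=\{y[k]:y\in[u,v]\}$. Then the following are equivalent. (1) The positroid variety $\Pi_{\tilde w}=\Pi_{[u,v]}=\Pi_{\mathcal M}$ is smooth. (2) For every $y\in[u,v]$, $\#\{I\in\mathcal M: |I\cap y[k]|=k-1\}=\ell(v)-\ell(u)$. (3) For every $J\in\mathcal M$, $\#\{I\in\mathcal M:|I\cap J|=k-1\}=k(n-k)-\#\mathrm{Alignments}(\tilde w)$. (4) The graph $J(\mathcal M)$ is regular, and each vertex has degree $\ell(v)-\ell(u)$. (5) The decorated permutation $\tilde w$ has no crossed alignments. (6) The chord diagram $D(\tilde w)$ is a disjoint union of spirographs. (7) The positroid $\mathcal M$ is a direct sum of uniform matroids.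
   Context: Orders and permutations. $[n]=\{1,\dots,n\}$; $\binom{[n]}{k}$ is the set of $k$-subsets. For $r\in[n]$ let $<_r$ be the linear order $r<_r r+1<_r\dots<_r n<_r 1<_r\dots<_r r-1$. For $k$-subsets $I=\{i_1<_r\dots<_r i_k\}$, $J=\{j_1<_r\dots<_r j_k\}$ write $I\preceq_r J$ if $i_h\le_r j_h$ for all $h$; $\preceq$ means $\preceq_1$. For $w\in S_n$, $w[i]=\{w(1),\dots,w(i)\}$ and $\ell(w)$ is the number of inversions. Bruhat order: $u\le v$ iff $u[i]\preceq v[i]$ for all $i$; $[u,v]=\{y\in S_n:u\le y\le v\}$. Products of permutations are compositions. Decorated permutations. A decorated permutation on $[n]$ is a pair $\tilde w=(w,\mathrm{co})$ with $w\in S_n$ and $\mathrm{co}$ a map from the fixed points of $w$ to $\{\text{clockwise},\text{counterclockwise}\}$. Let $I_r(\tilde w)=\{i\in[n]: i<_r w^{-1}(i)\}\cup\{i: w(i)=i,\ \mathrm{co}(i)=\text{clockwise}\}$; all have the same size, and $\tilde S_{n,k}$ is the set of decorated permutations on $[n]$ for which this size is $k$. Associated Grassmann interval: $v$ is the $k$-Grassmannian permutation ($v_1<\dots<v_k$, $v_{k+1}<\dots<v_n$) with $v[k]=w^{-1}(I_1(\tilde w))$, and $u=wv$ (then $u\le v$). Associated positroid: $\mathcal M=\mathcal M(\tilde w)=\{I\in\binom{[n]}{k}: I_r(\tilde w)\preceq_r I\ \forall r\in[n]\}$, a matroid given by its bases; it equals $\{y[k]:y\in[u,v]\}$. Positroid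 variety and smoothness. $Gr(k,n)$ is the complex Grassmannian; a point is the row span of a full rank $k\times n$ matrix, and $\Delta_I$ is the maximal minor in columns $I$, a polynomial in variables $x_{ij}$. $\Pi_{\mathcal M}\subseteq Gr(k,n)$ is the subvariety defined by $\Delta_I=0$ for all $I\in\binom{[n]}{k}\setminus\mathcal M$ (these are known to generate its vanishing ideal). Its codimension in $Gr(k,n)$ is known to be $\#\mathrm{Alignments}(\tilde w)=k(n-k)-[\ell(v)-\ell(u)]$. A point represented by $A$ is singular if the Jacobian matrix $(\partial\Delta_I/\partial x_{ij})_{I\notin\mathcal M,\,(i,j)}$ evaluated at $A$ has rank strictly less than this codimension; $\Pi_{\mathcal M}$ is smooth if it has no singular point. Johnson graph. $J(\mathcal M)$ is the graph with vertex set $\mathcal M$ in which $I,J$ are adjacent iff $|I\cap J|=k-1$. Chord diagram, alignments. The chord diagram $D(\tilde w)$ has vertices $1,\dots,n$ placed clockwise on a circle and a directed arc $i\mapsto w(i)$ for each $i$ (a loop oriented by $\mathrm{co}$ at each fixed point). For $a,b\in[n]$ let $[a,b]^{cyc}=[a,b]$ if $a\le b$ and $[a,n]\cup[1,b]$ if $a>b$. An alignment of $\tilde w$ is a pair of arcs $(p\mapsto w(p),\,s\mapsto w(s))$, $p\neq s$, that are noncrossing (in particular share no endpoints) and point in the same direction, with $(p\mapsto w(p))$ on the port (left) side: that is, going clockwise from $p$ one meets $p,w(p),w(s),s$ in this order, where only $p=w(p)$ and $s=w(s)$ are allowed as coincidences; equivalently, with residues taken in $\{0,\dots,n-1\}$,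 $(w(p)-p \bmod n)<(w(s)-p\bmod n)\le (s-p\bmod n)$. In addition, if $w(s)=s$ then $\mathrm{co}(s)$ is clockwise, and if $w(p)=p$ then $\mathrm{co}(p)$ is counterclockwise. $\mathrm{Alignments}(\tilde w)$ is the set of alignments. A crossed alignment is an alignment $(p\mapsto w(p),s\mapsto w(s))$ together with a third arc $x\mapsto w(x)$ crossing both, i.e. either $x\in[w(s),s]^{cyc}$ and $w(x)\in[p,w(p)]^{cyc}$, or $x\in[p,w(p)]^{cyc}$ and $w(x)\in[w(s),s]^{cyc}$. Spirographs. A decorated permutation $(w,\mathrm{co})$ on $[n]$ is a spirograph permutation if there is a positive integer $m$ with $w(i)\equiv i+m \pmod n$ for all $i$ and $w$ has at most one fixed point; its chord diagram is a spirograph. $D(\tilde w)$ is a disjoint union of spirographs if there is a non-crossing partition $[n]=B_1\sqcup\dots\sqcup B_t$ (no distinct $a,b,c,d$ in cyclic order with $a,c\in B_i$, $b,d\in B_j$, $i\ne j$) with $w(B_i)=B_i$ for all $i$ and such that each restriction of $\tilde w$ to $B_i$, after the order-preserving relabeling of $B_i$ by $[\#B_i]$, is a spirograph permutation. Matroids. The uniform matroid of rank $k$ on a set $B$ has all $k$-subsets of $B$ as bases. The direct sum of matroids on disjoint ground sets has as bases the unions of one basis from each summand. *)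

(* Defs.v *)
From HB Require Import structures.
From mathcomp Require Import all_boot all_order all_algebra all_fingroup.
From mathcomp Require Import reals complex mpoly.

Set Implicit Arguments.
Unset Strict Implicit.
Unset Printing Implicit Defensive.

Import GRing.Theory.

(* The ground set [n] = {1, .., n} is represented by 'I_n = {0, .., n-1}. *)

Section Permutations.
Variable n : nat.
Implicit Types (I J : {set 'I_n}) (u v w y : 'S_n).

(* [enum I] lists [I] increasingly, and [all2] also tests that the sizes of
   the two lists agree. *)
Definition gale_le I J : bool :=
  all2 (fun i j : 'I_n => i <= j) (enum I) (enum J).

Definition prefix_set w (i : nat) : {set 'I_n} :=
  [set w j | j : 'I_n & j < i].

Definition perm_length w : nat :=
  #|[set p : 'I_n * 'I_n | (p.1 < p.2) && (w p.2 < w p.1)]|.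

Definition bruhat_le u v : bool :=
  [forall i : 'I_n.+1, gale_le (prefix_set u i) (prefix_set v i)].

Definition bruhat_interval u v : {set 'S_n} :=
  [set y | bruhat_le u y && bruhat_le y v].

Definition grassmannian (k : nat) v : Prop :=
  forall i j : 'I_n, i < j -> (j < k) || (k <= i) -> v i < v j.

End Permutations.

(* A colouring of the fixed points by two colours is given by the set of the
   clockwise ones; the other fixed points are counterclockwise. *)
Record decperm (n : nat) := DecPerm {
  dperm :> 'S_n;
  clockwise : {set 'I_n};
  clockwise_fixed : clockwise \subset [set i | dperm i == i]
}.

Section DecoratedPermutations.
Variable n : nat.
Implicit Types (w : decperm n) (u v : 'S_n).

Definition counterclockwise w : {set 'I_n} :=
  [set i | w i == i] :\: clockwise w.

(* The set I_1(w), for the standard order of the ground set. *)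
Definition anti_exceedances w : {set 'I_n} :=
  [set i : 'I_n | i < (dperm w)^-1%g i] :|: clockwise w.

(* Membership of w in the set of decorated permutations of type (k, n). The
   sets I_r(w) all have the same size, so r = 1 suffices. *)
Definition has_type (k : nat) w : Prop := #|anti_exceedances w| = k.

(* [u] is the composition w o v; the product of 'S_n is diagrammatic, that is
   (v * w)%g i = w (v i). *)
Definition grassmann_interval (k : nat) w u v : Prop :=
  [/\ grassmannian k v,
      prefix_set v k = (dperm w)^-1%g @: anti_exceedances w
    & u = (v * dperm w)%g].

End DecoratedPermutations.

Definition positroid (n k : nat) (u v : 'S_n) : {set {set 'I_n}} :=
  [set prefix_set y k | y in bruhat_interval u v].

Section ChordDiagrams.
Variable n : nat.
Implicit Types (a b p s x : 'I_n) (w : decperm n).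

(* The residue of b - a modulo n. *)
Definition cyc_dist a b : nat := (b + n - a) %% n.

Definition cyc_interval a b : {set 'I_n} :=
  if a <= b then [set x : 'I_n | a <= x <= b]
  else [set x : 'I_n | (a <= x) || (x <= b)].

(* The pair (p, s) stands for the pair of arcs (p |-> w p, s |-> w s). *)
Definition is_alignment w p s : bool :=
  [&& p != s,
      cyc_dist p (w p) < cyc_dist p (w s),
      cyc_dist p (w s) <= cyc_dist p s,
      (w s == s) ==> (s \in clockwise w)
    & (w p == p) ==> (p \in counterclockwise w)].

Definition alignments w : {set 'I_n * 'I_n} :=
  [set ps | is_alignment w ps.1 ps.2].

Definition is_crossed_alignment w p s x : bool :=
  [&& is_alignment w p s, x != p, x != s
    & ((x \in cyc_interval (w s) s) && (w x \in cyc_interval p (w p)))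
      || ((x \in cyc_interval p (w p)) && (w x \in cyc_interval (w s) s))].

End ChordDiagrams.

Definition spirograph (n : nat) (w : decperm n) : Prop :=
  (exists2 m : nat, 0 < m & forall i : 'I_n, w i = i + m %[mod n])
  /\ #|[set i | w i == i]| <= 1.

Section Spirographs.
Variable n : nat.
Implicit Types (w : decperm n) (B : {set 'I_n}) (P : {set {set 'I_n}}).

(* [z] is the restriction of [w] to the invariant set [B], relabelled along
   the increasing bijection [enum_val : 'I_#|B| -> B]. *)
Definition is_restriction w B (z : decperm #|B|) : Prop :=
  forall j : 'I_#|B|,
    enum_val (z j) = w (enum_val j)
    /\ (j \in clockwise z) = (enum_val j \in clockwise w).

Definition cyclically_ordered (a b c d : 'I_n) : bool :=
  [&& 0 < cyc_dist a b, cyc_dist a b < cyc_dist a c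
    & cyc_dist a c < cyc_dist a d].

Definition noncrossing P : Prop :=
  forall B B' : {set 'I_n}, B \in P -> B' \in P -> B != B' ->
  forall a b c d : 'I_n, cyclically_ordered a b c d ->
  ~~ [&& a \in B, c \in B, b \in B' & d \in B'].

Definition disjoint_union_of_spirographs w : Prop :=
  exists P : {set {set 'I_n}},
    [/\ partition P [set: 'I_n], noncrossing P
      & forall B, B \in P ->
          dperm w @: B = B
          /\ exists2 z : decperm #|B|, is_restriction w z & spirograph z].

End Spirographs.

Section Johnson.
Variables (n k : nat).
Implicit Types (I J : {set 'I_n}) (M : {set {set 'I_n}}).

(* The condition |I :&: J| = k - 1; for k = 0 it never holds. *)
Definition johnson_adj I J : bool := #|I :&: J|.+1 == k.

Definition johnson_degree M J : nat := #|[set I in M | johnson_adj I J]|.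

Definition johnson_regular M : Prop :=
  exists d : nat, forall J, J \in M -> johnson_degree M J = d.

End Johnson.

(* A matroid is represented by its set of bases. *)

Section Matroids.
Variable T : finType.
Implicit Types (B I : {set T}) (P : {set {set T}}).

Definition uniform_bases (r : nat) B : {set {set T}} :=
  [set I : {set T} | (I \subset B) && (#|I| == r)].

(* The direct sum, over the blocks B of P, of the matroids on B with sets of
   bases [bases B]; a family f picks one basis for each block. *)
Definition direct_sum_bases P (bases : {set T} -> {set {set T}}) :
    {set {set T}} :=
  [set \bigcup_(B in P) f B | f : {ffun {set T} -> {set T}}
     & [forall B in P, f B \in bases B]].

Definition direct_sum_of_uniform (M : {set {set T}}) : Prop :=
  exists P (r : {set T} -> nat),
    [/\ partition P [set: T],
        forall B, B \in P -> r B <= #|B|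
      & M = direct_sum_bases P (fun B => uniform_bases (r B) B)].

End Matroids.

Definition ksubset (n k : nat) := {I : {set 'I_n} | #|I| == k}.

(* The j-th smallest element of I. *)
Definition ksubset_nth (n k : nat) (I : ksubset n k) (j : 'I_k) : 'I_n :=
  enum_val (cast_ord (esym (eqP (valP I))) j).

Definition plucker (K : comNzRingType) (n k : nat)
    (A : 'M[K]_(k, n)) (I : ksubset n k) : K :=
  (\det (colsub (ksubset_nth I) A))%R.

(* The variable x_ij is the variable of index [mxvec_index i j]. *)
Definition generic_mx (K : comNzRingType) (n k : nat) :
    'M[{mpoly K[k * n]}]_(k, n) :=
  (\matrix_(i, j) 'X_(mxvec_index i j))%R.

Section PositroidVarieties.
Variables (R : realType) (n k : nat).
Variable M : {set {set 'I_n}}.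
Implicit Type A : 'M[R[i]]_(k, n).

Definition nonbases : {set ksubset n k} := [set I | val I \notin M].

Definition in_positroid_variety A : Prop :=
  row_free A /\ forall I, I \in nonbases -> plucker A I = 0%R.

Definition jacobian A : 'M[R[i]]_(#|nonbases|, k * n) :=
  (\matrix_(r, c)
     ((plucker (generic_mx R[i] n k) (enum_val r))^`M(c)).@[mxvec A 0])%R.

Definition singular_point (codim : nat) A : Prop :=
  in_positroid_variety A /\ \rank (jacobian A) < codim.

Definition smooth_variety (codim : nat) : Prop :=
  ~ exists A, singular_point codim A.

End PositroidVarieties.

(* The known codimension of the positroid variety in the Grassmannian, the
   number of alignments, is the one used in the Jacobian criterion. The field
   R[i] of complex numbers is built over an arbitrary model R of the reals. *)
Definition smooth_positroid_variety (R : realType) (n k : nat)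
    (w : decperm n) (M : {set {set 'I_n}}) : Prop :=
  smooth_variety R k M #|alignments w|.

(* Main.v *)
Require Import Defs.
From mathcomp Require Import all_boot all_order all_algebra all_fingroup.
From mathcomp Require Import reals complex mpoly.
From mathcomp Require Import zify.

(* Cutting the circle open splits the arcs x |-> w x into k downward and n - k
   upward ones, and a k-subset I lies in M iff every interval contains at least as
   many elements of I (of its complement) as it contains whole downward (upward)
   arcs; this description is invariant under rotation.

   At a point with Delta_J <> 0 the Jacobian matrix has rank at least the number of
   non-bases adjacent to J, with equality at the coordinate point of J. Hence Pi_M
   is smooth iff every J in M has at least #Alignments adjacent non-bases. For the
   least basis J of a cut these non-bases inject into the alignments, and a crossed
   alignment is missed if the cut is made next to the crossing arc.

   Without crossed alignments, every alignment is separated by a w-invariant cyclic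
   interval. The points not separated by such intervals form the blocks of a
   noncrossing partition; w has no alignment inside a block, so it is a shift there.
   Then M is a direct sum of uniform matroids on the blocks, and the alignments are
   equinumerous with the pairs of a downward and an upward arc in different blocks,
   that is, with the non-bases adjacent to any J in M.

   Conversely, in a direct sum of uniform matroids the arcs stay inside the blocks,
   crossing arcs lie in the same block, and the points of a block B in [x, w x) are
   as many as the rank of B, which excludes crossed alignments. *)

Set Implicit Arguments.
Unset Strict Implicit.
Unset Printing Implicit Defensive.

(** * Counting in ordinals *)

(** The Bruhat description of M singles out a first point, while alignments, crossings and
    noncrossing partitions are cyclic. Counting on intervals removes the asymmetry, because the
    bound for an interval is the other bound for its complement. Hence a crossed alignment can be
    tested on the least basis of one well-chosen cut.

    The coordinate point of J has the least Jacobian rank among the points with $\Delta_J \ne 0$, so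
    singularity becomes a condition on bases alone.

    One device replaces explicit bijections: a permutation has as many arcs going up over a cut as
    going down over it. It trades pairs of opposite directions for nested pairs of the same
    direction, both in the injection at a least basis and in the exact count over blocks.

    Smoothness yields inequalities only. The equalities in (2)-(4) come from the block structure,
    and $\#Alignments + \ell(v) = k(n-k) + \ell(u)$ ties the constants together. *)

Section Counting.
Variable n : nat.
Implicit Types (I J : {set 'I_n}).

Definition seg (a b : nat) : {set 'I_n} := [set x : 'I_n | a <= x < b].

Lemma card_segr (a b : nat) : a <= b <= n -> #|seg a b| = b - a.
Proof.
move=> /andP[ab bn].
have -> : seg a b = [set x : 'I_n | val x \in iota a (b - a)].
  by apply/setP => x; rewrite !inE mem_iota subnKC.
rewrite cardsE -sum1_card (eq_bigl (fun x : 'I_n => val x \in iota a (b - a))) //.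
rewrite -(big_mkord (fun i => i \in iota a (b - a)) (fun=> 1)).
rewrite -big_filter sum1_size.
suff -> : [seq i <- index_iota 0 n | i \in iota a (b - a)] = iota a (b - a).
  by rewrite size_iota.
apply: (@sorted_eq _ ltn) => //.
- exact: ltn_trans.
- by move=> x y /andP[/ltnW h /ltnW h']; apply/eqP; rewrite eqn_leq h h'.
- apply: sorted_filter; [exact: ltn_trans | exact: iota_ltn_sorted].
- exact: iota_ltn_sorted.
- apply: uniq_perm; rewrite ?filter_uniq ?iota_uniq // => x.
  rewrite mem_filter !mem_iota subn0 add0n; lia.
Qed.

(** Induction on the lists. If the heads had [y < x], the threshold [y.+1] would violate the counts;
    otherwise thresholds up to [y] see nothing in the tail of the second list, and beyond [y] the
    heads cancel. *)
Lemma all2_countP (s t : seq nat) : sorted ltn s -> sorted ltn t ->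
  reflect (size s = size t /\ forall c, count (fun x => x < c) t <= count (fun x => x < c) s)
    (all2 leq s t).
Proof.
elim: s t => [|x s IH] [|y t] //=.
- by constructor.
- by constructor=> -[].
- by constructor=> -[].
move=> ps pt; have ss := path_sorted ps; have st := path_sorted pt.
have Hx c : c <= x -> count (fun z => z < c) s = 0.
  move=> cx; apply/eqP; rewrite -leqn0 leqNgt -has_count -all_predC.
  apply: sub_all (order_path_min ltn_trans ps) => z /=; lia.
have Hy c : c <= y -> count (fun z => z < c) t = 0.
  move=> cx; apply/eqP; rewrite -leqn0 leqNgt -has_count -all_predC.
  apply: sub_all (order_path_min ltn_trans pt) => z /=; lia.
apply: (iffP andP) => [[xy /(IH _ ss st)[sz H]]|[[sz] H]].
  split; first by rewrite sz.
  move=> c; have := H c; lia.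
have xy : x <= y.
  rewrite leqNgt; apply/negP => yx; have := H y.+1; rewrite (Hx y.+1) //.
  lia.
split=> //; apply/(IH _ ss st); split=> // c.
have [cy|yc] := leqP c y; first by rewrite Hy.
have := H c; lia.
Qed.

Lemma all2_map (s t : seq 'I_n) :
  all2 (fun i j : 'I_n => i <= j) s t = all2 leq (map val s) (map val t).
Proof. by elim: s t => [|x s IH] [|y t] //=; rewrite IH. Qed.

Lemma sorted_enum_val (I : {set 'I_n}) : sorted ltn (map val (enum I)).
Proof.
apply: (subseq_sorted ltn_trans (s2 := map val (enum 'I_n))).
  by rewrite [enum I]/enum_mem [enum 'I_n]enumT; apply: map_subseq; apply: filter_subseq.
by rewrite val_enum_ord iota_ltn_sorted.
Qed.

Lemma count_enum (I : {set 'I_n}) (p : pred nat) :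
  count p (map val (enum I)) = #|[set x in I | p x]|.
Proof.
rewrite count_map -size_filter cardE; congr size.
rewrite /enum_mem -filter_predI; apply: eq_filter => x.
by rewrite /= !inE andbC.
Qed.

Lemma gale_leP I J : reflect
  (#|I| = #|J| /\ forall c, #|[set x in J | x < c]| <= #|[set x in I | x < c]|)
  (gale_le I J).
Proof.
rewrite /gale_le all2_map.
have H := all2_countP (sorted_enum_val I) (sorted_enum_val J).
have E c : (count (fun x => x < c) (map val (enum J)) <= count (fun x => x < c) (map val (enum I)))
  = (#|[set x in J | x < c]| <= #|[set x in I | x < c]|) by rewrite !count_enum.
apply: (iffP H); rewrite !size_map -!cardE => -[sz h]; split=> // c; move: (h c);
  by rewrite E.
Qed.

Lemma gale_le_nth x0 I J (i : nat) : gale_le I J -> i < #|I| ->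
  nth x0 (enum I) i <= nth x0 (enum J) i.
Proof.
rewrite /gale_le all2E => /andP[/eqP sz /allP H] iI.
have sI : i < size (enum I) by rewrite -cardE.
have := H (nth x0 (enum I) i, nth x0 (enum J) i).
apply; rewrite -nth_zip //; apply: mem_nth.
by rewrite size_zip -sz minnn.
Qed.

Lemma card_pair_split (T : finType) (I : {set T}) (p : pred T) :
  #|[set x in I | p x]| + #|[set x in I | ~~ p x]| = #|I|.
Proof.
rewrite -cardsUI [X in _ + X]eq_card0 ?addn0.
  by apply: eq_card => x; rewrite !inE; case: (p x); rewrite ?andbT ?andbF ?orbF.
by move=> x; rewrite !inE; case: (p x); rewrite ?andbT ?andbF.
Qed.

Lemma card_ltn (c : nat) : c <= n -> #|[set x : 'I_n | x < c]| = c.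
Proof.
by move=> cn; rewrite -[RHS]subn0 -card_segr ?leq0n //; apply: eq_card => x; rewrite !inE.
Qed.

(** The sets [x < b] and [w x < b] have the same size; removing their intersection leaves the arcs
    that cross the cut [b] upward and downward. *)
Lemma card_cut (w : 'S_n) (b : nat) :
  #|[set x : 'I_n | x < b <= w x]| = #|[set x : 'I_n | w x < b <= x]|.
Proof.
have e : #|[set x : 'I_n | x < b]| = #|[set x : 'I_n | w x < b]|.
  rewrite -(card_imset [set x : 'I_n | w x < b] (@perm_inj _ w)).
  apply: eq_card => x; rewrite !inE.
  apply/idP/imsetP => [xb|[y]]; last by rewrite inE => h ->.
  by exists (w^-1%g x); rewrite ?inE ?permKV.
have := card_pair_split [set x : 'I_n | x < b] (fun x : 'I_n => w x < b).
have := card_pair_split [set x : 'I_n | w x < b] (fun x : 'I_n => x < b).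
rewrite e => <- /eqP; rewrite [X in _ == X + _ ](_ : _ = #|[set x in [set x : 'I_n | x < b] | w x < b]|).
  rewrite eqn_add2l => /eqP h; transitivity #|[set x in [set x : 'I_n | x < b] | ~~ (w x < b)]|.
    by apply: eq_card => x; rewrite !inE; lia.
  by rewrite h; apply: eq_card => x; rewrite !inE; lia.
by apply: eq_card => x; rewrite !inE andbC.
Qed.

End Counting.

Section Bruhat.
Variable n : nat.
Implicit Types (u v w y : 'S_n).

Lemma card_prefix_lt w (i : nat) (p : pred 'I_n) :
  #|[set x in prefix_set w i | p x]| = #|[set j : 'I_n | (j < i) && p (w j)]|.
Proof.
rewrite -(card_imset [set j : 'I_n | (j < i) && p (w j)] (@perm_inj _ w)).
apply: eq_card => x; rewrite !inE.
apply/andP/imsetP => [[/imsetP[j]]|[j]]; rewrite inE.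
  by move=> ji -> pj; exists j; rewrite // inE ji.
by move=> /andP[ji pj] ->; split=> //; apply/imsetP; exists j; rewrite ?inE.
Qed.

Lemma card_prefix w (i : nat) : i <= n -> #|prefix_set w i| = i.
Proof.
by move=> iN; rewrite card_imset ?card_ltn //; apply: perm_inj.
Qed.

Lemma bruhat_leP u v : reflect
  (forall i c : nat, i <= n -> #|[set j : 'I_n | (j < i) && (v j < c)]|
     <= #|[set j : 'I_n | (j < i) && (u j < c)]|) (bruhat_le u v).
Proof.
apply: (iffP forallP) => H.
  move=> i c iN; have iN' : i < n.+1 by [].
  have /gale_leP[_ /(_ c)] := H (Ordinal iN').
  by rewrite !card_prefix_lt.
move=> i; apply/gale_leP; split; first by rewrite !card_prefix // -ltnS.
by move=> c; rewrite !card_prefix_lt; apply: H; rewrite -ltnS.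
Qed.

End Bruhat.

(** * Bruhat intervals below a Grassmannian permutation *)

Section Grassmann.
Variable n : nat.
Implicit Types (v g w : 'S_n) (D V I : {set 'I_n}).

Lemma card_perm_pred v (p : pred 'I_n) : #|[set j | p (v j)]| = #|[set x | p x]|.
Proof.
rewrite -(card_imset [set j | p (v j)] (@perm_inj _ v)); congr #|pred_of_set _|.
apply/setP => x; rewrite inE; apply/imsetP/idP => [[j]|px].
  by rewrite inE => h ->.
by exists (v^-1%g x); rewrite ?inE permKV.
Qed.

Lemma down_closed_card D : (forall i j : 'I_n, i <= j -> j \in D -> i \in D) ->
  forall j : 'I_n, (j \in D) = (j < #|D|).
Proof.
move=> H j; apply/idP/idP => [jD|].
  rewrite -(card_ltn (ltn_ord j)); apply/subset_leq_card/subsetP => i.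
  by rewrite inE ltnS => /H; apply.
apply: contraLR => jD; rewrite -leqNgt; apply: leq_trans (eq_leq (card_ltn (ltnW (ltn_ord j)))).
apply/subset_leq_card/subsetP => i iD; rewrite inE ltnNge.
by apply: contra jD => /H; apply.
Qed.

Section Fixed.
Variables (k : nat) (v : 'S_n) (V : {set 'I_n}).
Hypotheses (gv : grassmannian k v) (vV : prefix_set v k = V).

Lemma mem_grass (j : 'I_n) : (v j \in V) = (j < k).
Proof.
rewrite -vV; apply/imsetP/idP => [[i ik /perm_inj ->]|jk]; last by exists j; rewrite ?inE.
by rewrite inE in ik.
Qed.

Lemma grass_le (i j : 'I_n) : (j < k) || (k <= i) -> i <= j -> v i <= v j.
Proof.
move=> h; rewrite leq_eqVlt => /orP[/eqP/val_inj -> //|ij].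
exact/ltnW/gv.
Qed.

(** As [v] increases on the positions below [k] and on those from [k] on, the first [i <= k]
    positions carry the elements of [V] below some [b], and the positions from [i > k] on carry the
    elements outside [V] from some [b] on. Bruhat comparison thus becomes counting on values. *)
Lemma bruhat_grassP g1 g2 : reflect
  ((forall b c : nat, #|[set x | [&& x \in V, x < b & c <= g1 x]]|
                   <= #|[set x | [&& x \in V, x < b & c <= g2 x]]|) /\
   (forall b c : nat, #|[set x | [&& x \notin V, b <= x & g1 x < c]]|
                   <= #|[set x | [&& x \notin V, b <= x & g2 x < c]]|))
  (bruhat_le (v * g1)%g (v * g2)%g).
Proof.
(* Complementing inside the first [i] positions, or inside the values below [c] for [highE],
   reverses the Bruhat inequality; hence [g1] is on the smaller side. *)
have lowE g (i c : nat) : i <= n ->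
  #|[set j : 'I_n | (j < i) && ((v * g)%g j < c)]|
   + #|[set j : 'I_n | (j < i) && (c <= g (v j))]| = i.
  move=> iN; rewrite -[RHS](card_ltn iN).
  rewrite -(card_pair_split [set j : 'I_n | j < i] (fun j : 'I_n => g (v j) < c)).
  by congr (_ + _); apply: eq_card => j; rewrite !inE ?permM -?leqNgt.
have highE g (i c : nat) :
  #|[set j : 'I_n | (j < i) && ((v * g)%g j < c)]|
   + #|[set j : 'I_n | (i <= j) && (g (v j) < c)]| = #|[set x : 'I_n | x < c]|.
  rewrite -[RHS](card_perm_pred (v * g)%g (fun x => x < c)).
  rewrite -(card_pair_split [set j : 'I_n | (v * g)%g j < c] (fun j : 'I_n => j < i)).
  congr (_ + _); apply: eq_card => j; rewrite !inE ?permM; lia.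
apply: (iffP (bruhat_leP _ _)) => [H|[H1 H2] i c iN].
  split=> b c.
    set D := [set j : 'I_n | (v j \in V) && (v j < b)].
    have DP := @down_closed_card D; have {}DP j : (j \in D) = (j < #|D|).
      apply: DP => i j0 ij; rewrite !inE !mem_grass => /andP[jk vb].
      have := @grass_le i j0; rewrite jk /= => /(_ isT ij); lia.
    have DN : #|D| <= n by rewrite -[X in _ <= X](card_ord n) max_card.
    have E g : #|[set x | [&& x \in V, x < b & c <= g x]]|
       = #|[set j : 'I_n | (j < #|D|) && (c <= g (v j))]|.
      rewrite -[LHS](card_perm_pred v); apply: eq_card => j.
      by rewrite !inE -DP inE andbA.
    have := H #|D| c DN; have := lowE g1 #|D| c DN; have := lowE g2 #|D| c DN.
    rewrite !E; lia.
  set D := [set j : 'I_n | ~~ ((v j \notin V) && (b <= v j))].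
  have DP := @down_closed_card D; have {}DP j : (j \in D) = (j < #|D|).
    apply: DP => i j0 ij; rewrite !inE !mem_grass => h; apply/negP => /andP[ik vb].
    have := @grass_le i j0; rewrite (leqNgt k) ik orbT => /(_ isT ij); lia.
  have DN : #|D| <= n by rewrite -[X in _ <= X](card_ord n) max_card.
  have E g : #|[set x | [&& x \notin V, b <= x & g x < c]]|
     = #|[set j : 'I_n | (#|D| <= j) && (g (v j) < c)]|.
    rewrite -[LHS](card_perm_pred v); apply: eq_card => j.
    by rewrite !inE (leqNgt #|D|) -DP inE negbK andbA.
  have := H #|D| c DN; have := highE g1 #|D| c; have := highE g2 #|D| c.
  rewrite !E; lia.
have [ik|ki] := leqP i k.
  case: i iN ik => [|i] iN ik.
    by rewrite eq_card0 // => j; rewrite !inE.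
  have E g : #|[set x | [&& x \in V, x < (v (Ordinal iN)).+1 & c <= g x]]|
     = #|[set j : 'I_n | (j < i.+1) && (c <= g (v j))]|.
    rewrite -[LHS](card_perm_pred v); apply: eq_card => j.
    rewrite !inE mem_grass andbA; congr (_ && _).
    apply/andP/idP => [[jk vj]|ji].
      rewrite ltnNge; apply/negP => ij; have := gv (i := Ordinal iN) (j := j) ij.
      rewrite jk => /(_ isT); lia.
    split; first lia.
    by rewrite ltnS grass_le //= ik.
  have := H1 (v (Ordinal iN)).+1 c; rewrite !E.
  have := lowE g1 i.+1 c iN; have := lowE g2 i.+1 c iN; lia.
have := highE g1 i c; have := highE g2 i c.
have [ni|iN'] := leqP n i.
  have E g : #|[set j : 'I_n | (i <= j) && (g (v j) < c)]| = 0.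
    by rewrite eq_card0 // => j; rewrite !inE; have := ltn_ord j; lia.
  rewrite !E; lia.
have E g : #|[set x | [&& x \notin V, v (Ordinal iN') <= x & g x < c]]|
   = #|[set j : 'I_n | (i <= j) && (g (v j) < c)]|.
  rewrite -[LHS](card_perm_pred v); apply: eq_card => j.
  rewrite !inE mem_grass andbA; congr (_ && _).
  apply/andP/idP => [[jk vj]|ji].
    rewrite leqNgt; apply/negP => ij; have := gv (i := j) (j := Ordinal iN') ij.
    rewrite (leqNgt k) jk orbT => /(_ isT); lia.
  split; first lia.
  by rewrite grass_le //= (ltnW ki) orbT.
have := H2 (v (Ordinal iN')) c; rewrite !E; lia.
Qed.

(** Compared with the identity, the test [b = x.+1], [c = g x] isolates one point: its right-hand
    side is empty as soon as [x < g x]. Outside [V] the argument is dual. *)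
Lemma bruhat_le_grass g : reflect
  (forall x, if x \in V then g x <= x else x <= g x) (bruhat_le (v * g)%g v).
Proof.
rewrite -[v in bruhat_le _ v]mulg1.
apply: (iffP (bruhat_grassP g 1%g)) => [[H1 H2] x|H].
  case: ifP => xV.
    rewrite leqNgt; apply/negP => h; have := H1 x.+1 (g x); rewrite leqNgt => /negP; apply.
    rewrite [X in X < _]eq_card0; last first.
      by move=> z; rewrite !inE perm1; apply/negP => /and3P[_]; lia.
    by apply/card_gt0P; exists x; rewrite inE xV !leqnn.
  rewrite leqNgt; apply/negP => h; have := H2 x (g x).+1; rewrite leqNgt => /negP; apply.
  rewrite [X in X < _]eq_card0; last first.
    by move=> z; rewrite !inE perm1; apply/negP => /and3P[_]; lia.
  by apply/card_gt0P; exists x; rewrite inE xV !leqnn.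
split=> b c; apply/subset_leq_card/subsetP => x; rewrite !inE perm1;
  move=> /and3P[xV xb xc]; rewrite xV xb; have := H x; rewrite ?xV ?(negbTE xV); lia.
Qed.

End Fixed.
End Grassmann.

(** * The positroid described by arcs *)

Section Down.
Variable n : nat.
Implicit Types (w : decperm n) (I : {set 'I_n}).

(* Locked: otherwise [inE] would expand membership in [down w]. *)
Fact down_key : unit. Proof. exact: tt. Qed.
Definition down w : {set 'I_n} :=
  locked_with down_key ([set x | w x < x] :|: clockwise w).

Lemma clockwise_fix w x : x \in clockwise w -> w x = x.
Proof. by move/(subsetP (clockwise_fixed w)); rewrite inE => /eqP. Qed.

Lemma in_down w x : (x \in down w) = (w x < x) || (x \in clockwise w).
Proof. by rewrite [down w]unlock !inE. Qed.

Lemma down_le w x : x \in down w -> w x <= x.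
Proof. by rewrite in_down => /orP[/ltnW //|/clockwise_fix ->]. Qed.

Lemma up_le w x : x \notin down w -> x <= w x.
Proof. by rewrite in_down negb_or -leqNgt => /andP[]. Qed.

Lemma anti_exceedancesE w : anti_exceedances w = (dperm w) @: down w.
Proof.
apply/setP => i; rewrite !inE; apply/idP/imsetP => [/orP[h|h]|[x]].
- by exists ((dperm w)^-1%g i); rewrite ?permKV // in_down permKV h.
- by exists i; rewrite ?clockwise_fix // in_down h orbT.
rewrite in_down => /orP[h|h] ->; first by rewrite permK h.
by rewrite clockwise_fix // h orbT.
Qed.

Lemma card_down k w : has_type k w -> #|down w| = k.
Proof. by move=> <-; rewrite anti_exceedancesE card_imset //; apply: perm_inj. Qed.

Definition down_arcs w (a b : nat) : {set 'I_n} :=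
  [set x in down w | (a <= w x) && (x < b)].

Definition up_arcs w (a b : nat) : {set 'I_n} :=
  [set x in ~: down w | (a <= x) && (w x < b)].

(* The inequalities I_r <=_r I, written out on intervals: up_arcs bounds the
   elements of I in [a, b) from above, and down_arcs those in the complement of
   [a, b), which runs through all cyclic intervals. *)
Fact arc_bases_key : unit. Proof. exact: tt. Qed.
Definition arc_bases w : {set {set 'I_n}} := locked_with arc_bases_key
  [set I : {set 'I_n} | (#|I| == #|down w|) &&
    [forall a : 'I_n.+1, forall b : 'I_n.+1,
      (#|down_arcs w a b| <= #|I :&: seg n a b|)
      && (#|up_arcs w a b| <= #|seg n a b :\: I|)]].

Lemma arc_basesP w I : reflect
  (#|I| = #|down w| /\ forall a b, a <= b <= n ->
      #|down_arcs w a b| <= #|I :&: seg n a b| /\ #|up_arcs w a b| <= #|seg n a b :\: I|)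
  (I \in arc_bases w).
Proof.
rewrite [arc_bases w]unlock inE; apply: (iffP andP) => -[/eqP cI H]; split; rewrite ?cI //.
  move=> a b /andP[ab bn]; have an := leq_trans ab bn.
  move: H => /'forall_forallP H.
  have := H (Ordinal (an : a < n.+1)) (Ordinal (bn : b < n.+1)).
  by move=> /andP.
apply/'forall_forallP => a b; apply/andP.
have [ab|ba] := leqP a b.
  by apply: H; rewrite ab -ltnS ltn_ord.
split.
  rewrite [X in X <= _]eq_card0 // => x; rewrite !inE; apply/negP => /and3P[/down_le]; lia.
rewrite [X in X <= _]eq_card0 // => x; rewrite !inE; apply/negP => /and3P[/up_le]; lia.
Qed.

End Down.

Section Matching.
Variable n : nat.
Implicit Types (g v u y : 'S_n) (w : decperm n) (V I : {set 'I_n}).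

Lemma prefix_comp v g k : prefix_set (v * g)%g k = g @: prefix_set v k.
Proof.
apply/setP => x; apply/imsetP/imsetP => [[j jk ->]|[z /imsetP[j jk ->] ->]].
  by exists (v j); rewrite ?permM ?imset_f.
by exists j; rewrite ?permM.
Qed.

(** The matching sends the r-th element of [V] to the r-th element of [I], and likewise on the
    complements; the Gale inequalities give the directions. *)
Lemma gale_matching V I : gale_le I V -> gale_le (~: V) (~: I) ->
  exists g, forall x, if x \in V then (g x \in I) && (g x <= x)
                      else (g x \notin I) && (x <= g x).
Proof.
move=> gIV gVI; have [cIV _] := gale_leP _ _ gIV; have [cVI _] := gale_leP _ _ gVI.
pose f x := if x \in V then nth x (enum I) (index x (enum V))
            else nth x (enum (~: I)) (index x (enum (~: V))).
have iV x : x \in V -> index x (enum V) < size (enum I).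
  by move=> xV; rewrite -cardE cIV cardE index_mem mem_enum.
have iC x : x \notin V -> index x (enum (~: V)) < size (enum (~: I)).
  by move=> xV; rewrite -cardE -cVI cardE index_mem mem_enum inE.
have fI x : (f x \in I) = (x \in V).
  rewrite /f; case: ifP => xV.
    by rewrite -mem_enum mem_nth ?iV.
  by apply: negbTE; rewrite -in_setC -mem_enum mem_nth ?iC ?xV.
have fi : injective f.
  move=> x z fE; have := fI x; rewrite fE fI; move: fE; rewrite /f => fE ezx.
  move: fE; rewrite -ezx; case: ifP => zV.
    have xV : x \in V by rewrite -ezx.
    rewrite (set_nth_default z) ?iV // => /eqP; rewrite nth_uniq ?iV ?enum_uniq //.
    by move=> /eqP /(index_inj x); apply; rewrite mem_enum.
  have xV : x \notin V by rewrite -ezx zV.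
  rewrite (set_nth_default z) ?iC ?zV // => /eqP; rewrite nth_uniq ?iC ?enum_uniq ?zV //.
  by move=> /eqP /(index_inj x); apply; rewrite mem_enum inE ?zV.
exists (perm fi) => x; rewrite permE fI; case: ifP => xV; rewrite /f xV /=.
  have := gale_le_nth (i := index x (enum V)) x gIV.
  by rewrite cardE iV // nth_index ?mem_enum //; apply.
have := gale_le_nth (i := index x (enum (~: V))) x gVI.
by rewrite cVI cardE iC ?xV // nth_index ?mem_enum ?inE ?xV //; apply.
Qed.

Lemma sum_swap_lt g (x x' : 'I_n) : x < x' -> g x < g x' ->
  \sum_(z : 'I_n) z * (tperm x x' * g)%g z < \sum_(z : 'I_n) z * g z.
Proof.
move=> xx' gxx'; have nx : x' != x by apply: contraTneq xx' => ->; rewrite ltnn.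
rewrite (bigD1 x) // (bigD1 x') //= [X in _ < X](bigD1 x) // [X in _ < _ + X](bigD1 x') //=.
have -> : \sum_(i < n | (i != x) && (i != x')) i * (tperm x x' * g)%g i
        = \sum_(i < n | (i != x) && (i != x')) i * g i.
  by apply: eq_bigr => z /andP[zx zx']; rewrite permM tpermD // eq_sym.
rewrite !permM tpermL tpermR !addnA ltn_add2r.
move: (nat_of_ord x) (nat_of_ord x') (nat_of_ord (g x)) (nat_of_ord (g x')) xx' gxx'.
by move=> a b c d /subnKC <- /subnKC <-; nia.
Qed.

(* A matching minimizing the sum of x * g x has no two arcs of the same kind
   that cross, and therefore has as many short arcs as possible. *)
Lemma arc_matching w I : I \in arc_bases w ->
  exists g, [/\ g @: down w = I,
   forall x, if x \in down w then g x <= x else x <= g x,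
   forall b c : nat, #|[set x | [&& x \in down w, x < b & c <= w x]]|
                   <= #|[set x | [&& x \in down w, x < b & c <= g x]]| &
   forall b c : nat, #|[set x | [&& x \notin down w, b <= x & w x < c]]|
                   <= #|[set x | [&& x \notin down w, b <= x & g x < c]]|].
Proof.
move=> /arc_basesP[cI H]; set V := down w in cI H *.
have hV c : #|[set x in V | x < c]| <= #|[set x in I | x < c]|.
  wlog cn : c / c <= n.
    move=> h; have [|nc] := leqP c n; first exact: h.
    have E (J : {set 'I_n}) : #|[set x in J | x < c]| = #|J|.
      by apply: eq_card => x; rewrite inE (leq_trans (ltn_ord x) (ltnW nc)) andbT.
    by rewrite !E cI.
  have [h _] := H 0 c cn; apply: leq_trans (leq_trans h _).
    by apply/subset_leq_card/subsetP => x; rewrite !inE.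
  by apply/subset_leq_card/subsetP => x; rewrite !inE => /and3P[-> _ ->].
have g1 : gale_le I V by apply/gale_leP.
have g2 : gale_le (~: V) (~: I).
  have cE (J : {set 'I_n}) c : #|[set x in ~: J | x < c]| + #|[set x in J | x < c]|
     = #|[set x : 'I_n | x < c]|.
    rewrite -[RHS](card_pair_split _ (fun x : 'I_n => x \notin J)).
    by congr (_ + _); apply: eq_card => x; rewrite !inE ?negbK andbC.
  apply/gale_leP; split; first by have := cardsC V; have := cardsC I; lia.
  by move=> c; have := cE V c; have := cE I c; have := hV c; lia.
pose P (g : 'S_n) := [forall x, if x \in V then (g x \in I) && (g x <= x)
                      else (g x \notin I) && (x <= g x)].
have [g0 /forallP Pg0] := gale_matching g1 g2.
have [g /forallP Pg gmin] := @arg_minnP _ g0 P (fun g => \sum_(z : 'I_n) z * g z) Pg0.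
have PI x : (g x \in I) = (x \in V).
  by have := Pg x; case: ifP => _ /andP[] // /negbTE.
have Ple x : if x \in V then g x <= x else x <= g x.
  by have := Pg x; case: ifP => _ /andP[].
have noswap (x x' : 'I_n) : x < x' -> g x < g x' -> P (tperm x x' * g)%g -> False.
  by move=> h1 h2 /gmin; rewrite leqNgt sum_swap_lt.
(* After the swap [x] goes to [g x' <= x] and [x'] to [g x < x'], so the matching stays admissible
   and minimality is violated. *)
have noV (x x' : 'I_n) : x \in V -> x' \in V -> x < x' -> g x < g x' -> g x' <= x -> False.
  move=> xV xV' h1 h2 h3; apply: (noswap x x') => //; apply/forallP => z.
  rewrite permM; case: tpermP => [->|->|_ _]; last exact: Pg.
    by rewrite xV PI xV'.
  by rewrite xV' PI xV; have := Pg x; rewrite xV; lia.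
have noC (x x' : 'I_n) : x \notin V -> x' \notin V -> x < x' -> g x < g x' -> x' <= g x -> False.
  move=> xV xV' h1 h2 h3; apply: (noswap x x') => //; apply/forallP => z.
  rewrite permM; case: tpermP => [->|->|_ _]; last exact: Pg.
    by rewrite (negbTE xV) PI (negbTE xV') /=; have := Pg x'; rewrite (negbTE xV'); lia.
  by rewrite (negbTE xV') PI (negbTE xV) /=.
exists g; split=> //.
- apply/eqP; rewrite eqEcard card_imset; last exact: perm_inj.
  by rewrite cI leqnn andbT; apply/subsetP => _ /imsetP[x xV ->]; rewrite PI.
(* Let [m] be the last downward start in [[c, b)] matched below [c]. Beyond [m] every start counted
   for [w] is counted for [g]. Up to [m], the bound for [[c, m.+1)] supplies enough elements of [I],
   and [noV] forces each to be matched from a point at most [m]. *)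
- move=> b c; pose Q (x : 'I_n) := [&& x \in V, c <= x, x < b & g x < c].
  have [x0 Qx0|noQ] := pickP Q; last first.
    apply/subset_leq_card/subsetP => x; rewrite !inE => /and3P[xV xb cx].
    rewrite xb xV /=; have := noQ x; rewrite /Q xV xb /=; have := down_le xV; lia.
  have [m /and4P[mV cm mb gm] mmax] := @arg_maxnP _ x0 Q (fun x => nat_of_ord x) Qx0.
  have hs f : #|[set x | [&& x \in V, x < b & c <= f x]]|
      = #|[set x | [&& x \in V, x < m.+1 & c <= f x]]|
         + #|[set x : 'I_n| [&& x \in V, m < x, x < b & c <= f x]]|.
    rewrite -[LHS](card_pair_split _ (fun x : 'I_n => x <= m)); congr (_ + _).
      apply: eq_card => x; rewrite !inE; lia.
    by apply: eq_card => x; rewrite !inE; lia.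
  rewrite !hs; apply: leq_add; last first.
    apply/subset_leq_card/subsetP => x; rewrite !inE => /and4P[xV mx xb _].
    rewrite xV mx xb /= leqNgt; apply/negP => gx.
    have := mmax x; rewrite /Q xV xb gx; lia.
  have [h _] : #|down_arcs w c m.+1| <= #|I :&: seg n c m.+1| /\ #|up_arcs w c m.+1| <= #|seg n c m.+1 :\: I|.
    by apply: H; rewrite (leqW cm) ltn_ord.
  have {}h : #|[set x | [&& x \in V, x < m.+1 & c <= w x]]| <= #|I :&: seg n c m.+1|.
    apply: leq_trans h; apply/subset_leq_card/subsetP => x; rewrite !inE -/V; lia.
  apply: leq_trans h _.
  rewrite -[X in _ <= X](card_imset _ (@perm_inj _ g)).
  apply/subset_leq_card/subsetP => i; rewrite !inE => /and3P[iI ci im].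
  apply/imsetP; exists (g^-1%g i); rewrite ?permKV // inE permKV ci andbT.
  have xV : g^-1%g i \in V by rewrite -PI permKV.
  rewrite xV /= ltnS leqNgt; apply/negP => mx.
  by apply: (noV m (g^-1%g i)) => //; rewrite permKV; lia.
- move=> b c; pose Q (x : 'I_n) := [&& x \notin V, b <= x, x < c & c <= g x].
  have [x0 Qx0|noQ] := pickP Q; last first.
    apply/subset_leq_card/subsetP => x; rewrite !inE => /and3P[xV xb cx].
    rewrite xb xV /=; have := noQ x; rewrite /Q xV xb /=; have := up_le xV; lia.
  have [m /and4P[mV bm mc gm] mmin] := @arg_minnP _ x0 Q (fun x => nat_of_ord x) Qx0.
  have hs f : #|[set x | [&& x \notin V, b <= x & f x < c]]|
      = #|[set x | [&& x \notin V, m <= x & f x < c]]|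
         + #|[set x : 'I_n| [&& x \notin V, x < m, b <= x & f x < c]]|.
    rewrite -[LHS](card_pair_split _ (fun x : 'I_n => m <= x)); congr (_ + _).
      apply: eq_card => x; rewrite !inE; lia.
    by apply: eq_card => x; rewrite !inE; lia.
  rewrite !hs; apply: leq_add; last first.
    apply/subset_leq_card/subsetP => x; rewrite !inE => /and4P[xV mx bx _].
    rewrite xV mx bx /= ltnNge; apply/negP => gx; have := mmin x; rewrite /Q xV bx gx andbT /=.
    by lia.
  have [_ h] : #|down_arcs w m c| <= #|I :&: seg n m c| /\ #|up_arcs w m c| <= #|seg n m c :\: I|.
    by apply: H; rewrite (ltnW mc) (leq_trans gm) // ltnW.
  have {}h : #|[set x | [&& x \notin V, m <= x & w x < c]]| <= #|seg n m c :\: I|.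
    by apply: leq_trans h; apply/subset_leq_card/subsetP => x; rewrite !inE.
  apply: leq_trans h _.
  rewrite -[X in _ <= X](card_imset _ (@perm_inj _ g)).
  apply/subset_leq_card/subsetP => i; rewrite !inE => /and3P[iI mi ic].
  apply/imsetP; exists (g^-1%g i); rewrite ?permKV // inE permKV ic andbT.
  have xV : g^-1%g i \notin V by rewrite -PI permKV.
  rewrite xV /= leqNgt; apply/negP => mx.
  by apply: (noC (g^-1%g i) m) => //; rewrite permKV; lia.
Qed.

Lemma grassmann_interval_prefix k w u v :
  grassmann_interval k w u v -> prefix_set v k = down w.
Proof.
move=> [_ -> _]; rewrite anti_exceedancesE -imset_comp -[RHS]imset_id.
by apply: eq_imset => x /=; rewrite permK.
Qed.

(** With [y = v * g], the set [y[k]] is [g @: down w], the bound [y <= v] fixes the directions of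
    the arcs of [g], and [u <= y] says that [g] has at least as many arcs inside each interval as
    [w]. The ends of these arcs fill the intervals; the minimal matching gives the converse. *)
Theorem positroidE k w u v : has_type k w -> grassmann_interval k w u v ->
  positroid k u v = arc_bases w.
Proof.
move=> hw huv; have cV := card_down hw; have vV := grassmann_interval_prefix huv.
have [gv _ ->] := huv.
apply/setP => I; apply/imsetP/idP => [[y]|/arc_matching[g [gI gle h1 h2]]]; last first.
  exists (v * g)%g; last by rewrite prefix_comp vV.
  rewrite inE; apply/andP; split; first exact/(bruhat_grassP gv vV).
  exact/(bruhat_le_grass gv vV).
rewrite inE -[y](mulKVg v) => /andP[/(bruhat_grassP gv vV)[h1 h2]].
set g := (_ * y)%g => /(bruhat_le_grass gv vV) gle.
rewrite prefix_comp vV => ->; apply/arc_basesP; rewrite card_imset; last exact: perm_inj.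
split=> // a b _; split.
  apply: leq_trans (leq_trans (h1 b a) _).
    by apply/subset_leq_card/subsetP => x; rewrite !inE => /and3P[-> -> ->].
  rewrite -[X in X <= _](card_imset _ (@perm_inj _ g)).
  apply/subset_leq_card/subsetP => _ /imsetP[x + ->]; rewrite !inE => /and3P[xV xb agx].
  by rewrite mem_imset ?xV ?agx //=; [have := gle x; rewrite xV; lia | exact: perm_inj].
apply: leq_trans (leq_trans (h2 a b) _).
  by apply/subset_leq_card/subsetP => x; rewrite !inE => /and3P[-> -> ->].
rewrite -[X in X <= _](card_imset _ (@perm_inj _ g)).
apply/subset_leq_card/subsetP => _ /imsetP[x + ->]; rewrite !inE => /and3P[xV xb agx].
rewrite mem_imset ?xV ?agx ?andbT //=; last exact: perm_inj.
by have := gle x; rewrite (negbTE xV); lia.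
Qed.

End Matching.

(** * Alignments and lengths *)

Section Alignments.
Variable n : nat.
Implicit Types (g v u y : 'S_n) (w : decperm n) (V I : {set 'I_n}).

Lemma cyc_distE (a b : 'I_n) : cyc_dist a b = if a <= b then b - a else b + n - a.
Proof.
have an := ltn_ord a; have bn := ltn_ord b; rewrite /cyc_dist; case: leqP => ab.
  by rewrite -addnBAC // modnDr modn_small //; lia.
by rewrite modn_small //; lia.
Qed.

(** Relative to the cut at 0, arcs of the same direction are aligned when nested, the port arc being
    outside if both go down and inside if both go up. With opposite directions the port arc must go
    up, and only [p < s] together with [w s < w p] fails. Loops fit in because clockwise ones count
    as downward. *)
Lemma is_alignmentE w p s : is_alignment w p s =
  [|| [&& p \notin down w, s \in down w & (s < p) || (w p < w s)]
    | [&& (p \in down w) ==> (s \in down w), s < p & w p < w s]].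
Proof.
rewrite /is_alignment !inE !cyc_distE.
have := ltn_ord p; have := ltn_ord s; have := ltn_ord (w p); have := ltn_ord (w s).
have wps : (w p == w s) = (p == s) by rewrite (inj_eq perm_inj).
have cp := @clockwise_fix _ w p; have cs := @clockwise_fix _ w s.
have {}cp : p \in clockwise w -> nat_of_ord (w p) = p by move/cp ->.
have {}cs : s \in clockwise w -> nat_of_ord (w s) = s by move/cs ->.
move: wps cp cs; rewrite !in_down -!val_eqE /=.
case: (p \in clockwise w); case: (s \in clockwise w);
move: (nat_of_ord p) (nat_of_ord s) (nat_of_ord (w p)) (nat_of_ord (w s)) => a b c d.
all: move=> e1 e2 e3 h1 h2 h3 h4; rewrite ?(e2 isT) ?(e3 isT) in e1 h1 h2 h3 h4 *.
all: case: (leqP a b) => ?; case: (leqP a c) => ?; case: (leqP a d) => ?.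
all: rewrite /= ?orbT ?orbF ?andbT ?andbF ?implybT ?eqxx /=; apply/idP/idP; lia.
Qed.

Section Length.
Variables (k : nat) (w : decperm n) (v : 'S_n).
Hypotheses (gv : grassmannian k v) (vV : prefix_set v k = down w).
Let V := down w.

Lemma grass_lt (i j : 'I_n) : (i < j) =
  ((v i \in V) && (v j \notin V)) || (((v j \in V) ==> (v i \in V)) && (v i < v j)).
Proof.
rewrite !(mem_grass vV).
have h1 := @gv i j; have h2 := @gv j i.
have e : (nat_of_ord i == j) -> nat_of_ord (v i) = v j by move/eqP/val_inj ->.
lia.
Qed.

Lemma card_perm_pair (p : rel 'I_n) : #|[set q : 'I_n * 'I_n | p (v q.1) (v q.2)]| = #|[set q | p q.1 q.2]|.
Proof.
have vi : injective (fun q : 'I_n * 'I_n => (v q.1, v q.2)).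
  by move=> [a b] [c d] /= [/perm_inj -> /perm_inj ->].
rewrite -(card_imset [set q : 'I_n * 'I_n | p (v q.1) (v q.2)] vi); apply: eq_card => -[x z].
rewrite !inE /=; apply/imsetP/idP => [[[a b]]|h].
  by rewrite inE /= => h [-> ->].
by exists (v^-1%g x, v^-1%g z); rewrite ?inE /= !permKV.
Qed.

(** Transported along [v], everything is counted on pairs [(x, z)] of values, an alignment being
    read as [(s, p)]. All pairs of [setX V (~: V)] with [x < z] are aligned. The other alignments
    are the inversions of [v * w], and the other pairs of [setX V (~: V)] are the inversions of
    [v]. *)
Lemma card_alignments_length :
  #|alignments w| + perm_length v = #|V| * (n - #|V|) + perm_length (v * dperm w)%g.
Proof.
have -> : perm_length v = #|[set q : 'I_n * 'I_n | [&& q.1 \in V, q.2 \notin V & q.2 < q.1]]|.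
  rewrite -[RHS](card_perm_pair (fun x z => [&& x \in V, z \notin V & z < x])); apply: eq_card => -[i j]; rewrite !inE /= grass_lt.
  have := @down_le; lia.
have -> : perm_length (v * dperm w)%g = #|[set q : 'I_n * 'I_n |
   [&& q.1 \in V & q.2 \notin V] && (w q.2 < w q.1) ||
   [&& (q.2 \in V) ==> (q.1 \in V), q.1 < q.2 & w q.2 < w q.1]]|.
  rewrite -[RHS](card_perm_pair (fun x z => [&& x \in V & z \notin V] && (w z < w x) ||
   [&& (z \in V) ==> (x \in V), x < z & w z < w x])); apply: eq_card => -[i j]; rewrite !inE /= grass_lt !permM.
  lia.
have -> : #|alignments w| = #|[set q : 'I_n * 'I_n |
   [&& q.1 \in V, q.2 \notin V & (q.1 < q.2) || (w q.2 < w q.1)] ||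
   [&& (q.2 \in V) ==> (q.1 \in V), q.1 < q.2 & w q.2 < w q.1]]|.
  have si : injective (fun q : 'I_n * 'I_n => (q.2, q.1)) by move=> [a b] [c d] /= [-> ->].
  rewrite -(card_imset (alignments w) si); apply: eq_card => -[x z].
  rewrite !inE /=; apply/imsetP/idP => [[[p s]]|h].
    by rewrite inE /= is_alignmentE => h [-> ->]; move: h; rewrite -/V; lia.
  by exists (z, x) => //; rewrite inE /= is_alignmentE -/V; lia.
have -> : #|V| * (n - #|V|) = #|setX V (~: V)|.
  by rewrite cardsX; congr (_ * _); have := cardsC V; rewrite card_ord; lia.
pose C : pred ('I_n * 'I_n) := fun q => [&& q.1 \in V, q.2 \notin V & q.1 < q.2].
have sp (S : {set 'I_n * 'I_n}) (p : pred ('I_n * 'I_n)) :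
    #|S| = #|[set q in S | p q]| + #|[set q in S | ~~ p q]|.
  rewrite -[LHS](cardsID [set q | p q]); congr (_ + _); apply: eq_card => q; by rewrite !inE // andbC.
rewrite [X in X + _ = _](sp _ C) [X in _ = X + _](sp _ C).
set A1 := #|_|; set A2 := #|_|; set A3 := #|_|; set B1 := #|_|; set B2 := #|_|; set B3 := #|_|.
have e1 : A1 = B1.
  apply: eq_card => -[x z]; rewrite !inE /C /=; lia.
have e2 : A2 = B3.
  apply: eq_card => -[x z]; rewrite !inE /C /=.
  have := @down_le _ w x; have := @up_le _ w z; rewrite -/V; lia.
have e3 : A3 = B2.
  apply: eq_card => -[x z]; rewrite !inE /C /=.
  have e : nat_of_ord x = z -> (x \in V) = (z \in V) by move/val_inj ->.
  lia.
lia.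
Qed.

End Length.
End Alignments.

(** * Rotation *)

Section Rotation.
Variable n : nat.
Implicit Types (w : decperm n) (V I J : {set 'I_n}).

Definition rotp : 'S_n := perm (@ordS_inj n).

Lemma rotpE (i : 'I_n) : nat_of_ord (rotp i) = if i.+1 == n then 0 else i.+1.
Proof.
rewrite permE /=; case: eqP => [->|]; first by rewrite modnn.
by move=> ne; rewrite modn_small //; have := ltn_ord i; lia.
Qed.

Lemma cyc_dist_rot (a b : 'I_n) : cyc_dist (rotp a) (rotp b) = cyc_dist a b.
Proof.
have an := ltn_ord a; have bn := ltn_ord b; rewrite !cyc_distE !rotpE.
case: (leqP a b) => h; do 2?case: eqP => ?; case: leqP => ?; lia.
Qed.

Lemma in_cyc_interval (a b x : 'I_n) :
  (x \in cyc_interval a b) = (cyc_dist a x <= cyc_dist a b).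
Proof.
have an := ltn_ord a; have bn := ltn_ord b; have xn := ltn_ord x.
rewrite /cyc_interval !cyc_distE; case: leqP => h; rewrite inE; case: leqP => h'; lia.
Qed.

Lemma rot_fixed w : rotp @: clockwise w \subset
  [set i | (rotp^-1 * dperm w * rotp)%g i == i].
Proof.
apply/subsetP => _ /imsetP[i iw ->].
by rewrite inE !permM permK clockwise_fix.
Qed.

Definition rotate_dec w := DecPerm (rot_fixed w).

Lemma rotE w i : rotate_dec w (rotp i) = rotp (w i).
Proof. by rewrite /= !permM permK. Qed.

Lemma clockwise_rot w i : (rotp i \in clockwise (rotate_dec w)) = (i \in clockwise w).
Proof. by rewrite /= mem_imset //; apply: perm_inj. Qed.

Lemma is_alignment_rot w p s : is_alignment (rotate_dec w) (rotp p) (rotp s) = is_alignment w p s.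
Proof.
by rewrite /is_alignment !inE !rotE !cyc_dist_rot !clockwise_rot !(inj_eq perm_inj).
Qed.

Lemma card_alignments_rot w : #|alignments (rotate_dec w)| = #|alignments w|.
Proof.
have ri : injective (fun q : 'I_n * 'I_n => (rotp q.1, rotp q.2)).
  by move=> [a b] [c d] /= [/perm_inj -> /perm_inj ->].
rewrite -(card_imset (alignments w) ri); apply: eq_card => -[x z].
rewrite !inE /=; apply/idP/imsetP => [h|[[p s]]].
  exists (rotp^-1%g x, rotp^-1%g z); rewrite ?inE /= ?permKV //.
  by rewrite -is_alignment_rot !permKV.
by rewrite inE /= => h [-> ->]; rewrite is_alignment_rot.
Qed.

Section Complement.
Variables (w : decperm n) (I : {set 'I_n}).
Hypothesis cI : #|I| = #|down w|.

(** The arcs ending below [a] are the downward ones ending there and the upward ones inside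
    [[0, a)]. Hence each side on [[a, n)] is [#|down w| - a] plus the corresponding side on
    [[0, a)]: complementation exchanges the two bounds. *)
Lemma down_tail a : a <= n ->
  (#|down_arcs w a n| <= #|I :&: seg n a n|) = (#|up_arcs w 0 a| <= #|seg n 0 a :\: I|).
Proof.
move=> an.
have h1 : #|I :&: seg n 0 a| + #|I :&: seg n a n| = #|I|.
  rewrite -[RHS](card_pair_split _ (fun x : 'I_n => x < a)).
  congr (_ + _); apply: eq_card => x; rewrite !inE ?ltn_ord ?leq0n ?andbT -?leqNgt //; lia.
have h2 : #|I :&: seg n 0 a| + #|seg n 0 a :\: I| = a.
  by rewrite setIC cardsID card_segr ?subn0.
have h3 : #|[set x in down w | w x < a]| + #|down_arcs w a n| = #|down w|.
  rewrite -[RHS](card_pair_split _ (fun x : 'I_n => w x < a)).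
  congr (_ + _); apply: eq_card => x; rewrite !inE ?ltn_ord ?leq0n ?andbT -?leqNgt //; lia.
have h4 : #|[set x in down w | w x < a]| + #|up_arcs w 0 a| = a.
  rewrite -[RHS](card_ltn an) -[RHS](card_perm_pred (dperm w) (fun x => x < a)).
  rewrite -[RHS](card_pair_split _ (fun x : 'I_n => x \in down w)).
  congr (_ + _); apply: eq_card => x; rewrite !inE; lia.
lia.
Qed.

Lemma up_tail a : a <= n ->
  (#|up_arcs w a n| <= #|seg n a n :\: I|) = (#|down_arcs w 0 a| <= #|I :&: seg n 0 a|).
Proof.
move=> an.
have h1 : #|I :&: seg n 0 a| + #|I :&: seg n a n| = #|I|.
  rewrite -[RHS](card_pair_split _ (fun x : 'I_n => x < a)).
  congr (_ + _); apply: eq_card => x; rewrite !inE ?ltn_ord ?leq0n ?andbT -?leqNgt //; lia.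
have h2 : #|I :&: seg n a n| + #|seg n a n :\: I| = n - a.
  by rewrite setIC cardsID card_segr ?an ?leqnn.
have h3 : #|down_arcs w 0 a| + #|[set x in down w | a <= x]| = #|down w|.
  rewrite -[RHS](card_pair_split _ (fun x : 'I_n => x < a)).
  congr (_ + _); apply: eq_card => x; rewrite !inE ?ltn_ord ?leq0n ?andbT -?leqNgt //; lia.
have h4 : #|[set x in down w | a <= x]| + #|up_arcs w a n| = n - a.
  rewrite -(@card_segr n) ?an ?leqnn //.
  rewrite -[RHS](card_pair_split _ (fun x : 'I_n => x \in down w)).
  congr (_ + _); apply: eq_card => x; rewrite !inE ?ltn_ord ?leq0n ?andbT -?leqNgt //; lia.
lia.
Qed.

Definition arc_bound a b :=
  #|down_arcs w a b| <= #|I :&: seg n a b| /\ #|up_arcs w a b| <= #|seg n a b :\: I|.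

Lemma arc_bound_full : arc_bound 0 n.
Proof.
have h1 : #|I :&: seg n 0 n| = #|I|.
  by apply: eq_card => x; rewrite !inE ltn_ord leq0n !andbT.
have h2 : #|down_arcs w 0 n| = #|down w|.
  by apply: eq_card => x; rewrite !inE ltn_ord leq0n !andbT.
split; first by rewrite h1 h2 cI.
rewrite up_tail //.
by rewrite (_ : down_arcs _ _ _ = set0) ?cards0 //; apply/setP => x; rewrite !inE andbF.
Qed.

Lemma arc_bound_compl a : a <= n -> arc_bound a n <-> arc_bound 0 a.
Proof. by move=> an; rewrite /arc_bound down_tail // up_tail //; split=> -[]. Qed.

(** Rotation shifts [[a, b)] with [b < n] to [[a.+1, b.+1)], taking the intervals that avoid the
    last point to those that avoid the first. By complementation either family implies all the
    bounds, whence the invariance under rotation. *)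
Lemma arc_bases_init : (I \in arc_bases w) <-> forall a b, a <= b < n -> arc_bound a b.
Proof.
split=> [/arc_basesP[_ H] a b /andP[ab bn]|H]; first by apply: H; rewrite ab ltnW.
apply/arc_basesP; split=> // a b /andP[ab]; rewrite leq_eqVlt => /orP[/eqP->|bn]; last first.
  by apply: H; rewrite ab.
have [->|a0] := posnP a; first exact: arc_bound_full.
have [an|na] := ltnP a n; first by apply/(arc_bound_compl (ltnW an)); apply: H; rewrite an.
split; first by rewrite (_ : down_arcs _ _ _ = set0) ?cards0 //; apply/setP => x; rewrite !inE; have := ltn_ord (w x); lia.
by rewrite (_ : up_arcs _ _ _ = set0) ?cards0 //; apply/setP => x; rewrite !inE; have := ltn_ord x; lia.
Qed.

Lemma arc_bases_tail : (I \in arc_bases w) <-> forall a b, 0 < a -> a <= b <= n -> arc_bound a b.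
Proof.
split=> [/arc_basesP[_ H] a b a0 ab|H]; first exact: H.
apply/arc_basesP; split=> // a b /andP[ab bn].
have [->|a0] := posnP a; last by apply: H; rewrite ?ab.
have [->|b0] := posnP b.
  split; first by rewrite (_ : down_arcs _ _ _ = set0) ?cards0 //; apply/setP => x; rewrite !inE andbF.
  by rewrite (_ : up_arcs _ _ _ = set0) ?cards0 //; apply/setP => x; rewrite !inE andbF.
by apply/(arc_bound_compl bn); apply: H; rewrite // bn leqnn.
Qed.

End Complement.

Lemma in_down_rot w x : (rotp x \in down (rotate_dec w)) = (rotp (w x) < rotp x) || (x \in clockwise w).
Proof. by rewrite in_down rotE clockwise_rot. Qed.

(** Only two arcs change direction when the last point is moved to the front: the one starting there
    turns upward and the one ending there turns downward. A loop there keeps its direction, given by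
    its colour. *)
Lemma card_down_rot w : #|down (rotate_dec w)| = #|down w|.
Proof.
have [n0|n_gt0] := posnP n.
  by rewrite !eq_card0 // => x; have := ltn_ord x; rewrite [X in _ < X]n0.
have en : n.-1 < n by rewrite prednK.
pose e := Ordinal en; pose f := (dperm w)^-1%g e.
have wf : w f = e by rewrite permKV.
have -> : #|down (rotate_dec w)| = #|[set x | rotp x \in down (rotate_dec w)]|.
  by rewrite (card_perm_pred rotp (fun x => x \in down (rotate_dec w))) cardsE.
have wx x : (nat_of_ord (w x) == n.-1) = (x == f).
  by rewrite -(inj_eq (@perm_inj _ (dperm w))) wf.
have [ef|ef] := eqVneq e f.
  have we : w e = e by rewrite {1}ef wf.
  apply: eq_card => x; rewrite !inE in_down_rot in_down !rotpE.
  have h1 := ltn_ord x; have h2 := ltn_ord (w x); have := wx x.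
  rewrite -ef -val_eqE /= => h3; case: eqP => ?; case: eqP => ?; lia.
have we : nat_of_ord (w e) != n.-1 by rewrite wx.
have eD : e \in down w by rewrite in_down; have := ltn_ord (w e) => /=; lia.
have fD : f \notin down w.
  apply/negP => /down_le; rewrite wf /= => h; move/eqP: ef; apply; apply: val_inj => /=.
  have := ltn_ord f; lia.
have -> : [set x | rotp x \in down (rotate_dec w)] = f |: (down w :\ e).
  apply/setP => x; rewrite !inE in_down_rot in_down !rotpE.
  have h1 := ltn_ord x; have h2 := ltn_ord (w x); have h3 := wx x.
  have cl : x \in clockwise w -> nat_of_ord (w x) = x by move/clockwise_fix ->.
  have -> : (x == e) = (nat_of_ord x == n.-1) by [].
  have hxe : nat_of_ord x = n.-1 -> nat_of_ord (w x) <> n.-1.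
    by move=> xe; have -> : x = e; [exact: val_inj | move/eqP: we].
  case: eqP => ?; case: eqP => ?; lia.
rewrite cardsU1 !inE negb_and fD orbT /=.
by rewrite (cardsD1 e (down w)) eD.
Qed.

Lemma arc_bound_rot w I a b : b < n ->
  arc_bound (rotate_dec w) (rotp @: I) a.+1 b.+1 <-> arc_bound w I a b.
Proof.
move=> bn; rewrite /arc_bound.
have setE (A : {set 'I_n}) : #|A| = #|[set x | rotp x \in A]|.
  by rewrite (card_perm_pred rotp (fun x => x \in A)) cardsE.
rewrite (setE (down_arcs (rotate_dec w) _ _)) (setE (up_arcs (rotate_dec w) _ _)).
rewrite (setE (rotp @: I :&: _)) (setE (_ :\: rotp @: I)).
have -> : [set x | rotp x \in down_arcs (rotate_dec w) a.+1 b.+1] = down_arcs w a b.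
  apply/setP => x; rewrite !inE in_down_rot in_down rotE !rotpE.
  have cl : x \in clockwise w -> nat_of_ord (w x) = x by move/clockwise_fix ->.
  have h1 := ltn_ord x; have h2 := ltn_ord (w x).
  case: eqP => ?; case: eqP => ?; lia.
have -> : [set x | rotp x \in up_arcs (rotate_dec w) a.+1 b.+1] = up_arcs w a b.
  apply/setP => x; rewrite !inE in_down_rot in_down rotE !rotpE.
  have h1 := ltn_ord x; have h2 := ltn_ord (w x).
  case: eqP => ?; case: eqP => ?; lia.
have -> : [set x | rotp x \in rotp @: I :&: seg n a.+1 b.+1] = I :&: seg n a b.
  apply/setP => x; rewrite !inE mem_imset; last exact: perm_inj.
  rewrite rotpE; case: eqP => ? //; lia.
have -> : [set x | rotp x \in seg n a.+1 b.+1 :\: rotp @: I] = seg n a b :\: I.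
  apply/setP => x; rewrite !inE mem_imset; last exact: perm_inj.
  rewrite rotpE; case: eqP => ? //; lia.
by [].
Qed.

Lemma arc_bases_rot w I : (rotp @: I \in arc_bases (rotate_dec w)) = (I \in arc_bases w).
Proof.
have cr : #|rotp @: I| = #|I| by rewrite card_imset //; apply: perm_inj.
have [cI|cI] := eqVneq #|I| #|down w|; last first.
  by apply/arc_basesP/arc_basesP => -[+ _]; rewrite ?cr ?card_down_rot => /eqP; rewrite (negbTE cI).
have cI' : #|rotp @: I| = #|down (rotate_dec w)| by rewrite cr card_down_rot.
apply/idP/idP => [/(arc_bases_tail cI') H|/(arc_bases_init cI) H].
  apply/(arc_bases_init cI) => a b.
  by move=> /andP[ab bn]; apply/(arc_bound_rot _ _ _ bn); apply: (H a.+1 b.+1); rewrite // ltnS ab.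
apply/(arc_bases_tail cI') => -[//|a] [//|b] _; rewrite ltnS => /andP[ab bn].
by apply/(arc_bound_rot _ _ _ bn); apply: H; rewrite ab.
Qed.

Definition adjacent_nonbases w J : {set {set 'I_n}} :=
  [set I | [&& I \notin arc_bases w, #|I| == #|J| & #|I :&: J|.+1 == #|J|]].

Lemma card_adjacent_nonbases_rot w J :
  #|adjacent_nonbases (rotate_dec w) (rotp @: J)| = #|adjacent_nonbases w J|.
Proof.
have ri : injective (fun I : {set 'I_n} => rotp @: I) by apply/imset_inj/perm_inj.
rewrite -(card_imset (adjacent_nonbases w J) ri); apply: eq_card => I.
have IE : I = rotp @: (rotp^-1%g @: I).
  by rewrite -imset_comp -[LHS]imset_id; apply: eq_imset => x /=; rewrite permKV.
rewrite IE mem_imset // !inE arc_bases_rot -imsetI; last by move=> x y _ _ /perm_inj.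
by rewrite !card_imset //; apply: perm_inj.
Qed.

End Rotation.

(** * Exchanges out of the minimal basis *)

Section Exchange.
Variable T : finType.
Implicit Types (I J : {set T}).

Lemma card_exchange J (Q : pred {set T}) :
  #|[set I | [&& Q I, #|I| == #|J| & #|I :&: J|.+1 == #|J|]]|
  = #|[set q : T * T | [&& q.1 \in J, q.2 \notin J & Q (q.2 |: (J :\ q.1))]]|.
Proof.
pose f (q : T * T) := q.2 |: (J :\ q.1).
set S := [set q : T * T | _].
have fI : {in S &, injective f}.
  move=> [c d] [c' d']; rewrite !inE /= => /and3P[cJ dJ _] /and3P[cJ' dJ' _] /setP e.
  have cd : c != d by apply: contraTneq cJ => ->.
  have cd' : c != d' by apply: contraTneq cJ => ->.
  have := e c; have := e d.
  rewrite !inE !eqxx (negbTE cd) (negbTE cd') cJ (negbTE dJ) /= ?andbF ?andbT ?orbF.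
  by move=> /esym/eqP -> /esym/negbFE/eqP ->.
rewrite -(card_in_imset fI); apply: eq_card => I; rewrite inE.
apply/and3P/imsetP => [[QI /eqP cI /eqP cIJ]|[[c d]]]; last first.
  rewrite inE /= => /and3P[cJ dJ Qf] ->; rewrite /f /=.
  have cJ1 : #|J| = #|J :\ c|.+1 by rewrite (cardsD1 c) cJ.
  split=> //; first by rewrite cardsU1 !inE (negbTE dJ) andbF cJ1.
  rewrite (_ : (_ |: _) :&: J = J :\ c) -?cJ1 //; apply/setP => x; rewrite !inE.
  by case: (x =P d) => [->|_]; rewrite ?(negbTE dJ) ?andbF // -andbA andbb.
have h1 : #|I :\: J| == 1 by have := cardsID J I; lia.
have h2 : #|J :\: I| == 1 by have := cardsID I J; rewrite setIC; lia.
have /cards1P[d /setP dE] := h1; have /cards1P[c /setP cE] := h2.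
have := cE c; have := dE d; rewrite !inE !eqxx => /andP[dJ dI] /andP[cI' cJ].
have IE : I = f (c, d).
  apply/setP => x; rewrite !inE; have := cE x; have := dE x; rewrite !inE => <- <-.
  by case: (x \in I); case: (x \in J).
by exists (c, d); rewrite // !inE /= cJ dJ -/(f (c, d)) -IE.
Qed.

Lemma card_exchangeI c d J (S : {set T}) : d \notin J ->
  #|(d |: (J :\ c)) :&: S| = (d \in S) + #|(J :&: S) :\ c|.
Proof.
move=> dJ; have -> : (d |: J :\ c) :&: S = if d \in S then d |: ((J :&: S) :\ c) else (J :&: S) :\ c.
  apply/setP => i; case: ifP => dS; rewrite !inE; case: (i =P d) => [->|] /=; rewrite ?dS ?(negbTE dJ) ?andbF ?andbA //.
by case: ifP => dS; rewrite // cardsU1 !inE (negbTE dJ) andbF.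
Qed.

Lemma card_exchangeD c d J (S : {set T}) : c \in J -> d \notin J ->
  #|S :\: (d |: (J :\ c))| = (c \in S) + #|(S :\: J) :\ d|.
Proof.
move=> cJ dJ; have cd : c != d by apply: contraTneq cJ => ->.
have -> : S :\: (d |: J :\ c) = if c \in S then c |: ((S :\: J) :\ d) else (S :\: J) :\ d.
  apply/setP => i; case: ifP => cS; rewrite !inE; case: (i =P c) => [->|] /=;
    by rewrite ?cS ?(negbTE cd) ?andbF ?negb_or ?andbA.
by case: ifP => cS; rewrite // cardsU1 !inE cJ andbF.
Qed.

Lemma card_pairs_le (U : finType) (p q : T -> U -> bool) :
  (forall x, #|[set z | p x z]| <= #|[set z | q x z]|) ->
  #|[set r : T * U | p r.1 r.2]| <= #|[set r : T * U | q r.1 r.2]|.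
Proof.
have E (s : T -> U -> bool) : #|[set r : T * U | s r.1 r.2]| = \sum_x #|[set z | s x z]|.
  rewrite -sum1_card (eq_bigl (fun r : T * U => true && s r.1 r.2)); last by move=> r; rewrite inE.
  rewrite -(pair_big_dep xpredT s (fun _ _ => 1)) /=; apply: eq_bigr => x _.
  by rewrite -sum1_card; apply: eq_bigl => z; rewrite inE.
by move=> H; rewrite !E; apply: leq_sum.
Qed.

End Exchange.

Section Cut.
Variables (n : nat) (w : decperm n).
Let V := down w.
Let J := dperm w @: V.

Lemma mem_min (x : 'I_n) : (w x \in J) = (x \in V).
Proof. by rewrite mem_imset //; apply: perm_inj. Qed.

Lemma down_arcs_sub a b : dperm w @: down_arcs w a b \subset J :&: seg n a b.
Proof.
apply/subsetP => _ /imsetP[x + ->]; rewrite !inE mem_min => /and3P[xV h h'].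
by rewrite xV h (leq_ltn_trans (down_le xV)).
Qed.

Lemma up_arcs_sub a b : dperm w @: up_arcs w a b \subset seg n a b :\: J.
Proof.
apply/subsetP => _ /imsetP[x + ->]; rewrite !inE mem_min => /and3P[xV h h'].
by rewrite xV h' (leq_trans h) ?up_le.
Qed.

Lemma card_min : #|J| = #|V|.
Proof. by rewrite card_imset //; apply: perm_inj. Qed.

Lemma min_base : J \in arc_bases w.
Proof.
apply/arc_basesP; split=> [|a b _]; first exact: card_min.
have := subset_leq_card (down_arcs_sub a b); have := subset_leq_card (up_arcs_sub a b).
by rewrite !card_imset; try exact: perm_inj.
Qed.

(* J is the least basis, hence tight. The element w x of J cannot be exchanged for
   one at or above [top_bound x], the least b such that every downward arc ending
   in [w x, b) starts below b; dually for [bottom_bound]. *)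
Definition closed_down (x : 'I_n) (b : 'I_n.+1) : bool :=
  (w x < b) && [forall x', (x' \in V) && (w x <= w x' < b) ==> (x' < b)].

Definition closed_up (z : 'I_n) (a : 'I_n.+1) : bool :=
  (a <= w z) && [forall z', (z' \notin V) && (a <= w z' <= w z) ==> (a <= z')].

Definition top_bound x : 'I_n.+1 := [arg min_(b < ord_max | closed_down x b) b].
Definition bottom_bound z : 'I_n.+1 := [arg max_(a > ord0 | closed_up z a) a].

Lemma top_boundP x : closed_down x (top_bound x) /\
  forall b : 'I_n.+1, closed_down x b -> top_bound x <= b.
Proof.
rewrite /top_bound; case: arg_minnP => //.
by rewrite /closed_down /= ltn_ord; apply/forallP => z /=; rewrite (ltn_ord z) implybT.
Qed.

Lemma bottom_boundP z : closed_up z (bottom_bound z) /\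
  forall a : 'I_n.+1, closed_up z a -> a <= bottom_bound z.
Proof.
rewrite /bottom_bound; case: arg_maxnP => //.
by rewrite /closed_up /=; apply/forallP => x; rewrite implybT.
Qed.

Lemma top_bound_closed x x' : x' \in V -> w x <= w x' < top_bound x -> x' < top_bound x.
Proof.
have [/andP[_ /forallP /(_ x') /implyP h] _] := top_boundP x.
by move=> xV h'; apply: h; rewrite xV h'.
Qed.

Lemma bottom_bound_closed z z' : z' \notin V -> bottom_bound z <= w z' <= w z -> bottom_bound z <= z'.
Proof.
have [/andP[_ /forallP /(_ z') /implyP h] _] := bottom_boundP z.
by move=> xV h'; apply: h; rewrite xV h'.
Qed.

Lemma top_bound_gt x : w x < top_bound x.
Proof. by have [/andP[]] := top_boundP x. Qed.

Lemma bottom_bound_le z : bottom_bound z <= w z.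
Proof. by have [/andP[]] := bottom_boundP z. Qed.

Lemma top_bound_self x : x \in V -> x < top_bound x.
Proof. by move=> xV; apply: top_bound_closed; rewrite ?leqnn ?top_bound_gt. Qed.

Lemma bottom_bound_self z : z \notin V -> bottom_bound z <= z.
Proof. by move=> zV; apply: bottom_bound_closed; rewrite ?leqnn ?bottom_bound_le. Qed.

(** An interval [[a, b)] loses an element only if it contains [w x] but not [w z]. Then [b <= w z]
    is below the top bound, so [b] is not closed, and some downward arc ends in [[w x, b)] without
    starting below [b]. Its end is an element of [J] that the bound does not count, which pays for
    the loss. The upward bound is dual. *)
Lemma exchange_base x z : x \in V -> z \notin V -> w x < w z ->
  w z < top_bound x -> bottom_bound z <= w x -> w z |: (J :\ w x) \in arc_bases w.
Proof.
move=> xV zV xz top bot.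
have [_ topmin] := top_boundP x; have [_ botmax] := bottom_boundP z.
have xJ : w x \in J by rewrite mem_min.
have zJ : w z \notin J by rewrite mem_min.
apply/arc_basesP; split=> [|a b /andP[ab bn]].
  by rewrite cardsU1 !inE (negbTE zJ) andbF -card_min (cardsD1 (w x) J) xJ.
have an := leq_trans ab bn.
have h1 := subset_leq_card (down_arcs_sub a b).
have h2 := subset_leq_card (up_arcs_sub a b).
rewrite card_imset in h1; last exact: perm_inj.
rewrite card_imset in h2; last exact: perm_inj.
have xs : (w x \in seg n a b) = (a <= w x < b) by rewrite inE.
have zs : (w z \in seg n a b) = (a <= w z < b) by rewrite inE.
have D1 := cardsD1 (w x) (J :&: seg n a b); rewrite in_setI xJ /= xs in D1.
have D2 := cardsD1 (w z) (seg n a b :\: J); rewrite in_setD zJ /= zs in D2.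
rewrite card_exchangeI // card_exchangeD // xs zs; split.
  have [/andP[xab nzab]|] := boolP ((a <= w x < b) && ~~ (a <= w z < b)); last first.
    by move: h1; rewrite D1; case: (a <= w x < b); case: (a <= w z < b) => //=; lia.
  have bz : b <= w z by lia.
  have : ~~ closed_down x (Ordinal (bn : b < n.+1)) by apply/negP => /topmin /=; lia.
  rewrite negb_and /=; move: (xab) => /andP[_ ->] /= /forallPn[x']; rewrite negb_imply -leqNgt => /andP[/andP[xV' /andP[xx' xb']] bx'].
  have : #|down_arcs w a b| <= #|(J :&: seg n a b) :\ w x'|.
    rewrite -(card_imset _ (@perm_inj _ (dperm w))); apply/subset_leq_card/subsetP => i iA.
    rewrite in_setD1 (subsetP (down_arcs_sub a b) _ iA) andbT.
    apply: contraTneq iA => ->; rewrite mem_imset; last exact: perm_inj.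
    by rewrite !inE; lia.
  have := cardsD1 (w x') (J :&: seg n a b); rewrite in_setI mem_min xV' inE.
  have -> : a <= w x' < b by lia.
  rewrite D1 xab (negbTE nzab) => /addnI -> //.
have [/andP[zab nxab]|] := boolP ((a <= w z < b) && ~~ (a <= w x < b)); last first.
  by move: h2; rewrite D2; case: (a <= w x < b); case: (a <= w z < b) => //=; lia.
have xa : w x < a by lia.
have : ~~ closed_up z (Ordinal (an : a < n.+1)) by apply/negP => /botmax /=; lia.
rewrite negb_and /=; move: (zab) => /andP[-> _] /= /forallPn[z']; rewrite negb_imply -ltnNge => /andP[/andP[zV' /andP[az' zz']] bz'].
have : #|up_arcs w a b| <= #|(seg n a b :\: J) :\ w z'|.
  rewrite -(card_imset _ (@perm_inj _ (dperm w))); apply/subset_leq_card/subsetP => i iA.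
  rewrite in_setD1 (subsetP (up_arcs_sub a b) _ iA) andbT.
  apply: contraTneq iA => ->; rewrite mem_imset; last exact: perm_inj.
  by rewrite !inE; lia.
have := cardsD1 (w z') (seg n a b :\: J); rewrite in_setD mem_min zV' inE.
have -> : a <= w z' < b by lia.
rewrite D2 zab (negbTE nxab) => /addnI -> //.
Qed.
End Cut.

Section CutCount.
Variables (n : nat) (w : decperm n).
Let V := down w.
Let J := dperm w @: V.
Let top x : nat := top_bound w x.
Let bot z : nat := bottom_bound w z.

Lemma card_up_cut (b : nat) :
  #|[set z | (z \notin V) && (z < b <= w z)]| = #|[set x | (x \in V) && (w x < b <= x)]|.
Proof.
transitivity #|[set z : 'I_n | z < b <= w z]|.
  apply: eq_card => z; rewrite !inE; case: (boolP (z \in V)) => //= /down_le; lia.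
rewrite card_cut; apply: eq_card => z; rewrite !inE; case: (boolP (z \in V)) => //= /up_le; lia.
Qed.

(* Exchanging w x for w z fails if w z < w x, if top_bound x <= w z or if
   w x < bottom_bound z. In the second case either z is beyond the bound, or the
   arc of z passes over it; the arcs passing over it upwards are as many as those
   passing over it downwards, and the latter enclose the arc of x. *)
Definition seen_alignment (p s : 'I_n) : bool :=
  [|| [&& p \notin V, s \in V & (w p < w s) || ((s < p) && ((top s <= p) || (s < bot p)))],
      [&& p \in V, s \in V, w p < w s & top s <= p]
    | [&& p \notin V, s \notin V, w p < w s & s < bot p]].

Lemma seen_alignmentP p s : seen_alignment p s -> is_alignment w p s.
Proof.
rewrite /seen_alignment is_alignmentE -/V.
have := @top_bound_self _ w s; have := @bottom_bound_self _ w p; rewrite -/V -/(top s) -/(bot p).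
case: (p \in V); case: (s \in V) => //=; lia.
Qed.

Lemma card_bad_le :
  #|[set q : 'I_n * 'I_n | [&& q.1 \in J, q.2 \notin J & q.2 |: (J :\ q.1) \notin arc_bases w]]|
  <= #|[set q : 'I_n * 'I_n | seen_alignment q.1 q.2]|.
Proof.
(* The pairs in [A1] are alignments in swapped order. In [A2] and [A3] an arc of the opposite
   direction passes over the bound of the first component; [card_up_cut] trades it for an arc of the
   same direction over the same bound, which gives [B2] and [B3]. *)
pose A1 := [set q : 'I_n * 'I_n | [&& q.1 \in V, q.2 \notin V &
  (w q.2 < w q.1) || ((q.1 < q.2) && ((top q.1 <= q.2) || (q.1 < bot q.2)))]].
pose A2 := [set q : 'I_n * 'I_n | (q.1 \in V) && ((q.2 \notin V) && (q.2 < top q.1 <= w q.2))].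
pose A3 := [set q : 'I_n * 'I_n | (q.1 \notin V) && ((q.2 \in V) && (w q.2 < bot q.1 <= q.2))].
pose B2 := [set q : 'I_n * 'I_n | (q.1 \in V) && [&& q.2 \in V, w q.2 < w q.1 & top q.1 <= q.2]].
pose B3 := [set q : 'I_n * 'I_n | (q.1 \notin V) && [&& q.2 \notin V, w q.1 < w q.2 & q.2 < bot q.1]].
have swi : injective (fun q : 'I_n * 'I_n => (q.2, q.1)) by move=> [a b] [c d] /= [-> ->].
have wwi : injective (fun q : 'I_n * 'I_n => (w q.1, w q.2)).
  by move=> [a b] [c d] /= [/perm_inj -> /perm_inj ->].
have h2 : #|A2| <= #|B2|.
  apply: (card_pairs_le (p := fun x z => (x \in V) && ((z \notin V) && (z < top x <= w z)))
     (q := fun x z => (x \in V) && [&& z \in V, w z < w x & top x <= z])) => x.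
  case: (boolP (x \in V)) => xV /=; last by rewrite eq_card0 // => z; rewrite inE.
  rewrite card_up_cut; apply/subset_leq_card/subsetP => z; rewrite !inE => /and3P[zV wz tz].
  rewrite zV tz andbT /= ltnNge; apply/negP => wxz.
  by have := top_bound_closed (x := x) zV; rewrite wxz wz ltnNge tz => /(_ isT).
have h3 : #|A3| <= #|B3|.
  apply: (card_pairs_le (p := fun z x => (z \notin V) && ((x \in V) && (w x < bot z <= x)))
     (q := fun z x => (z \notin V) && [&& x \notin V, w z < w x & x < bot z])) => z.
  case: (boolP (z \in V)) => zV /=; first by rewrite eq_card0 // => x; rewrite inE.
  rewrite -card_up_cut; apply/subset_leq_card/subsetP => x; rewrite !inE => /and3P[xV xb bx].
  rewrite xV xb andbT /= ltnNge; apply/negP => wxz.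
  by have := bottom_bound_closed (z := z) xV; rewrite wxz bx leqNgt xb => /(_ isT).
pose sw := fun q : 'I_n * 'I_n => (q.2, q.1).
pose ww := fun q : 'I_n * 'I_n => (w q.1, w q.2).
apply: (@leq_trans #|ww @: (A1 :|: A2 :|: sw @: A3)|).
  apply/subset_leq_card/subsetP => -[c d]; rewrite inE /= => /and3P[cJ dJ nb].
  have cE : c = w ((dperm w)^-1%g c) by rewrite permKV.
  have dE : d = w ((dperm w)^-1%g d) by rewrite permKV.
  move: nb cJ dJ; rewrite cE dE !mem_min -/V.
  move: (_ c) (_ d) => x z nb xV zV; apply/imsetP; exists (x, z) => //.
  rewrite !inE /= xV zV /= (_ : ((x, z) \in sw @: A3) = ((z, x) \in A3)); last first.
    by rewrite -[(x, z)]/(sw (z, x)) mem_imset.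
  rewrite inE /= xV zV /=.
  have := top_bound_self xV; have := bottom_bound_self zV; rewrite -/(top x) -/(bot z).
  have nxz : nat_of_ord (w x) <> w z.
    by move=> /val_inj /perm_inj e; move: zV; rewrite -e xV.
  have : ~ [/\ w x < w z, w z < top x & bot z <= w x].
    by case=> h1' h2' h3'; move: nb; rewrite exchange_base.
  move=> h t b; case: (ltnP (w z) (w x)) => //= h4; case: (leqP (top x) (w z)) => h5; first lia.
  case: (leqP (bot z) (w x)) => h6; last lia.
  by case: h; split=> //; lia.
rewrite card_imset //; apply: leq_trans (leq_card_setU _ _) _.
apply: leq_trans (leq_add (leq_card_setU _ _) (leqnn _)) _.
rewrite [#|sw @: _|]card_imset //.
apply: (@leq_trans (#|A1| + #|B2| + #|B3|)); first by rewrite !leq_add.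
pose seen := [set q : 'I_n * 'I_n | seen_alignment q.1 q.2].
have sE := card_pair_split seen (fun q : 'I_n * 'I_n => q.1 \in V).
have sE' := card_pair_split [set q in seen | q.1 \notin V] (fun q : 'I_n * 'I_n => q.2 \in V).
rewrite -sE -sE' -(card_imset A1 swi) -(card_imset B2 swi) -/sw [X in X + _ <= _]addnC -addnA.
apply: leq_add; [|apply: leq_add].
- apply/subset_leq_card/subsetP => _ /imsetP[[x z] + ->]; rewrite !inE /= => /and4P[xV zV h t].
  by rewrite /seen_alignment xV zV h t ?orbT.
- apply/subset_leq_card/subsetP => _ /imsetP[[x z] + ->]; rewrite !inE /= => /and3P[xV zV h].
  by rewrite /seen_alignment xV zV h.
- apply/subset_leq_card/subsetP => -[x z]; rewrite !inE /= => /and4P[xV zV h t].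
  by rewrite /seen_alignment (negbTE xV) (negbTE zV) h t.
Qed.

Lemma bad_min_base p s : is_alignment w p s -> ~~ seen_alignment p s ->
  #|adjacent_nonbases w J| < #|alignments w|.
Proof.
move=> al ns; rewrite card_exchange.
apply: leq_ltn_trans card_bad_le _; apply: proper_card; apply/properP; split.
  by apply/subsetP => q; rewrite !inE; apply: seen_alignmentP.
by exists (p, s); rewrite inE.
Qed.

(** The given alignment escapes [seen_alignment]. If [s] goes down, the arc from the last point [y]
    into [[w s, s]] drives [top s] to [n], beyond [p]. If [p] goes up, then [w p = y], so closedness
    of [bot p] excludes upward arcs over the cut [bot p]; but [s < bot p] would make [y] cross this
    cut downward. *)
Lemma crossed_last p s y : is_alignment w p s -> y != p -> y != s ->
  y \in cyc_interval p (w p) -> w y \in cyc_interval (w s) s -> y.+1 = n ->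
  #|adjacent_nonbases w J| < #|alignments w|.
Proof.
move=> al yp ys ypp yss yn; apply: (bad_min_base al).
have yp' : nat_of_ord y <> p by move=> /val_inj e; rewrite e eqxx in yp.
have ys' : nat_of_ord y <> s by move=> /val_inj e; rewrite e eqxx in ys.
have hp := ltn_ord p; have hs := ltn_ord s; have hwp := ltn_ord (w p); have hws := ltn_ord (w s); have hwy := ltn_ord (w y).
have wyp : nat_of_ord (w y) <> w p by move=> /val_inj /perm_inj e; rewrite e eqxx in yp.
have wys : nat_of_ord (w y) <> w s by move=> /val_inj /perm_inj e; rewrite e eqxx in ys.
have topn : s \in V -> w s <= w y <= s -> s < y -> top s = n.
  move=> sV h sy; have := top_bound_self sV; rewrite -/(top s) => st.
  have yV : y \in V by rewrite in_down; apply/orP; left; lia.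
  have := top_bound_closed (x := s) yV; rewrite -/(top s) => /(_ _).
  by have : top s <= n := ltn_ord (top_bound w s); lia.
move: al ypp yss; rewrite is_alignmentE !in_cyc_interval !cyc_distE -/V /seen_alignment.
have [pV|pV] := boolP (p \in V); have [sV|sV] := boolP (s \in V) => //=.
- have := down_le pV; have := down_le sV; have := topn sV.
  by case: (leqP (w s) (w y)) => ?; case: (leqP p y) => ?; case: (leqP p (w p)) => ?; case: (leqP (w s) s) => ?; lia.
- have := up_le pV; have := down_le sV; have := topn sV.
  case: (leqP (w s) (w y)) => ?; case: (leqP p y) => ?; case: (leqP p (w p)) => ?; case: (leqP (w s) s) => ?; try lia.
  move=> ht h1 h2 h3 h4 h5.
  have pt : p < top s by lia.
  suff : bot p <= s by lia.
  have := bottom_bound_self pV; rewrite -/(bot p) => bp.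
  rewrite leqNgt; apply/negP => sb.
  have : 0 < #|[set x | (x \in V) && (w x < bot p <= x)]|.
    apply/card_gt0P; exists y; rewrite inE in_down; lia.
  rewrite -card_up_cut => /card_gt0P[z']; rewrite inE => /and3P[zV z1 z2].
  have := bottom_bound_closed (z := p) zV; rewrite -/(bot p); have := ltn_ord (w z'); lia.
- have := up_le pV; have := up_le sV.
  by case: (leqP (w s) (w y)) => ?; case: (leqP p y) => ?; case: (leqP p (w p)) => ?; case: (leqP (w s) s) => ?; lia.
Qed.

(** The mirror image: the arc from the first point runs up into [[p, w p]] and drives [bot p] to 0
    when [p] goes up. *)
Lemma crossed_first p s y : is_alignment w p s -> y != p -> y != s ->
  y \in cyc_interval (w s) s -> w y \in cyc_interval p (w p) -> nat_of_ord y = 0 ->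
  #|adjacent_nonbases w J| < #|alignments w|.
Proof.
move=> al yp ys yss ypp y0; apply: (bad_min_base al).
have yp' : nat_of_ord y <> p by move=> /val_inj e; rewrite e eqxx in yp.
have ys' : nat_of_ord y <> s by move=> /val_inj e; rewrite e eqxx in ys.
have hp := ltn_ord p; have hs := ltn_ord s; have hwp := ltn_ord (w p); have hws := ltn_ord (w s); have hwy := ltn_ord (w y).
have wyp : nat_of_ord (w y) <> w p by move=> /val_inj /perm_inj e; rewrite e eqxx in yp.
have wys : nat_of_ord (w y) <> w s by move=> /val_inj /perm_inj e; rewrite e eqxx in ys.
have bot0 : p \notin V -> p <= w y <= w p -> bot p = 0.
  move=> pV h; have := bottom_bound_self pV; rewrite -/(bot p) => bp.
  have yV : y \notin V by rewrite in_down negb_or; apply/andP; split; [lia | apply/negP => /clockwise_fix; move/(congr1 val) => /=; lia].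
  have := bottom_bound_closed (z := p) yV; rewrite -/(bot p); lia.
move: al ypp yss; rewrite is_alignmentE !in_cyc_interval !cyc_distE -/V /seen_alignment.
have [pV|pV] := boolP (p \in V); have [sV|sV] := boolP (s \in V) => //=.
- have := down_le pV; have := down_le sV.
  by case: (leqP p (w y)) => ?; case: (leqP (w s) y) => ?; case: (leqP p (w p)) => ?; case: (leqP (w s) s) => ?; lia.
- have := up_le pV; have := down_le sV; have := bot0 pV.
  case: (leqP p (w y)) => ?; case: (leqP (w s) y) => ?; case: (leqP p (w p)) => ?; case: (leqP (w s) s) => ?; try lia.
  move=> hb h1 h2 h3 h4 h5.
  have pt : bot p <= s by lia.
  suff : p < top s by lia.
  have := top_bound_gt w s; rewrite -/(top s) => bp.
  rewrite ltnNge; apply/negP => sb.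
  have : 0 < #|[set z | (z \notin V) && (z < top s <= w z)]|.
    apply/card_gt0P; exists y; rewrite inE; apply/andP; split; last lia.
    by apply/negP => /down_le; lia.
  rewrite card_up_cut => /card_gt0P[z']; rewrite inE => /and3P[zV z1 z2].
  have := top_bound_closed (x := s) zV; rewrite -/(top s); lia.
- have := up_le pV; have := up_le sV; have := bot0 pV.
  by case: (leqP p (w y)) => ?; case: (leqP (w s) y) => ?; case: (leqP p (w p)) => ?; case: (leqP (w s) s) => ?; lia.
Qed.

End CutCount.

(** * Bases with too few adjacent non-bases *)

Section Crossed.
Variable n : nat.
Implicit Types w : decperm n.

Lemma iter_rotp m (y : 'I_n) : y + m < n -> nat_of_ord (iter m (rotp n) y) = y + m.
Proof.
elim: m => [|m IH] h /=; first by rewrite addn0.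
rewrite rotpE IH; last lia.
by case: eqP; lia.
Qed.

(** What is small is the number of adjacent non-bases, hence the Jacobian rank at the coordinate
    point; the degree of [J] in the Johnson graph is too large. *)
Definition small_degree_basis w := exists2 J, J \in arc_bases w &
  #|adjacent_nonbases w J| < #|alignments w|.

Lemma small_degree_basis_rot w : small_degree_basis (rotate_dec w) -> small_degree_basis w.
Proof.
move=> [J]; have -> : J = rotp n @: ((rotp n)^-1%g @: J).
  by rewrite -imset_comp -[LHS]imset_id; apply: eq_imset => x /=; rewrite permKV.
rewrite arc_bases_rot card_adjacent_nonbases_rot card_alignments_rot => h1 h2.
by exists ((rotp n)^-1%g @: J).
Qed.

Lemma small_degree_basis_iter m w : small_degree_basis (iter m (@rotate_dec n) w) -> small_degree_basis w.
Proof. by elim: m => //= m IH /small_degree_basis_rot. Qed.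

Lemma crossed_small_degree w p s y : is_crossed_alignment w p s y -> small_degree_basis w.
Proof.
have inr a b c (v : decperm n) : (rotp n a \in cyc_interval (rotp n b) (rotp n c)) = (a \in cyc_interval b c).
  by rewrite !in_cyc_interval !cyc_dist_rot.
have iterE m (v : decperm n) i : iter m (@rotate_dec n) v (iter m (rotp n) i) = iter m (rotp n) (v i).
  by elim: m => //= m IH; rewrite -IH rotE.
have initer m a b c : (iter m (rotp n) a \in cyc_interval (iter m (rotp n) b) (iter m (rotp n) c))
   = (a \in cyc_interval b c).
  by elim: m => //= m IH; rewrite inr.
have aliter m (v : decperm n) a b : is_alignment (iter m (@rotate_dec n) v) (iter m (rotp n) a) (iter m (rotp n) b)
   = is_alignment v a b by elim: m => //= m IH; rewrite is_alignment_rot.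
have neiter m a b : (iter m (rotp n) a != iter m (rotp n) b) = (a != b).
  by elim: m => //= m IH; rewrite (inj_eq perm_inj).
(* [m] rotations bring [y] to the last point and one more wraps it around to the first; the
   direction in which [y] crosses the alignment decides between the two. *)
have yn := ltn_ord y; pose m := n.-1 - y.
have ym : nat_of_ord (iter m (rotp n) y) = n.-1 by rewrite iter_rotp /m; lia.
case/and4P=> al yp ys /orP[]/andP[h1 h2]; last first.
  apply: (@small_degree_basis_iter m); exists (dperm (iter m (@rotate_dec n) w) @: down (iter m (@rotate_dec n) w)).
    exact: min_base.
  apply: (@crossed_last _ _ (iter m (rotp n) p) (iter m (rotp n) s) (iter m (rotp n) y));
    rewrite ?aliter ?neiter ?iterE ?initer //.
  by rewrite ym; lia.
apply: (@small_degree_basis_iter m.+1); exists (dperm (iter m.+1 (@rotate_dec n) w) @: down (iter m.+1 (@rotate_dec n) w)).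
  exact: min_base.
apply: (@crossed_first _ _ (iter m.+1 (rotp n) p) (iter m.+1 (rotp n) s) (iter m.+1 (rotp n) y));
  rewrite ?aliter ?neiter ?iterE ?initer //.
by rewrite /= rotpE ym; case: eqP; lia.
Qed.

End Crossed.

(** * Separation of alignments *)

Ltac if_lia := repeat match goal with
  |- context [if ?b then _ else _] =>
    lazymatch b with
    | context [if _ then _ else _] => fail
    | _ => case: (boolP b) => ?
    end
  end; lia.

Section Separation.
Variables (n : nat) (w : decperm n).

Definition invariant_interval (a b : 'I_n) : bool :=
  [forall x, (w x \in cyc_interval a b) == (x \in cyc_interval a b)].

Lemma perm_closed (C : {set 'I_n}) : (forall y, w y \in C -> y \in C) ->
  forall y, (w y \in C) = (y \in C).
Proof.
move=> H.
have e : [set y | w y \in C] = C.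
  apply/eqP; rewrite eqEcard (card_perm_pred (dperm w) (fun x => x \in C)) cardsE leqnn andbT.
  by apply/subsetP => y; rewrite inE; apply: H.
by move=> y; rewrite -[in RHS]e inE.
Qed.

Definition separated (x y : 'I_n) : bool :=
  [exists a, exists b, [&& invariant_interval a b, x \in cyc_interval a b & y \notin cyc_interval a b]].

Lemma separatedP x y : reflect (exists a b, [/\ forall z, (w z \in cyc_interval a b) = (z \in cyc_interval a b),
   x \in cyc_interval a b & y \notin cyc_interval a b]) (separated x y).
Proof.
apply: (iffP existsP) => -[a].
  move=> /existsP[b /and3P[/forallP H h1 h2]]; exists a, b; split=> // z; exact/eqP.
move=> [b [H h1 h2]]; exists a; apply/existsP; exists b; rewrite h1 h2 !andbT.
by apply/forallP => z; rewrite H.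
Qed.

(* The circle is cut open just after s, so that s comes last, at position n. *)
Definition cut_pos (s x : 'I_n) : nat := if x == s then n else cyc_dist s x.

Lemma cut_pos_gt0 s x : 0 < cut_pos s x <= n.
Proof.
have := ltn_ord s; have := ltn_ord x; rewrite /cut_pos -val_eqE /= cyc_distE.
by if_lia.
Qed.

Lemma cut_pos_inj s x y : cut_pos s x = cut_pos s y -> x = y.
Proof.
have := ltn_ord s; have := ltn_ord x; have := ltn_ord y.
rewrite /cut_pos -!val_eqE /= !cyc_distE => h1 h2 h3 h; apply: val_inj; move: h => /=.
by if_lia.
Qed.

Lemma cut_pos_dist s x y : cyc_dist x y =
  if cut_pos s x <= cut_pos s y then cut_pos s y - cut_pos s x else cut_pos s y + n - cut_pos s x.
Proof.
have := ltn_ord s; have := ltn_ord x; have := ltn_ord y.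
rewrite /cut_pos -!val_eqE /= !cyc_distE => h1 h2 h3.
by if_lia.
Qed.

(** A cyclic interval and its complement are both connected on the circle, so membership cannot
    alternate. This is how separating intervals lead to contradictions. *)
Lemma cyc_interval_cross s a b x1 x2 x3 x4 :
  cut_pos s x1 < cut_pos s x2 -> cut_pos s x2 < cut_pos s x3 -> cut_pos s x3 < cut_pos s x4 ->
  ~ [/\ x1 \in cyc_interval a b, x2 \notin cyc_interval a b, x3 \in cyc_interval a b & x4 \notin cyc_interval a b]
  /\ ~ [/\ x1 \notin cyc_interval a b, x2 \in cyc_interval a b, x3 \notin cyc_interval a b & x4 \in cyc_interval a b].
Proof.
rewrite !in_cyc_interval !(cut_pos_dist s).
have := cut_pos_gt0 s a; have := cut_pos_gt0 s b; have := cut_pos_gt0 s x1;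
have := cut_pos_gt0 s x2; have := cut_pos_gt0 s x3; have := cut_pos_gt0 s x4.
move: (cut_pos s a) (cut_pos s b) (cut_pos s x1) (cut_pos s x2) (cut_pos s x3) (cut_pos s x4).
move=> A B X1 X2 X3 X4 *.
by split; case; if_lia.
Qed.

Definition port_ok p := (w p == p) ==> (p \in counterclockwise w).
Definition starboard_ok s := (w s == s) ==> (s \in clockwise w).

Lemma alignment_pos s a b : let q := cut_pos s in
  q a <= q (w a) -> q (w a) < q (w b) -> (q (w b) <= q b) || (q b < q a) ->
  starboard_ok b -> port_ok a -> is_alignment w a b.
Proof.
rewrite /= => h1 h2 h3 h4 h5; rewrite /is_alignment -/(starboard_ok b) -/(port_ok a) h4 h5 !andbT.
have -> /= : a != b by apply: contraTneq h2 => ->; rewrite ltnn.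
have := cut_pos_gt0 s a; have := cut_pos_gt0 s b.
have := cut_pos_gt0 s (w a); have := cut_pos_gt0 s (w b).
rewrite !(cut_pos_dist s); move: h1 h2 h3.
move: (cut_pos s a) (cut_pos s b) (cut_pos s (w a)) (cut_pos s (w b)) => A B A' B'; clear; by if_lia.
Qed.

Lemma pos_alignment p s : let q := cut_pos s in is_alignment w p s ->
  [/\ q p < n, q p <= q (w p), q (w p) < q (w s), starboard_ok s & port_ok p].
Proof.
rewrite /= => /and5P[ps]; have ns : cut_pos s s = n by rewrite /cut_pos eqxx.
have pn : cut_pos s p <> n by move=> e; rewrite (@cut_pos_inj s p s) ?eqxx // e ns in ps.
have := cut_pos_gt0 s p; have := cut_pos_gt0 s (w p); have := cut_pos_gt0 s (w s).
move=> h1 h2 h3 d1 d2 ? ?.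
suff /and3P[] : [&& cut_pos s p < n, cut_pos s p <= cut_pos s (w p) & cut_pos s (w p) < cut_pos s (w s)] by [].
move: d1 d2 h1 h2 h3 pn; rewrite !(cut_pos_dist s) ns.
move: (cut_pos s p) (cut_pos s (w s)) (cut_pos s (w p)) => A B C; clear.
by if_lia.
Qed.

Lemma crossed_pos s a y : is_alignment w a s -> y != s ->
  cut_pos s (w s) <= cut_pos s y -> cut_pos s a <= cut_pos s (w y) <= cut_pos s (w a) ->
  is_crossed_alignment w a s y.
Proof.
move=> al ys h1 /andP[h2 h3]; have [_ o1 o2 _ _] := pos_alignment al.
rewrite /is_crossed_alignment al ys /=.
have -> /= : y != a by apply: contraTneq h1 => ->; rewrite -ltnNge (leq_ltn_trans o1).
apply/orP; left; rewrite !in_cyc_interval !(cut_pos_dist s).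
have ns : cut_pos s s = n by rewrite /cut_pos eqxx.
have /andP[_ yn] := cut_pos_gt0 s y; have /andP[_ wn] := cut_pos_gt0 s (w s).
by rewrite h1 ns wn h2 o1 !leq_sub2r.
Qed.

Hypothesis nocross : forall p s x, ~~ is_crossed_alignment w p s x.

(* Induction on the gap between w p and w s: if the alignment is not separated,
   then this gap is invariant, and the arcs entering [c, w p], for the least stable
   extension of [p, w p] to the left, cross an alignment. *)
Lemma alignment_separated p s : is_alignment w p s -> separated p s.
Proof.
have [m] := ubnP (cyc_dist (w p) (w s)); elim: m => // m IH in p s *; rewrite ltnS => Nm al.
apply: contraT => nsep.
pose q := cut_pos s; have qn x : 0 < q x <= n := cut_pos_gt0 s x.
have qi x y : q x = q y -> x = y := @cut_pos_inj s x y.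
have qd := cut_pos_dist s; rewrite -/q in qd.
have qs : q s = n by rewrite /q /cut_pos eqxx.
have [pn o1 o2 fs fp] := pos_alignment al; rewrite -/q in pn o1 o2.
have mkal := alignment_pos (s := s); rewrite -/q /= in mkal.
have cr := @cyc_interval_cross s; rewrite -/q in cr.
have nf y : q (w y) <> q y -> port_ok y /\ starboard_ok y.
  by move=> h; rewrite /port_ok /starboard_ok; case: eqP => // e; rewrite e in h.
have sepw a b : (forall z, (w z \in cyc_interval a b) = (z \in cyc_interval a b)) ->
    p \in cyc_interval a b -> s \in cyc_interval a b.
  by move=> H pC; apply/negPn/negP => sC; case/separatedP: nsep; exists a, b.
(* Otherwise [(p, y)] or [(y, s)] is an alignment with a smaller gap, separated by induction. By
   [sepw] an invariant interval containing [p] contains [s], so membership in the separating one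
   would alternate along four points. *)
have Nin y : q (w p) < q (w y) < q (w s) -> q (w p) < q y < q (w s).
  move=> /andP[y1 y2].
  have [y3|y3] := ltnP (q y) (q p).
    have /IH/separatedP[|a [b [H yC sC]]] : is_alignment w p y.
      by apply: mkal => //; first [lia | have := qn (w s); lia | by apply: (nf _ _).1; lia | by apply: (nf _ _).2; lia].
      by move: Nm; rewrite !qd; if_lia.
    case: (cr a b y (w p) (w y) (w s)); [lia | lia | lia | move=> _ []; split].
    - exact: sC.
    - by rewrite H.
    - by rewrite H.
    - by rewrite H; apply: sepw H yC.
  have yp : q y <> q p by move=> /qi e; move: y1; rewrite e ltnn.
  have ys : q y <> q s by move=> /qi e; move: y2; rewrite e ltnn.
  have [y4|y4] := leqP (q y) (q (w p)).
    have /IH/separatedP[|a [b [H yC sC]]] : is_alignment w y s.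
      by apply: mkal => //; first [lia | have := qn (w s); lia | by apply: (nf _ _).1; lia | by apply: (nf _ _).2; lia].
      by move: Nm; rewrite !qd; if_lia.
    have pC : p \notin cyc_interval a b by apply: contraNN sC; apply: sepw.
    have ywp : q y <> q (w p) by move=> /qi e; move: yC; rewrite e H (negbTE pC).
    by case: (cr a b y (w p) (w y) (w s)); [lia | lia | lia | case; split; rewrite ?H].
  have [y5|y5] := ltnP (q y) (q (w s)); first lia.
  have /IH/separatedP[|a [b [H yC sC]]] : is_alignment w p y.
    by apply: mkal => //; first [lia | have := qn (w s); lia | by apply: (nf _ _).1; lia | by apply: (nf _ _).2; lia].
    by move: Nm; rewrite !qd; if_lia.
  have sC' := sepw a b H yC.
  have yws : q y <> q (w s) by move=> /qi e; move: sC; rewrite e H sC'.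
  by case: (cr a b (w p) (w y) (w s) y); [lia | lia | lia | case; split; rewrite ?H].
have Nout y : q (w p) < q y < q (w s) -> q (w p) < q (w y) < q (w s).
  have := @perm_closed [set y | q (w p) < q y < q (w s)] _ y; rewrite !inE => -> // z.
  by rewrite !inE; apply: Nin.
(* [G x] says that no arc from the left of [x] enters [[x, w p]]. The first point in cut order
   satisfies it; the rightmost such point [c] gives the shortest interval. *)
pose G x := (q x <= q p) && [forall y, (q y < q x) ==> ~~ (q x <= q (w y) <= q (w p))].
have [x0 _ x0min] := @arg_minnP _ p xpredT q isT.
have Gx0 : G x0.
  rewrite /G x0min //=; apply/forallP => y; rewrite ltnNge x0min //.
have [c /andP[cp /forallP cG] cmax] := @arg_maxnP _ x0 G q Gx0.
case/negP: nsep; apply/separatedP; exists c, (w p).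
have inC x : (x \in cyc_interval c (w p)) = (q c <= q x <= q (w p)).
  rewrite in_cyc_interval !qd; have := qn c; have := qn x; have := qn (w p).
  by if_lia.
split; [|rewrite inC; lia | rewrite inC qs; have := qn (w s); lia].
apply: perm_closed => y; rewrite !inC => wyC.
have cy : q c <= q y by rewrite leqNgt; apply/negP => h; have := cG y; rewrite h wyC.
rewrite cy leqNgt; apply/negP => py.
have [sy|ys] := ltnP (q y) (q (w s)); first by have := Nout y; lia.
have yns : y != s by apply: contraTneq wyC => ->; lia.
have [wyp|wyp] := leqP (q p) (q (w y)).
  by apply: (negP (nocross p s y)); apply: crossed_pos => //; rewrite -/q wyp; case/andP: wyC.
(* [e] is the point just after [w y]. It lies strictly after [c] and not after [p], so by the choice
   of [c] some arc [y'] starts at or before [w y] and ends in [[e, w p]]; then [(y', s)] is an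
   alignment crossed by the arc of [y]. *)
have [e ey emin] := @arg_minnP _ p (fun x => q (w y) < q x) q wyp.
have : ~~ G e by apply/negP => /cmax /=; lia.
rewrite negb_and (emin p wyp) /= => /forallPn[y']; rewrite negb_imply negbK => /andP[y1 /andP[y2 y3]].
have y4 : q y' <= q (w y) by rewrite leqNgt; apply/negP => /emin; rewrite leqNgt y1.
have y5 : q (w y) <= q (w y') by apply: leq_trans y2; apply: ltnW.
have ny' : q (w y') <> q y' by clear -y1 y2; lia.
apply: (negP (nocross y' s y)); apply: crossed_pos; rewrite -/q ?y4 ?y5 //.
apply: mkal => //; [exact: leq_trans y5 | exact: leq_ltn_trans o2 | | exact: (nf _ ny').1].
by rewrite qs; case/andP: (qn (w s)) => _ ->.
Qed.

End Separation.

(** Only the linear order remains on the right, so alignments are preserved by the increasing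
    relabelling of a block. *)
Lemma cyc_dist_lt n (p a b : 'I_n) : (cyc_dist p a < cyc_dist p b) =
  if p <= a then (a < b) || (b < p) else (b < p) && (a < b).
Proof.
have := ltn_ord p; have := ltn_ord a; have := ltn_ord b; rewrite !cyc_distE.
move: (nat_of_ord p) (nat_of_ord a) (nat_of_ord b) => P A B; by if_lia.
Qed.

(** * Permutations without alignments are shifts *)

Section Shift.
Variables (n : nat) (z : decperm n).
Hypothesis nofix : forall i, z i != i.
Hypothesis noal : forall p s, ~~ is_alignment z p s.

(** If the successor of [z i] were the image of a point [j] other than the successor [i'] of [i],
    then [(i, j)], [(i', i)] or [(j, i')] would be an alignment. *)
Lemma shift_step i : z (rotp n i) = rotp n (z i).
Proof.
apply/eqP; apply: contraT => ne.
pose j := (dperm z)^-1%g (rotp n (z i)); have zj : z j = rotp n (z i) by rewrite permKV.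
have nal p s : ~~ [&& p != s, cyc_dist p (z p) < cyc_dist p (z s) & cyc_dist p (z s) <= cyc_dist p s].
  have := noal p s; rewrite /is_alignment (negbTE (nofix s)) (negbTE (nofix p)) /= !andbT.
  by [].
have a1 := nal i j; have a2 := nal (rotp n i) i; have a3 := nal j (rotp n i).
have ij : nat_of_ord i != j.
  apply/eqP => /val_inj e; move: zj; rewrite -e => /(congr1 (@nat_of_ord n)); rewrite rotpE.
  have := ltn_ord (z i); have := ltn_ord i; have := nofix i; rewrite -(inj_eq val_inj) /=.
  by if_lia.
have ii' : nat_of_ord (rotp n i) != i.
  apply: contraNneq (nofix i) => e; move: ne; have -> : rotp n i = i by apply: val_inj.
  move: e; rewrite rotpE; have := ltn_ord i; have := ltn_ord (z i) => h1 h2.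
  by rewrite -!(inj_eq val_inj) /= ; if_lia.
have ji' : nat_of_ord j != rotp n i.
  by rewrite (inj_eq val_inj); apply: contraNneq ne => <-; rewrite zj.
have nd : nat_of_ord (z (rotp n i)) != z i.
  by rewrite (inj_eq val_inj) (inj_eq perm_inj) -(inj_eq val_inj).
have ne' : nat_of_ord (z (rotp n i)) != rotp n (z i) by rewrite (inj_eq val_inj).
have nf1 : nat_of_ord (z i) != i by rewrite (inj_eq val_inj).
have nf2 : nat_of_ord (z (rotp n i)) != rotp n i by rewrite (inj_eq val_inj).
have nf3 : nat_of_ord j != rotp n (z i) by rewrite -zj (inj_eq val_inj) eq_sym.
move: a1 a2 a3; rewrite zj -!(inj_eq val_inj) /= !(leqNgt (cyc_dist _ _)) !cyc_dist_lt.
have := ltn_ord i; have := ltn_ord j; have := ltn_ord (z i); have := ltn_ord (z (rotp n i)).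
move: ij ii' ji' nd ne' nf1 nf2 nf3; rewrite !rotpE.
move: (nat_of_ord i) (nat_of_ord j) (nat_of_ord (z i)) (nat_of_ord (z (rotp n i))) => I J C D.
clear; by if_lia.
Qed.

Lemma shift_spirograph : spirograph z.
Proof.
split; last by rewrite eq_card0 // => i; rewrite inE; apply: negbTE.
have [n0|n_gt0] := posnP n.
  by exists 1 => // i; have := ltn_ord i; rewrite [X in _ < X]n0.
pose o := Ordinal n_gt0; exists (z o).
  by rewrite lt0n; apply: contraNneq (nofix o) => e; apply/eqP/val_inj.
have it m (x : 'I_n) : iter m (rotp n) x = x + m %[mod n].
  elim: m => [|m IH] /=; first by rewrite addn0.
  by rewrite permE /= modn_mod -addn1 -modnDml IH modnDml addn1 addnS.
move=> i; have ie : i = iter i (rotp n) o.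
  by apply: val_inj; have := it i o; rewrite add0n !modn_small.
rewrite [in LHS]ie addnC -it; congr (nat_of_ord _ %% n).
by elim: (nat_of_ord i) => //= m IH; rewrite shift_step IH.
Qed.
End Shift.

Section Restriction.
Variables (n : nat) (w : decperm n) (B : {set 'I_n}).

Lemma enum_val_lt (i j : 'I_#|B|) :
  (nat_of_ord (enum_val i) < nat_of_ord (enum_val j)) = (i < j).
Proof.
have H (k l : 'I_#|B|) : k < l -> nat_of_ord (enum_val k) < nat_of_ord (enum_val l).
  move=> kl; have sz (m : 'I_#|B|) : m < size (enum B) by rewrite -cardE.
  have x0 : 'I_n := enum_val k.
  rewrite !(enum_val_nth x0) -!(nth_map _ 0 val) ?sz //.
  by apply: (sorted_ltn_nth ltn_trans 0 (sorted_enum_val B)); rewrite ?inE ?size_map ?sz.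
case: (ltngtP i j) => [/H //|/H/ltnW|/val_inj ->]; last by rewrite ltnn.
by rewrite leqNgt => /negbTE.
Qed.

Hypothesis wB : forall x, (w x \in B) = (x \in B).

Lemma restrict_key (j : 'I_#|B|) : w (enum_val j) \in B.
Proof. by rewrite wB enum_valP. Qed.

Definition restrict_fun (j : 'I_#|B|) : 'I_#|B| := enum_rank_in (enum_valP j) (w (enum_val j)).

Lemma restrict_funE j : enum_val (restrict_fun j) = w (enum_val j).
Proof. by rewrite enum_rankK_in // restrict_key. Qed.

Lemma restrict_inj : injective restrict_fun.
Proof. by move=> i j /(congr1 enum_val); rewrite !restrict_funE => /perm_inj /enum_val_inj. Qed.

Lemma restrict_fixed : [set j | enum_val j \in clockwise w] \subset
  [set i | perm restrict_inj i == i].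
Proof.
apply/subsetP => j; rewrite !inE permE => /clockwise_fix e.
by apply/eqP/enum_val_inj; rewrite restrict_funE.
Qed.

Definition restrict := DecPerm restrict_fixed.

Lemma restrictE j : enum_val (restrict j) = w (enum_val j).
Proof. by rewrite /= permE restrict_funE. Qed.

Lemma restrict_restriction : is_restriction w restrict.
Proof. by move=> j; rewrite restrictE !inE. Qed.

Lemma is_alignment_restrict p s :
  is_alignment restrict p s = is_alignment w (enum_val p) (enum_val s).
Proof.
rewrite /is_alignment !(leqNgt (cyc_dist _ _)) !cyc_dist_lt -!restrictE !inE.
by rewrite !(leqNgt (nat_of_ord (enum_val _))) !enum_val_lt -!leqNgt -?restrictE !(inj_eq enum_val_inj).
Qed.
End Restriction.

Section Blocks.
Variables (n : nat) (w : decperm n).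
Hypothesis nocross : forall p s x, ~~ is_crossed_alignment w p s x.

Definition same_block (x y : 'I_n) : bool :=
  [forall a, forall b, invariant_interval w a b ==>
     ((x \in cyc_interval a b) == (y \in cyc_interval a b))].

Lemma same_blockP x y : reflect
  (forall a b, invariant_interval w a b -> (x \in cyc_interval a b) = (y \in cyc_interval a b))
  (same_block x y).
Proof.
apply: (iffP forallP) => H a; last by apply/forallP => b; apply/implyP => /H ->.
by move=> b; have /forallP/(_ b)/implyP h := H a; move=> /h/eqP.
Qed.

Lemma same_block_equiv : {in [set: 'I_n] & &, equivalence_rel same_block}.
Proof.
move=> x y z _ _ _; split; first by apply/same_blockP.
move=> /same_blockP h; apply/same_blockP/same_blockP => H a b i; rewrite -H //.
  by rewrite h.
by rewrite h.
Qed.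

Definition blocks := equivalence_partition same_block [set: 'I_n].

Lemma blocks_partition : partition blocks [set: 'I_n].
Proof. exact: equivalence_partitionP same_block_equiv. Qed.

Lemma mem_block B x y : B \in blocks -> x \in B -> (y \in B) = same_block x y.
Proof.
move=> BP xB; have /and3P[_ tI _] := blocks_partition.
rewrite -(def_pblock tI BP xB).
by rewrite (pblock_equivalence_partition same_block_equiv) ?inE.
Qed.

Lemma same_block_w x : same_block x (w x).
Proof. by apply/same_blockP => a b /forallP/(_ x)/eqP ->. Qed.

Lemma block_invariant B x : B \in blocks -> (w x \in B) = (x \in B).
Proof.
move=> BP; apply/idP/idP => h; last by rewrite (mem_block _ BP h) same_block_w.
rewrite (mem_block _ BP h); apply/same_blockP => a b /forallP/(_ x)/eqP. by [].
Qed.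

Lemma same_block_noal p s : same_block p s -> ~~ is_alignment w p s.
Proof.
move=> /same_blockP ps; apply/negP => /(alignment_separated nocross)/existsP[a /existsP[b /and3P[i h1 h2]]].
by move: h2; rewrite -ps // h1.
Qed.

(** An invariant interval that distinguishes [a] from [b] treats [c] like [a] and [d] like [b], so
    it alternates along [b], [c], [d], [a], which are in this order once the circle is cut after
    [a]. *)
Lemma blocks_noncrossing : noncrossing blocks.
Proof.
move=> B B' BP BP' BB' a b c d /and3P[o1 o2 o3]; apply/negP => /and4P[aB cB bB dB].
have : ~~ same_block a b.
  rewrite -(mem_block _ BP aB); apply: contra BB' => bB1.
  have /and3P[_ tI _] := blocks_partition.
  by rewrite -(def_pblock tI BP bB1) -(def_pblock tI BP' bB).
move=> /forallPn[u /forallPn[v]]; rewrite negb_imply => /andP[iuv].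
have cE : (c \in cyc_interval u v) = (a \in cyc_interval u v).
  by move: cB; rewrite (mem_block _ BP aB) => /same_blockP ->.
have dE : (d \in cyc_interval u v) = (b \in cyc_interval u v).
  by move: dB; rewrite (mem_block _ BP' bB) => /same_blockP ->.
have qa : cut_pos a a = n by rewrite /cut_pos eqxx.
have qE x : 0 < cyc_dist a x -> cut_pos a x = cyc_dist a x.
  by rewrite /cut_pos; case: eqP => // ->; rewrite cyc_distE leqnn subnn.
have dn : cyc_dist a d < n by rewrite /cyc_dist ltn_mod (leq_ltn_trans _ (ltn_ord a)).
have p2 := ltn_trans o1 o2; have p3 := ltn_trans p2 o3.
have [||| h1 h2] := @cyc_interval_cross n a u v b c d a.
- by rewrite !qE.
- by rewrite !qE.
- by rewrite qa qE.
case: (boolP (a \in cyc_interval u v)) => ha; case: (boolP (b \in cyc_interval u v)) => hb // _.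
  by case: h2; rewrite cE dE ha hb.
by case: h1; rewrite cE dE ha hb.
Qed.

Lemma fixed_block B x : B \in blocks -> x \in B -> w x = x -> B = [set x].
Proof.
move=> BP xB wx; apply/setP => y; rewrite (mem_block _ BP xB) inE.
apply/same_blockP/eqP => [|-> //] => /(_ x x).
have E z : (z \in cyc_interval x x) = (z == x).
  by rewrite /cyc_interval leqnn inE -eqn_leq eq_sym.
rewrite !E eqxx => h; apply/eqP; rewrite -h //.
by apply/forallP => z; rewrite !E -{1}wx (inj_eq perm_inj).
Qed.

Lemma uncrossed_spirographs : disjoint_union_of_spirographs w.
Proof.
exists blocks; split; [exact: blocks_partition | exact: blocks_noncrossing |].
move=> B BP; have wB x := block_invariant x BP; split.
  apply/eqP; rewrite eqEcard card_imset ?leqnn ?andbT; last exact: perm_inj.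
  by apply/subsetP => _ /imsetP[x xB ->]; rewrite wB.
exists (restrict wB); first exact: restrict_restriction.
case: (pickP [pred x | (x \in B) && (w x == x)]) => [x /= /andP[xB /eqP wx]|nf].
  have B1 : #|B| = 1 by rewrite (fixed_block BP xB wx) cards1.
  have m1 a b m : m = 1 -> a = b %[mod m] by move=> ->; rewrite !modn1.
  split; first by exists 1 => // i; apply: m1.
  by apply: leq_trans (max_card _) _; rewrite card_ord B1.
apply: shift_spirograph => [i|p s].
  apply: contraFneq (nf (enum_val i)) => e; rewrite /= enum_valP /=.
  by apply/eqP; rewrite -(restrictE wB) e.
rewrite is_alignment_restrict; apply: same_block_noal.
by rewrite -(mem_block _ BP (enum_valP p)) enum_valP.
Qed.
End Blocks.

(** * Blocks on which the permutation is a shift *)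

Section Rank.
Variables (n : nat) (B : {set 'I_n}).

Definition block_rank (x : 'I_n) : nat := #|[set y in B | y < x]|.

Lemma card_seg_le m (c d : nat) : #|seg m c d| <= d - c.
Proof.
have [cd|dc] := leqP c d; last first.
  by rewrite eq_card0 // => x; rewrite !inE; lia.
have [dm|md] := leqP d m; first by rewrite card_segr ?cd.
have [cm|mc] := leqP c m.
  apply: (@leq_trans #|seg m c m|); last by rewrite card_segr ?cm ?leqnn //; lia.
  by apply/subset_leq_card/subsetP => x; rewrite !inE ltn_ord andbT => /andP[].
by rewrite eq_card0 // => x; rewrite !inE; have := ltn_ord x; lia.
Qed.

Lemma block_rank_enum_val (i : 'I_#|B|) : block_rank (enum_val i) = i.
Proof.
rewrite -(card_ltn (ltnW (ltn_ord i))) -(card_imset _ enum_val_inj); apply: eq_card => y.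
rewrite inE; apply/andP/imsetP => [[yB yi]|[j]].
  exists (enum_rank_in yB y); last by rewrite enum_rankK_in.
  by rewrite inE -enum_val_lt enum_rankK_in.
by rewrite inE => ji ->; rewrite enum_valP enum_val_lt.
Qed.

Lemma mem_enum_val x : x \in B -> exists i : 'I_#|B|, x = enum_val i.
Proof. by move=> xB; exists (enum_rank_in xB x); rewrite enum_rankK_in. Qed.

Lemma card_block_rank_le (D : {set 'I_n}) (c d : nat) : D \subset B ->
  (forall x, x \in D -> c <= block_rank x < d) -> #|D| <= d - c.
Proof.
move=> DB H; apply: leq_trans (card_seg_le #|B| c d).
rewrite -(card_imset _ enum_val_inj); apply/subset_leq_card/subsetP => x xD.
have [i e] := mem_enum_val (subsetP DB _ xD).
by apply/imsetP; exists i; rewrite // inE -block_rank_enum_val -e H.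
Qed.

Lemma card_block_rank (c : nat) : c <= #|B| ->
  #|[set x in B | c <= block_rank x]| = #|B| - c.
Proof.
move=> cB; rewrite -(@card_segr #|B|) ?cB ?leqnn // -(card_imset _ enum_val_inj).
apply: eq_card => x; rewrite inE; apply/andP/imsetP => [[xB cx]|[j]].
  have [j e] := mem_enum_val xB; exists j => //.
  by rewrite inE ltn_ord andbT -block_rank_enum_val -e.
by rewrite inE => /andP[cj _] ->; rewrite enum_valP block_rank_enum_val.
Qed.

Lemma block_rank_lt x : x \in B -> block_rank x < #|B|.
Proof. by move=> /mem_enum_val[i ->]; rewrite block_rank_enum_val. Qed.

Lemma block_rank_mono x y : x \in B -> y \in B -> (block_rank x < block_rank y) = (x < y).
Proof.
move=> /mem_enum_val[i ->] /mem_enum_val[j ->].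
by rewrite !block_rank_enum_val -enum_val_lt.
Qed.

Lemma block_rank_ge (a : nat) (x : 'I_n) : a <= x -> #|[set y in B | y < a]| <= block_rank x.
Proof. by move=> ax; apply/subset_leq_card/subsetP => y; rewrite !inE; lia. Qed.

Lemma block_rank_below (a : nat) (x : 'I_n) : x \in B -> x < a -> block_rank x < #|[set y in B | y < a]|.
Proof.
move=> xB xa; apply: proper_card; apply/properP; split.
  by apply/subsetP => y; rewrite !inE; lia.
by exists x; rewrite !inE ?xB ?xa ?ltnn.
Qed.

Lemma card_block_seg (a b : nat) : a <= b ->
  #|B :&: seg n a b| = #|[set y in B | y < b]| - #|[set y in B | y < a]|.
Proof.
move=> ab; apply/eqP; rewrite -(eqn_add2r #|[set y in B | y < a]|) subnK; last first.
  by apply/subset_leq_card/subsetP => y; rewrite !inE; lia.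
rewrite -[X in _ == X](card_pair_split _ (fun y : 'I_n => a <= y)).
apply/eqP; congr (_ + _); apply: eq_card => y; rewrite !inE.
  by case: (y \in B) => //=; rewrite andbC.
by case: (y \in B) => //=; lia.
Qed.

End Rank.

Section ShiftBlock.
Variables (n : nat) (w : decperm n) (B : {set 'I_n}).

(** A cyclic shift by [r], unrolled along the block: upward arcs gain [r] in rank and downward arcs
    lose [#|B| - r]. The extreme values [r = 0] and [r = #|B|] accommodate the loops of either
    colour. *)
Definition shift_block (r : nat) := r <= #|B| /\ forall x, x \in B ->
  if x \in down w then block_rank B x = block_rank B (w x) + (#|B| - r)
  else block_rank B (w x) = block_rank B x + r.

Lemma spirograph_shift_block (z : decperm #|B|) : B != set0 ->
  is_restriction w z -> spirograph z -> exists r, shift_block r.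
Proof.
move=> B0 zr [[m m0 zm] zf]; have b0 : 0 < #|B| by rewrite card_gt0.
have inD (i : 'I_#|B|) : (enum_val i \in down w) = (z i < i) || (i \in clockwise z).
  by have [e ->] := zr i; rewrite in_down -e enum_val_lt.
have rkw (i : 'I_#|B|) : block_rank B (w (enum_val i)) = z i.
  by have [<- _] := zr i; rewrite block_rank_enum_val.
have [b1|b2] := leqP #|B| 1.
  have bE : #|B| = 1 by lia.
  have [c] : exists c, c \in B by apply/set0Pn.
  move=> cB; exists (nat_of_bool (c \in down w)); split; first by case: (c \in down w); lia.
  move=> x xB.
  have -> : x = c by apply: (card_le1_eqP b1).
  have [i e] := mem_enum_val cB; rewrite e rkw block_rank_enum_val.
  have le0 (k : 'I_#|B|) : nat_of_ord k = 0.
    by apply/eqP; rewrite -leqn0 -ltnS; apply: leq_trans (ltn_ord k) b1.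
  by rewrite !le0 bE; case: (enum_val i \in down w).
pose r := m %% #|B|; have rb : r < #|B| by rewrite ltn_mod.
have zE (i : 'I_#|B|) : nat_of_ord (z i) = if i + r < #|B| then i + r else i + r - #|B|.
  have := zm i; rewrite modn_small // => ->; rewrite -modnDmr -/r.
  case: ltnP => h; first by rewrite modn_small.
  rewrite -{1}(subnK h) modnDr modn_small //; have := ltn_ord i; lia.
have r0 : 0 < r.
  rewrite lt0n; apply/eqP => r0; have : #|B| <= 1; last by lia.
  apply: leq_trans zf; rewrite -{1}[#|B|]card_ord; apply/subset_leq_card/subsetP => i _.
  rewrite inE; apply/eqP/val_inj; rewrite /= zE r0 addn0 ltn_ord //.
exists r; split=> [|x xB]; first exact: ltnW.
have [i ->] := mem_enum_val xB; rewrite rkw block_rank_enum_val inD.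
have cl : i \in clockwise z -> nat_of_ord (z i) = i by move/clockwise_fix ->.
have := zE i; have := ltn_ord i; move: cl; case: (i \in clockwise z).
  by move=> /(_ isT) ->; case: ifP; case: ifP; lia.
by move=> _; case: ifP; case: ifP; lia.
Qed.

Variable r : nat.
Hypothesis wB : forall x, (w x \in B) = (x \in B).
Hypothesis sr : shift_block r.

Lemma shift_block_down x : x \in B -> (x \in down w) = (#|B| - r <= block_rank B x).
Proof.
move=> xB; have [rB /(_ x xB)] := sr; case: ifP => _ h; first by rewrite h leq_addl.
by apply/esym/negbTE; have := block_rank_lt (etrans (wB x) xB); lia.
Qed.

Lemma shift_block_card : #|down w :&: B| = r.
Proof.
have [rB _] := sr; rewrite -[RHS](subKn rB) -card_block_rank ?leq_subr //.
by apply: eq_card => x; rewrite !inE andbC; case: (boolP (x \in B)) => //= /shift_block_down ->.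
Qed.

(** Let [N] be the number of points of [B] in [[a, b)]. A downward arc loses [#|B| - r] in rank, so
    at most [N - (#|B| - r)] of them fit, while [I] misses only [#|B| - r] points of the block.
    Upward arcs use [r] in the same way. *)
Lemma shift_block_arcs (I : {set 'I_n}) (a b : nat) : a <= b -> #|I :&: B| = r ->
  #|down_arcs w a b :&: B| <= #|I :&: seg n a b :&: B| /\
  #|up_arcs w a b :&: B| <= #|(seg n a b :\: I) :&: B|.
Proof.
move=> ab cI; have [rB rk] := sr.
have C := card_block_seg B ab.
have C1 : #|B :&: seg n a b| = #|I :&: seg n a b :&: B| + #|(seg n a b :\: I) :&: B|.
  rewrite -(card_pair_split _ (fun x => x \in I)); congr (_ + _); apply: eq_card => x;
  by rewrite !inE; case: (x \in B); case: (x \in I); rewrite ?andbT ?andbF.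
have C2 : #|(seg n a b :\: I) :&: B| <= #|B| - r.
  rewrite -cI [I :&: B]setIC -cardsD; apply/subset_leq_card/subsetP => x; rewrite !inE.
  by move=> /andP[/andP[-> _] ->].
have C3 : #|I :&: seg n a b :&: B| <= r.
  by rewrite -cI; apply/subset_leq_card/subsetP => x; rewrite !inE => /andP[/andP[-> _] ->].
split.
  have [->|[x0 x0D]] := set_0Vmem (down_arcs w a b :&: B); first by rewrite cards0.
  have H x : x \in down_arcs w a b :&: B ->
     #|[set y in B | y < a]| + (#|B| - r) <= block_rank B x < #|[set y in B | y < b]|.
    rewrite !inE => /andP[/and3P[xV ax xb] xB]; rewrite block_rank_below //.
    by have := rk x xB; rewrite xV => ->; rewrite andbT leq_add2r block_rank_ge.
  have := card_block_rank_le (subsetIr _ _) H; have := H _ x0D.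
  move: C C1 C2; move: #|down_arcs w a b :&: B| #|B :&: seg n a b| #|I :&: seg n a b :&: B|.
  by move=> *; lia.
have [->|[x0 x0D]] := set_0Vmem (up_arcs w a b :&: B); first by rewrite cards0.
have H x : x \in up_arcs w a b :&: B ->
   #|[set y in B | y < a]| <= block_rank B x < #|[set y in B | y < b]| - r.
  rewrite !inE => /andP[/and3P[xV ax xb] xB]; rewrite block_rank_ge //=.
  have := rk x xB; rewrite (negbTE xV) => h.
  by rewrite ltn_subRL addnC -h block_rank_below ?wB.
have := card_block_rank_le (subsetIr _ _) H; have := H _ x0D.
move: C C1 C3; move: #|up_arcs w a b :&: B| #|B :&: seg n a b| #|(seg n a b :\: I) :&: B|.
by move=> *; lia.
Qed.
End ShiftBlock.

(** * Direct sums over noncrossing partitions *)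

Section DirectSum.
Variables (T : finType) (P : {set {set T}}).
Hypothesis PT : partition P [set: T].

Lemma card_partition_sum (A : {set T}) : #|A| = \sum_(B in P) #|A :&: B|.
Proof.
rewrite -sum1_card (eq_bigl (fun x => (x \in [set: T]) && (x \in A))); last by move=> x; rewrite inE.
rewrite (set_partition_big_cond _ PT) /=; apply: eq_bigr => B _.
by rewrite -sum1_card; apply: eq_bigl => x; rewrite inE andbC.
Qed.

Lemma mem_partition B x : B \in P -> (x \in B) = (pblock P x == B).
Proof.
have /and3P[/eqP cP tP _] := PT; move=> BP; apply/idP/eqP => [|<-]; first exact: def_pblock.
by rewrite mem_pblock cP inE.
Qed.

Lemma pblock_in x : pblock P x \in P.
Proof. by have /and3P[/eqP cP _ _] := PT; apply: pblock_mem; rewrite cP inE. Qed.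

Lemma mem_pblockT x : x \in pblock P x.
Proof. by rewrite (mem_partition _ (pblock_in x)). Qed.

Lemma mem_direct_sum (r : {set T} -> nat) I :
  (I \in direct_sum_bases P (fun B => uniform_bases (r B) B)) = [forall B in P, #|I :&: B| == r B].
Proof.
apply/imsetP/forall_inP => [[f]|H].
  rewrite inE => /forall_inP H -> B BP; have := H B BP; rewrite !inE => /andP[fB /eqP <-].
  apply/eqP/eq_card => x; rewrite inE; apply/andP/idP => [[/bigcupP[B' B'P xf] xB]|xf].
    have := H _ B'P; rewrite inE => /andP[/subsetP/(_ _ xf) xB' _].
    move: xB xB'; rewrite (mem_partition _ BP) (mem_partition _ B'P) => /eqP <- /eqP ->.
    exact: xf.
  by split; [apply/bigcupP; exists B | apply: (subsetP fB)].
exists [ffun B => I :&: B].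
  by rewrite inE; apply/forall_inP => B BP; rewrite ffunE inE subsetIr H.
apply/setP => x; apply/idP/bigcupP => [xI|[B _]]; last by rewrite ffunE inE => /andP[].
by exists (pblock P x); rewrite ?pblock_in // ffunE inE xI mem_pblockT.
Qed.

End DirectSum.

Section Spirographs.
Variables (n : nat) (w : decperm n) (P : {set {set 'I_n}}).
Hypothesis PT : partition P [set: 'I_n].
Hypothesis ncP : noncrossing P.
Hypothesis wP : forall B x, B \in P -> (w x \in B) = (x \in B).
Hypothesis sP : forall B, B \in P -> exists r, shift_block w B r.

Let V := down w.

Lemma shift_blockP B : B \in P -> shift_block w B #|V :&: B|.
Proof. by move=> BP; have [r sr] := sP BP; rewrite (shift_block_card (fun x => wP x BP) sr). Qed.

Lemma noncrossing_lin B B' (a b c d : 'I_n) : B \in P -> B' \in P ->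
  a \in B -> c \in B -> b \in B' -> d \in B' -> a < b -> b < c -> c < d -> B = B'.
Proof.
move=> BP BP' aB cB bB dB ab bc cd; apply/eqP; apply: contraT => BB'.
have : cyclically_ordered a b c d.
  rewrite /cyclically_ordered !cyc_distE; have := ltn_ord a; have := ltn_ord d.
  by move: ab bc cd; clear; if_lia.
by move=> /(ncP BP BP' BB'); rewrite aB cB bB dB.
Qed.

Lemma mem_same_pblock B x y : B \in P -> x \in B -> (y \in B) = (pblock P x == pblock P y).
Proof. by move=> BP xB; rewrite (mem_partition PT _ BP) eq_sym; move: xB; rewrite (mem_partition PT _ BP) => /eqP <-. Qed.

Lemma pblock_noncrossing (a b c d : 'I_n) : pblock P a = pblock P c -> pblock P b = pblock P d ->
  a < b -> b < c -> c < d -> pblock P a = pblock P b.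
Proof.
move=> ac bd; apply: noncrossing_lin; rewrite ?pblock_in ?mem_pblockT ?ac ?bd ?mem_pblockT //.
Qed.

Lemma pblock_w x : pblock P (w x) = pblock P x.
Proof. by apply/esym/eqP; rewrite -(mem_same_pblock _ (pblock_in PT x) (mem_pblockT PT x)) wP ?pblock_in ?mem_pblockT. Qed.

(** Every arc starting in an invariant interval stays inside it, so the lower and the upper bound on
    the elements of [I] coincide. *)
Lemma invariant_seg_card I a b : I \in arc_bases w -> a <= b <= n ->
  (forall x, (w x \in seg n a b) = (x \in seg n a b)) -> #|I :&: seg n a b| = #|V :&: seg n a b|.
Proof.
move=> /arc_basesP[_ H] ab inv; have [h1 h2] := H a b ab.
have e1 : down_arcs w a b = V :&: seg n a b.
  apply/setP => x; have := inv x; rewrite !inE; case: (boolP (x \in down w)) => //= xV.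
  by have := down_le xV; move: (nat_of_ord x) (nat_of_ord (w x)) => X Y; lia.
have e2 : up_arcs w a b = seg n a b :\: V.
  apply/setP => x; have := inv x; rewrite !inE; case: (boolP (x \in down w)) => //= xV.
  by have := up_le xV; move: (nat_of_ord x) (nat_of_ord (w x)) => X Y; lia.
rewrite e1 in h1; rewrite e2 in h2.
have := cardsID I (seg n a b); have := cardsID V (seg n a b).
rewrite ![seg n a b :&: _]setIC.
move: h1 h2; move: #|I :&: _| #|V :&: _| #|_ :\: I| #|_ :\: V| #|seg n a b| => *; lia.
Qed.

(** Induction on the length of the convex hull of a block. As the partition is noncrossing, the hull
    is a union of blocks, hence invariant, and its number of elements of [I] is known; the other
    blocks inside start later and have shorter hulls. *)
Lemma base_block_card I : I \in arc_bases w -> forall B, B \in P -> #|I :&: B| = #|V :&: B|.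
Proof.
move=> IM.
suff H m : forall B x y, B \in P -> x \in B -> y \in B -> (forall z, z \in B -> x <= z <= y) -> y - x < m ->
    #|I :&: B| = #|V :&: B|.
  move=> B BP; have [x0 x0B] : exists x, x \in B.
    apply/set0Pn; have /and3P[_ _] := PT; apply: contra => /eqP <- //.
  have [x xB xmin] := @arg_minnP _ x0 (mem B) (@nat_of_ord n) x0B.
  have [y yB ymax] := @arg_maxnP _ x0 (mem B) (@nat_of_ord n) x0B.
  apply: (H (y - x).+1 B x y) => // z zB; by rewrite xmin //=; apply: ymax.
elim: m => // m IH B x y BP xB yB xy; rewrite ltnS => lem.
pose S := seg n x y.+1.
have inS z : (z \in S) = (x <= z <= y) by rewrite inE ltnS.
have xy' : x <= y by have /andP[] := xy x xB.
have BS : B \subset S by apply/subsetP => z zB; rewrite inS xy.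
have blk z t : z \in S -> pblock P t = pblock P z -> t \in S.
  rewrite !inS => /andP[xz zy] tz.
  have [zB|zB] := boolP (z \in B).
    by apply: xy; move: zB; rewrite !(mem_partition PT _ BP) tz.
  have nz : pblock P z != pblock P x.
    by move: xB; rewrite (mem_partition PT _ BP) => /eqP ->; rewrite -(mem_partition PT _ BP).
  have ex : pblock P x = pblock P y by apply/eqP; rewrite -(mem_same_pblock _ BP xB).
  have xz' : x < z by rewrite ltn_neqAle xz andbT; apply: contraNneq nz => /val_inj ->.
  have zy' : z < y.
    by rewrite ltn_neqAle zy andbT; apply: contraNneq nz => /val_inj ->; rewrite ex.
  apply/andP; split; rewrite leqNgt; apply/negP => h.
    by case/eqP: nz; rewrite -tz; apply: (pblock_noncrossing (c := z) (d := y)).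
  by case/eqP: nz; rewrite (@pblock_noncrossing x z y t).
have cS : #|I :&: S| = #|V :&: S|.
  apply: invariant_seg_card => //; first by rewrite (leq_trans xy') ?ltn_ord //.
  by move=> z; apply/idP/idP => h; [apply: (blk (w z)) | apply: (blk z)]; rewrite ?pblock_w.
have bs B' (A : {set 'I_n}) : B' \in P -> A :&: S :&: B' = if B' \subset S then A :&: B' else set0.
  move=> BP'; case: ifPn => [/setIidPr BS'|nB]; first by rewrite -setIA BS'.
  apply/setP => z; rewrite inE [in RHS]inE; apply/negP => /andP[/setIP[_ zS] zB].
  case/negP: nB; apply/subsetP => t tB; apply: (blk z) => //.
  by apply/eqP; rewrite -(mem_same_pblock _ BP' tB).
have := cS; rewrite !(card_partition_sum PT (_ :&: S)) (bigD1 B) //= [X in _ = X -> _](bigD1 B) //=.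
rewrite !bs // BS; set s1 := \sum_(_ in _ | _) _; set s2 := \sum_(_ in _ | _) _.
suff -> : s1 = s2 by move/eqP; rewrite eqn_add2r => /eqP.
apply: eq_bigr => B' /andP[BP' nB]; rewrite !bs //; case: ifP => // BS'.
have [x0 x0B] : exists x, x \in B'.
  apply/set0Pn; have /and3P[_ _] := PT; apply: contra => /eqP <- //.
have [x' xB' xmin] := @arg_minnP _ x0 (mem B') (@nat_of_ord n) x0B.
have [y' yB' ymax] := @arg_maxnP _ x0 (mem B') (@nat_of_ord n) x0B.
apply: (IH B' x' y') => // [z zB|]; first by rewrite xmin //=; apply: ymax.
have := subsetP BS' _ xB'; have := subsetP BS' _ yB'; rewrite !inS => h1 h2.
have : nat_of_ord x <> x'.
  move=> /val_inj e; have h : x' \in B' := xB'; case/eqP: nB.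
  move: xB h; rewrite -e (mem_partition PT _ BP) (mem_partition PT _ BP') => /eqP <- /eqP.
  by move=> ->.
have h3 : x' <= y' := ymax _ xB'; move: h1 h2 h3 lem.
move: (nat_of_ord x) (nat_of_ord y) (nat_of_ord x') (nat_of_ord y') => a b c d; clear; lia.
Qed.

Lemma arc_bases_blocks I : (I \in arc_bases w) = [forall B in P, #|I :&: B| == #|V :&: B|].
Proof.
apply/idP/forall_inP => [IM B BP|H]; first by rewrite base_block_card.
apply/arc_basesP; split.
  rewrite (card_partition_sum PT I) (card_partition_sum PT (down w)).
  by apply: eq_bigr => B BP; apply/eqP/H.
move=> a b /andP[ab _]; have K B : B \in P -> _ := fun BP => shift_block_arcs (fun x => wP x BP) (shift_blockP BP) ab (eqP (H B BP)).
split.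
  rewrite (card_partition_sum PT) [X in _ <= X](card_partition_sum PT).
  by apply: leq_sum => B /K[].
rewrite (card_partition_sum PT) [X in _ <= X](card_partition_sum PT).
by apply: leq_sum => B /K[].
Qed.

Lemma arc_bases_direct_sum :
  arc_bases w = direct_sum_bases P (fun B => uniform_bases #|V :&: B| B).
Proof. by apply/setP => I; rewrite mem_direct_sum // arc_bases_blocks. Qed.

End Spirographs.

(** * Alignments and pairs of arcs in different blocks *)

Section CountAlignments.
Variables (n : nat) (w : decperm n) (P : {set {set 'I_n}}).
Hypothesis PT : partition P [set: 'I_n].
Hypothesis ncP : noncrossing P.
Hypothesis wP : forall B x, B \in P -> (w x \in B) = (x \in B).
Hypothesis sP : forall B, B \in P -> exists r, shift_block w B r.

Let V := down w.
Let same x y := pblock P x == pblock P y.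
Let bmax (x : 'I_n) : 'I_n := [arg max_(y > x | y \in pblock P x) y].
Let bmin (x : 'I_n) : 'I_n := [arg min_(y < x | y \in pblock P x) y].

Lemma bmaxP x : [/\ pblock P (bmax x) = pblock P x, x <= bmax x & forall y, same x y -> y <= bmax x].
Proof.
rewrite /bmax; case: arg_maxnP => [|m mB H]; first exact: mem_pblockT.
have E y : (y \in pblock P x) = same x y := mem_same_pblock PT y (pblock_in PT x) (mem_pblockT PT x).
split=> [||y]; last by rewrite -E; apply: H.
  by move: mB; rewrite E => /eqP.
by apply: H; exact: mem_pblockT.
Qed.

Lemma bminP x : [/\ pblock P (bmin x) = pblock P x, bmin x <= x & forall y, same x y -> bmin x <= y].
Proof.
rewrite /bmin; case: arg_minnP => [|m mB H]; first exact: mem_pblockT.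
have E y : (y \in pblock P x) = same x y := mem_same_pblock PT y (pblock_in PT x) (mem_pblockT PT x).
split=> [||y]; last by rewrite -E; apply: H.
  by move: mB; rewrite E => /eqP.
by apply: H; exact: mem_pblockT.
Qed.

Let bw x : pblock P (w x) = pblock P x := pblock_w PT wP x.
Let nc := pblock_noncrossing PT ncP.

Lemma same_down_lt x y : same x y -> (x \in V) = (y \in V) -> (w x < w y) = (x < y).
Proof.
move=> /eqP xy xyV; have BP := pblock_in PT x; have [_ H] := shift_blockP wP sP BP.
have xB := mem_pblockT PT x; have yB : y \in pblock P x by rewrite xy mem_pblockT.
have := H x xB; have := H y yB; rewrite -/V -xyV.
rewrite -(block_rank_mono xB yB) -(block_rank_mono (B := pblock P x)) ?wP //.
by case: ifP => _ ->; [move=> ->; rewrite ltn_add2r | move=> ->; rewrite ltn_add2r].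
Qed.

Lemma same_mixed x z : same x z -> x \in V -> z \notin V -> z < x /\ w x < w z.
Proof.
move=> /eqP xz xV zV; have BP := pblock_in PT x; have [_ H] := shift_blockP wP sP BP.
have xB := mem_pblockT PT x; have zB : z \in pblock P x by rewrite xz mem_pblockT.
have := H x xB; have := H z zB; rewrite -/V xV (negbTE zV).
rewrite -(block_rank_mono zB xB) -(block_rank_mono (B := pblock P x)) ?wP //.
have := block_rank_lt (etrans (wP x BP) xB); have := block_rank_lt (etrans (wP z BP) zB).
have := block_rank_lt xB.
have := subset_leq_card (subsetIr V (pblock P x)).
move: (block_rank (pblock P x) x) (block_rank (pblock P x) z) (block_rank (pblock P x) (w x)).
move: (block_rank (pblock P x) (w z)) #|V :&: pblock P x| #|pblock P x| => *; lia.
Qed.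

(** If the downward arcs around that of [x] were not those passing over the end of its block, two
    blocks would cross. In this form they can be traded for upward arcs over the same cut. *)
Lemma nested_down x y : x \in V -> y \in V ->
  (x < y) && (w y < w x) = (w y < (bmax x).+1 <= y).
Proof.
move=> xV yV; have [Mb xM Mmax] := bmaxP x.
have wx := down_le xV; have wy := down_le yV.
have [s|ns] := boolP (same x y).
  have yM := Mmax y s; have h := same_down_lt s (etrans xV (esym yV)).
  have : nat_of_ord x = y -> nat_of_ord (w x) = w y by move=> /val_inj ->.
  by move: h; lia.
have nyM : nat_of_ord y <> bmax x by move=> /val_inj e; move: ns; rewrite /same e Mb eqxx.
have nwyM : nat_of_ord (w y) <> bmax x by move=> /val_inj e; move: ns; rewrite /same -bw -(bw y) e Mb bw eqxx.
have nwxy : nat_of_ord (w y) <> w x by move=> /val_inj /perm_inj e; move: ns; rewrite /same e eqxx.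
apply/idP/idP => /andP[h1 h2].
  suff : ~ (y < bmax x) by lia.
  move=> h; move: ns; rewrite /same eq_sym -bw => /eqP; apply.
  by rewrite (@nc (w y) x y (bmax x)) ?bw ?Mb //; lia.
suff : ~ (w x < w y) by lia.
move=> h; move: ns; rewrite /same -bw -(bw y) => /eqP; apply.
by rewrite (@nc (w x) (w y) (bmax x) y) ?bw ?Mb //; lia.
Qed.

Lemma nested_up z y : z \notin V -> y \notin V ->
  (y < z) && (w z < w y) = (y < bmin z <= w y).
Proof.
move=> zV yV; have [Mb zM Mmin] := bminP z.
have wz := up_le zV; have wy := up_le yV.
have [s|ns] := boolP (same z y).
  have yM := Mmin y s; have h : (w z < w y) = (z < y).
    by apply: same_down_lt => //; rewrite (negbTE zV) (negbTE yV).
  by move: h; lia.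
have nyM : nat_of_ord y <> bmin z by move=> /val_inj e; move: ns; rewrite /same e Mb eqxx.
have nwyM : nat_of_ord (w y) <> bmin z by move=> /val_inj e; move: ns; rewrite /same -bw -(bw y) e Mb bw eqxx.
have nwzy : nat_of_ord (w y) <> w z by move=> /val_inj /perm_inj e; move: ns; rewrite /same e eqxx.
apply/idP/idP => /andP[h1 h2].
  suff : ~ (bmin z < y) by lia.
  move=> h; move: ns; rewrite /same -Mb => /eqP; apply.
  by rewrite (@nc (bmin z) y z (w y)) ?bw ?Mb //; lia.
suff : ~ (w y < w z) by lia.
move=> h; move: ns; rewrite /same eq_sym -Mb => /eqP; apply.
by rewrite (@nc y (bmin z) (w y) (w z)) ?bw ?Mb //; lia.
Qed.

(** For a downward arc [x] and an upward arc [z]: [C1] says that [(z, x)] is an alignment, [C3] that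
    [z] passes over the end of the block of [x], and [C4] that [x] passes over the start of the
    block of [z]. *)
Let C1 (x z : 'I_n) := (x < z) || (w z < w x).
Let C3 (x z : 'I_n) := z < (bmax x).+1 <= w z.
Let C4 (x z : 'I_n) := w x < bmin z <= x.

Lemma mixed_split x z : x \in V -> z \notin V ->
  [/\ C1 x z ==> ~~ same x z, C3 x z ==> ~~ same x z && ~~ C1 x z &
      C4 x z = [&& ~~ same x z, ~~ C1 x z & ~~ C3 x z]].
Proof.
move=> xV zV; have [Mb xM Mmax] := bmaxP x; have [mb mz mmin] := bminP z.
have wx := down_le xV; have wz := up_le zV.
rewrite /C1 /C3 /C4.
have [s|ns] := boolP (same x z).
  have [h1 h2] := same_mixed s xV zV.
  have := Mmax (w z); rewrite /same bw => /(_ s) h3.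
  have := mmin (w x); rewrite /same bw eq_sym => /(_ s) h4.
  by split; lia.
have nxz : nat_of_ord x <> z by move=> /val_inj e; move: ns; rewrite /same e eqxx.
have nwz : nat_of_ord (w x) <> w z by move=> /val_inj /perm_inj e; move: ns; rewrite /same e eqxx.
have nwxz : nat_of_ord (w x) <> z by move=> /val_inj e; move: ns; rewrite /same -e bw eqxx.
have nxwz : nat_of_ord x <> w z by move=> /val_inj e; move: ns; rewrite /same e bw eqxx.
have nMz : nat_of_ord (bmax x) <> z by move=> /val_inj e; move: ns; rewrite /same -Mb e eqxx.
have nMwz : nat_of_ord (bmax x) <> w z by move=> /val_inj e; move: ns; rewrite /same -Mb e bw eqxx.
have nmx : nat_of_ord (bmin z) <> x by move=> /val_inj e; move: ns; rewrite /same -mb e eqxx.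
have nmwx : nat_of_ord (bmin z) <> w x by move=> /val_inj e; move: ns; rewrite /same -mb e bw eqxx.
have cr a b c d : pblock P a = pblock P x -> pblock P c = pblock P x ->
   pblock P b = pblock P z -> pblock P d = pblock P z -> ~~ [&& a < b, b < c & c < d].
  move=> ha hc hb hd; apply/negP => /and3P[h1 h2 h3]; case/eqP: ns.
  by rewrite -ha -hb; apply: (@nc a b c d); rewrite ?ha ?hb.
have cr' a b c d : pblock P a = pblock P x -> pblock P c = pblock P x ->
   pblock P b = pblock P z -> pblock P d = pblock P z -> ~~ [&& b < a, a < d & d < c].
  move=> ha hc hb hd; apply/negP => /and3P[h1 h2 h3]; case/eqP: ns.
  by rewrite -ha -hb; apply/esym/(@nc b a d c); rewrite ?ha ?hb.
have c1 := cr x z (bmax x) (w z) erefl Mb erefl (bw z).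
have c2 := cr (w x) (bmin z) x z (bw x) erefl mb erefl.
have c3 := cr (w x) z x (w z) (bw x) erefl erefl (bw z).
have c4 := cr' (w x) z x (w z) (bw x) erefl erefl (bw z).
have c5 := cr (w x) (bmin z) x (w z) (bw x) erefl mb (bw z).
have c6 := cr' x z (bmax x) (w z) erefl Mb erefl (bw z).
have c7 := cr' (w x) (bmin z) x z (bw x) erefl mb erefl.
move: c1 c2 c3 c4 c5 c6 c7 xM mz wx wz nxz nwz nwxz nxwz nMz nMwz nmx nmwx.
move: (nat_of_ord x) (nat_of_ord z) (nat_of_ord (w x)) (nat_of_ord (w z)) (nat_of_ord (bmax x)) (nat_of_ord (bmin z)).
by move=> X Z X' Z' M m; clear; split; lia.
Qed.

(** A pair of opposite directions in different blocks satisfies exactly one of [C1], [C3], [C4]. The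
    first are the alignments of opposite directions; the other two are traded, at the end and at the
    start of a block, for nested pairs going down and going up. *)
Lemma card_alignments_blocks :
  #|alignments w| = #|[set q : 'I_n * 'I_n | [&& q.1 \in V, q.2 \notin V & ~~ same q.1 q.2]]|.
Proof.
pose D := [set q : 'I_n * 'I_n | [&& q.1 \in V, q.2 \notin V & ~~ same q.1 q.2]].
have swi : injective (fun q : 'I_n * 'I_n => (q.2, q.1)) by move=> [a b] [c d] /= [-> ->].
pose sw := fun q : 'I_n * 'I_n => (q.2, q.1).
rewrite -/D -(card_pair_split D (fun q => C1 q.1 q.2)).
rewrite -(card_pair_split [set q in D | ~~ C1 q.1 q.2] (fun q => C3 q.1 q.2)).
rewrite -(card_pair_split (alignments w) (fun q : 'I_n * 'I_n => (q.1 \notin V) && (q.2 \in V))).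
rewrite -(card_pair_split [set q in alignments w | ~~ _] (fun q : 'I_n * 'I_n => q.2 \in V)).
congr (_ + (_ + _)).
- rewrite -[RHS](card_imset _ swi); apply: eq_card => -[p s]; rewrite -[(p, s)]/(sw (s, p)) mem_imset //.
  rewrite !inE /= is_alignmentE -/V.
  case: (boolP (s \in V)) => sV; case: (boolP (p \in V)) => pV; rewrite ?andbF //=.
  by have [+ _ _] := mixed_split sV pV; rewrite /C1 ?andbT ?andbF; case: (same s p) => /=; lia.
- rewrite -[LHS](card_imset _ swi).
  transitivity #|[set q : 'I_n * 'I_n | (q.1 \in V) && ((q.2 \in V) && (w q.2 < (bmax q.1).+1 <= q.2))]|.
    apply: eq_card => -[s p]; rewrite -[(s, p)]/(sw (p, s)) mem_imset // !inE /= is_alignmentE -/V.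
    case: (boolP (s \in V)) => sV; case: (boolP (p \in V)) => pV; rewrite ?andbF //=.
    by rewrite -nested_down // !andbT.
  transitivity #|[set q : 'I_n * 'I_n | (q.1 \in V) && ((q.2 \notin V) && (q.2 < (bmax q.1).+1 <= w q.2))]|.
    apply/eqP; rewrite eqn_leq; apply/andP; split.
      apply: (card_pairs_le (p := fun x y => (x \in V) && ((y \in V) && (w y < (bmax x).+1 <= y)))
         (q := fun x z => (x \in V) && ((z \notin V) && (z < (bmax x).+1 <= w z)))) => x.
      by case: (x \in V) => //=; rewrite (card_up_cut w).
    apply: (card_pairs_le (q := fun x y => (x \in V) && ((y \in V) && (w y < (bmax x).+1 <= y)))
         (p := fun x z => (x \in V) && ((z \notin V) && (z < (bmax x).+1 <= w z)))) => x.
    by case: (x \in V) => //=; rewrite (card_up_cut w).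
  apply: eq_card => -[x z]; rewrite !inE /=.
  case: (boolP (x \in V)) => xV //=; case: (boolP (z \in V)) => zV //=.
  by have [_ + _] := mixed_split xV zV; rewrite -/(C3 x z); case: (C3 x z); rewrite /= ?andbF // => ->.
transitivity #|[set q : 'I_n * 'I_n | (q.1 \notin V) && ((q.2 \notin V) && (q.2 < bmin q.1 <= w q.2))]|.
  apply: eq_card => -[p s]; rewrite !inE /= is_alignmentE -/V.
  case: (boolP (s \in V)) => sV; case: (boolP (p \in V)) => pV; rewrite ?andbF //=.
  by rewrite -nested_up // !andbT.
transitivity #|[set q : 'I_n * 'I_n | (q.1 \notin V) && ((q.2 \in V) && (w q.2 < bmin q.1 <= q.2))]|.
  apply/eqP; rewrite eqn_leq; apply/andP; split.
    apply: (card_pairs_le (p := fun z y => (z \notin V) && ((y \notin V) && (y < bmin z <= w y)))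
       (q := fun z x => (z \notin V) && ((x \in V) && (w x < bmin z <= x)))) => x.
    by case: (x \in V) => //=; rewrite (card_up_cut w).
  apply: (card_pairs_le (q := fun z y => (z \notin V) && ((y \notin V) && (y < bmin z <= w y)))
       (p := fun z x => (z \notin V) && ((x \in V) && (w x < bmin z <= x)))) => x.
  by case: (x \in V) => //=; rewrite (card_up_cut w).
rewrite -[LHS](card_imset _ swi); apply: eq_card => -[x z]; rewrite -[(x, z)]/(sw (z, x)) mem_imset //.
rewrite !inE /=.
case: (boolP (x \in V)) => xV //=; case: (boolP (z \in V)) => zV //=.
by have [_ _] := mixed_split xV zV; rewrite -/(C4 x z) => ->; rewrite andbA.
Qed.

End CountAlignments.

(** * Direct sums of uniform matroids *)

(* The bases are those of a direct sum of uniform matroids of ranks r on the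
   classes of e; this form, by exchanges, is easy to transport along a rotation. *)
Definition uniform_classes n (w : decperm n) (e : rel 'I_n) (r : 'I_n -> nat) : Prop :=
  [/\ equivalence_rel e,
      forall J c d, J \in arc_bases w -> c \in J -> d \notin J ->
        (d |: (J :\ c) \in arc_bases w) = e c d
    & forall J x, J \in arc_bases w -> #|[set y in J | e x y]| = r x].

Section Uniform.
Variable n : nat.
Implicit Types (w : decperm n) (e : rel 'I_n) (r : 'I_n -> nat).

Lemma imset_exchange (g : 'S_n) (J : {set 'I_n}) c d :
  g @: (d |: (J :\ c)) = g d |: (g @: J :\ g c).
Proof.
apply/setP => x; rewrite -(permKV g x) mem_imset; last exact: perm_inj.
by rewrite !inE mem_imset ?(inj_eq perm_inj) //; exact: perm_inj.
Qed.

Lemma rotp_set (J : {set 'I_n}) : exists J0 : {set 'I_n}, J = rotp n @: J0.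
Proof.
exists ((rotp n)^-1%g @: J).
by rewrite -imset_comp -[LHS]imset_id; apply: eq_imset => x /=; rewrite permKV.
Qed.

Lemma rotp_elt (x : 'I_n) : exists x0, x = rotp n x0.
Proof. by exists ((rotp n)^-1%g x); rewrite permKV. Qed.

Lemma uniform_classes_rot w e r : uniform_classes w e r ->
  uniform_classes (rotate_dec w) (fun x y => e ((rotp n)^-1%g x) ((rotp n)^-1%g y))
     (fun x => r ((rotp n)^-1%g x)).
Proof.
move=> [eq H1 H2]; split.
- by move=> x y z; apply: eq.
- move=> J c d; have [J0 ->] := rotp_set J; have [c0 ->] := rotp_elt c; have [d0 ->] := rotp_elt d.
  rewrite -imset_exchange !arc_bases_rot !permK !mem_imset; try exact: perm_inj.
  exact: H1.
move=> J x; have [J0 ->] := rotp_set J; have [x0 ->] := rotp_elt x.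
rewrite arc_bases_rot permK => /(H2 _ x0) <-.
rewrite -[RHS](card_imset _ (@perm_inj _ (rotp n))); apply: eq_card => y.
have [y0 ->] := rotp_elt y.
by rewrite mem_imset ?inE ?permK ?mem_imset //; exact: perm_inj.
Qed.

Section Classes.
Variables (w : decperm n) (e : rel 'I_n) (r : 'I_n -> nat).
Hypothesis U : uniform_classes w e r.

Let e_refl x : e x x. Proof. by have [eq _ _] := U; have [] := eq x x x. Qed.
Let e_trans x y z : e x y -> e x z = e y z.
Proof. by have [eq _ _] := U; have [_ h] := eq x y z; exact: h. Qed.
Let e_sym x y : e x y = e y x.
Proof. by apply/idP/idP => h; [rewrite -(e_trans _ h) | rewrite -(e_trans _ h)]. Qed.

(** The least basis is tight on [[d.+1, n)]: its elements there are the ends of the downward arcs.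
    Exchanging some [y > d] for [d] would remove one of them. *)
Lemma min_base_lower y d : y \in dperm w @: down w -> d \notin dperm w @: down w -> e y d -> y < d.
Proof.
move=> yJ dJ yd; have [_ H1 _] := U; set J := dperm w @: down w in yJ dJ *.
have : d |: (J :\ y) \in arc_bases w by rewrite H1 // min_base.
have yd' : nat_of_ord y <> d by move=> /val_inj e'; rewrite e' (negbTE dJ) in yJ.
move=> /arc_basesP[_ H]; rewrite ltnNge; apply/negP => dy.
have /H[h _] : d < n <= n by rewrite ltn_ord leqnn.
have e1 : down_arcs w d.+1 n = [set x in down w | d < w x].
  by apply/setP => x; rewrite !inE ltn_ord andbT.
have e2 : #|J :&: seg n d.+1 n| = #|down_arcs w d.+1 n|.
  rewrite e1 -(card_imset [set x in down w | d < w x] (@perm_inj _ (dperm w))).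
  apply: eq_card => x; rewrite !inE ltn_ord andbT; apply/andP/imsetP => [[/imsetP[z zV ->] dz]|[z]].
    by exists z; rewrite // inE zV.
  by rewrite inE => /andP[zV dz] ->; rewrite imset_f.
move: h; rewrite card_exchangeI // inE ltnn /= add0n -e2 (cardsD1 y (J :&: _)) inE yJ inE ltn_ord andbT.
have -> : d < y by lia.
by rewrite /= add1n ltnn.
Qed.

End Classes.

(** Moving [x] from the last to the first place replaces the least basis [J] by
    [K = x |: (J :\ w x)]. Both are bases, so [x] and [w x] lie in one class. As [J] is least before
    the move and [K] after it, the members of the class in [K] are those met before [w x] when
    starting from [x]. *)
Lemma class_arc_last w e r (x : 'I_n) : uniform_classes w e r -> x.+1 = n -> w x != x ->
  e x (w x) /\ #|[set y | e x y && (cyc_dist x y < cyc_dist x (w x))]| = r x.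
Proof.
move=> U xn wx; have [eq H1 H2] := U.
have xle (y : 'I_n) : y <= x by rewrite -ltnS xn ltn_ord.
set J := dperm w @: down w.
have xV : x \in down w.
  by rewrite in_down; apply/orP; left; rewrite ltn_neqAle xle andbT.
have wxJ : w x \in J by rewrite imset_f.
have xJ : x \notin J.
  apply/imsetP => -[f fV xf]; have := down_le fV; rewrite -xf => h.
  have fx : f = x by apply: val_inj; have := xle f => /=; lia.
  by case/eqP: wx; rewrite -{1}fx -xf.
pose K := x |: (J :\ w x).
have KE : dperm (rotate_dec w) @: down (rotate_dec w) = rotp n @: K.
  have cK : #|rotp n @: K| = #|down (rotate_dec w)|.
    rewrite card_imset ?card_down_rot; last exact: perm_inj.
    rewrite cardsU1 !inE (negbTE xJ) andbF /= -(card_imset (down w) (@perm_inj _ (dperm w))).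
    by rewrite (cardsD1 (w x)) wxJ.
  apply/eqP; rewrite eq_sym eqEcard cK card_imset ?leqnn ?andbT; last exact: perm_inj.
  apply/subsetP => _ /imsetP[y yK ->].
  have -> : rotp n y = rotate_dec w (rotp n ((dperm w)^-1%g y)) by rewrite rotE permKV.
  rewrite mem_imset; last exact: perm_inj.
  rewrite in_down_rot permKV !rotpE.
  set f := (dperm w)^-1%g y; have wf : w f = y by rewrite permKV.
  have yn := ltn_ord y; have fn := ltn_ord f.
  move: yK; rewrite !inE => /orP[/eqP yx|/andP[ywx]].
    have fx : nat_of_ord f <> x by move=> /val_inj fx; case/eqP: wx; rewrite -{1}fx wf.
    by rewrite yx xn eqxx; case: eqP => //; lia.
  move=> /imsetP[z zV yz].
  have fV : f \in down w by rewrite /f yz permK.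
  have yx : nat_of_ord y <> x by move=> /val_inj e1; move: xJ; rewrite -e1 yz imset_f.
  have fx : nat_of_ord f <> x by move=> /val_inj e1; case/eqP: ywx; rewrite -wf e1.
  move: fV; rewrite in_down wf => /orP[yf|->]; last by rewrite orbT.
  by case: eqP => ?; [lia | case: eqP => ?; lia].
have KM : K \in arc_bases w by rewrite -arc_bases_rot -KE min_base.
have ewx : e (w x) x by rewrite -(H1 J) ?min_base.
have esym y z : e y z = e z y.
  apply/idP/idP => h; first by have [h1 /(_ h) <-] := eq y z y.
  by have [h1 /(_ h) <-] := eq z y z.
have etr y z t : e y z -> e y t = e z t by have [_] := eq y z t.
split; first by rewrite esym.
rewrite -(H2 K x KM); apply: eq_card => y; rewrite [LHS]inE [RHS]inE andbC.
case: (boolP (e x y)) => [exy|]; last by rewrite !andbF.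
rewrite !andbT cyc_dist_lt !inE.
have wxx : w x < x by rewrite ltn_neqAle xle andbT.
rewrite wxx /= orbT.
have yx : (y == x) = (x <= y) by apply/eqP/idP => [->//|h]; apply/val_inj/eqP; rewrite eqn_leq xle h.
rewrite -yx; case: (y =P x) => //= nyx.
have ewxy : e (w x) y by rewrite (etr _ _ _ ewx).
(* Minimality of [J] puts [y] into [J]; conversely, minimality of [K] in the rotated order puts [y]
   before [w x]. *)
apply/idP/andP => [ywx|[nwx yJ]].
  split; first by apply: contraTneq ywx => ->; rewrite ltnn.
  apply/negPn/negP => /(min_base_lower U wxJ)/(_ ewxy).
  by rewrite ltnNge (ltnW ywx).
have := min_base_lower (uniform_classes_rot U) (y := rotp n y) (d := rotp n (w x)).
rewrite KE !mem_imset; try exact: perm_inj.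
rewrite !permK !inE (negbTE wx) eqxx /= nwx yJ orbT (esym y) ewxy => /(_ isT isT isT).
have rotS (z : 'I_n) : z < x -> nat_of_ord (rotp n z) = z.+1.
  by move=> zx; rewrite rotpE; case: eqP => // zn; move: zx; rewrite -ltnS zn xn ltnn.
by rewrite !rotS // ltn_neqAle xle andbT; apply/eqP => /val_inj.
Qed.

Lemma class_arc w e r (x : 'I_n) : uniform_classes w e r -> w x != x ->
  e x (w x) /\ #|[set y | e x y && (cyc_dist x y < cyc_dist x (w x))]| = r x.
Proof.
have [m] := ubnP (n - x); elim: m => // m IH in w e r x *; rewrite ltnS => xm U wx.
have [xl|xl] := eqVneq x.+1 n; first exact: class_arc_last.
have /IH := uniform_classes_rot U => /(_ (rotp n x)); rewrite rotpE (negbTE xl) rotE (inj_eq perm_inj) !permK.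
move=> []//; first by have := ltn_ord x; lia.
move=> h1 h2; split=> //; rewrite -h2 -(card_imset _ (@perm_inj _ (rotp n))).
apply: eq_card => y; have [y0 ->] := rotp_elt y.
by rewrite mem_imset ?inE ?permK ?cyc_dist_rot //; exact: perm_inj.
Qed.

Section Crossing.
Variables (w : decperm n) (e : rel 'I_n) (r : 'I_n -> nat).
Hypothesis U : uniform_classes w e r.

Let e_refl x : e x x. Proof. by have [eq _ _] := U; have [] := eq x x x. Qed.
Let e_trans x y z : e x y -> e x z = e y z.
Proof. by have [eq _ _] := U; have [_ h] := eq x y z; exact: h. Qed.
Let e_sym x y : e x y = e y x.
Proof. by apply/idP/idP => h; [rewrite -(e_trans _ h) | rewrite -(e_trans _ h)]. Qed.

(** Only the class of [a] is changed, so the construction can be repeated for a second class. The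
    bounds on [r a] provide the exchange partner in this class when [a] and [c] are both in [J] or
    both outside. *)
Lemma choose_base J a c : J \in arc_bases w -> e a c -> a != c -> 0 < r a < #|[set y | e a y]| ->
  exists J', [/\ J' \in arc_bases w, a \in J', c \notin J' & forall y, ~~ e a y -> (y \in J') = (y \in J)].
Proof.
have [_ H1 H2] := U; move=> JM ac nac /andP[r0 r1].
have Hx c' d' y : e a c' -> e a d' -> ~~ e a y -> (y \in d' |: (J :\ c')) = (y \in J).
  move=> hc hd hy; rewrite !inE.
  have -> : (y == d') = false by apply: contraNF hy => /eqP ->.
  by have -> : (y == c') = false by apply: contraNF hy => /eqP ->.
have [aJ|aJ] := boolP (a \in J); have [cJ|cJ] := boolP (c \in J).
- have [d] : exists d, d \in [set y | e a y] :\: J.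
    apply/set0Pn; rewrite -card_gt0; have := cardsID J [set y | e a y].
    rewrite (_ : [set y | e a y] :&: J = [set y in J | e a y]) ?H2 //.
      by move=> h; move: r1; rewrite -h -[X in X < _]addn0 ltn_add2l.
    by apply/setP => y; rewrite !inE andbC.
  rewrite !inE => /andP[dJ ad]; exists (d |: (J :\ c)); split.
  - by rewrite H1 // -(e_trans _ ac).
  - by rewrite !inE nac aJ orbT.
  - by rewrite !inE eqxx orbF; apply: contraNneq dJ => <-.
  - by move=> y; apply: Hx.
- by exists J.
- exists (a |: (J :\ c)); split.
  - by rewrite H1 // e_sym.
  - by rewrite !inE eqxx.
  - by rewrite !inE eqxx orbF eq_sym.
  - by move=> y; apply: Hx.
have [d] : exists d, d \in [set y in J | e a y] by apply/set0Pn; rewrite -card_gt0 H2.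
rewrite !inE => /andP[dJ ad]; exists (a |: (J :\ d)); split.
- by rewrite H1 // e_sym.
- by rewrite !inE eqxx.
- by rewrite !inE negb_or eq_sym nac negb_and cJ orbT.
- by move=> y; apply: Hx.
Qed.

(** Take a basis [J] containing [a], [b] but not [c], [d], and let [S = J :\ a :\ b]. If the classes
    differ, adding [ab], [bc], [ad] or [cd] to [S] gives bases, but adding [ac] does not, since it
    exchanges [b] for [c]. An interval bound that holds for the four pairs and fails for [ac] needs
    an interval with [a], [c] on one side and [b], [d] on the other, which the cyclic order
    excludes. *)
Lemma classes_noncrossing a b c d : cyclically_ordered a b c d -> e a c -> e b d ->
  0 < r a < #|[set y | e a y]| -> 0 < r b < #|[set y | e b y]| -> e a b.
Proof.
move=> cyc ac bd ra rb; apply: contraT => ab; have [_ H1 H2] := U.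
move: cyc; rewrite /cyclically_ordered !cyc_distE => cyc.
have nac : a != c by apply: contraTneq cyc => ->; have := ltn_ord c; if_lia.
have nbd : b != d by apply: contraTneq cyc => ->; have := ltn_ord d; if_lia.
have [J1 [J1M a1 c1 _]] := choose_base (min_base w) ac nac ra.
have [J [JM bJ dJ JE]] := choose_base J1M bd nbd rb.
have ba : ~~ e b a by rewrite e_sym.
have aJ : a \in J by rewrite JE.
have cJ : c \notin J by rewrite JE // e_sym -(e_trans _ ac).
have bc : ~~ e b c by rewrite e_sym -(e_trans _ ac).
have ad : ~~ e a d by rewrite e_sym -(e_trans _ bd).
have K1 : c |: (J :\ b) \notin arc_bases w by rewrite H1.
case/negP: K1.
have cb : c != b by apply: contraNneq bc => ->.
have nab : a != b by apply: contraNneq ab => ->.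
have ncd : c != d by apply: contraNneq ad => <-.
have nad : a != d by apply: contraNneq ad => <-.
have Jcb : c |: (J :\ a) \in arc_bases w by rewrite H1.
have Jad : d |: (J :\ b) \in arc_bases w by rewrite H1.
have Jcd : d |: ((c |: (J :\ a)) :\ b) \in arc_bases w.
  have bJ' : b \in c |: (J :\ a) by rewrite !inE bJ andbT [b == a]eq_sym nab orbT.
  have dJ' : d \notin c |: (J :\ a) by rewrite !inE negb_or eq_sym ncd negb_and dJ orbT.
  by rewrite H1.
pose S := J :\ a :\ b.
have cS (p q : 'I_n) (A : {set 'I_n}) : p != q -> p \notin S -> q \notin S ->
    #|(p |: (q |: S)) :&: A| = (p \in A) + (q \in A) + #|S :&: A|.
  move=> pq pS qS; rewrite -addnA.
  have h1 (z : 'I_n) (Y : {set 'I_n}) : z \notin Y -> #|(z |: Y) :&: A| = (z \in A) + #|Y :&: A|.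
    move=> zY; have -> : (z |: Y) :&: A = if z \in A then z |: (Y :&: A) else Y :&: A.
      by apply/setP => t; case: ifP => zA; rewrite !inE; case: (t =P z) => [->|] //=; rewrite ?zA ?(negbTE zY).
    by case: ifP => zA; rewrite // cardsU1 inE (negbTE zY).
  by rewrite !h1 // in_setU1 negb_or pq.
have aS : a \notin S by rewrite !inE eqxx andbF.
have bS : b \notin S by rewrite !inE eqxx.
have cS' : c \notin S by rewrite !inE (negbTE cJ) !andbF.
have dS : d \notin S by rewrite !inE (negbTE dJ) !andbF.
have eJ : J = a |: (b |: S).
  by apply/setP => t; rewrite !inE; case: (t =P a) => [->|] //=; case: (t =P b) => [->|].
have ecb : c |: (J :\ a) = c |: (b |: S).
  by apply/setP => t; rewrite !inE; case: (t =P b) => [->|] //=; rewrite [b == a]eq_sym nab bJ !orbT.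
have ead : d |: (J :\ b) = d |: (a |: S).
  by apply/setP => t; rewrite !inE; case: (t =P a) => [->|] //=; rewrite nab aJ orbT.
have ecd : d |: ((c |: (J :\ a)) :\ b) = d |: (c |: S).
  by apply/setP => t; rewrite !inE; case: (t =P c) => [->|] //=; rewrite ?cb ?orbT.
have eca : c |: (J :\ b) = c |: (a |: S).
  by apply/setP => t; rewrite !inE; case: (t =P a) => [->|] //=; rewrite nab aJ orbT.
rewrite ecb in Jcb; rewrite ead in Jad; rewrite ecd in Jcd; rewrite {1}eJ in JM.
rewrite eca.
move: JM Jcb Jad Jcd => /arc_basesP[cd1 b1] /arc_basesP[_ b2] /arc_basesP[_ b3] /arc_basesP[_ b4].
have nca : c != a by rewrite eq_sym.
have nda : d != a by rewrite eq_sym.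
have ndc : d != c by rewrite eq_sym.
apply/arc_basesP; split=> [|x y xy].
  by rewrite -cd1 -[c |: _]setIT -[in RHS](setIT (a |: _)) !cS // !in_setT.
have cD (X A : {set 'I_n}) : #|A :\: X| = #|A| - #|X :&: A| by rewrite cardsD setIC.
have := b1 x y xy; have := b2 x y xy; have := b3 x y xy; have := b4 x y xy.
rewrite !cD !cS // !inE.
have seg_cyc : ~~ [&& x <= a < y, x <= c < y, ~~ (x <= b < y) & ~~ (x <= d < y)] /\
  ~~ [&& ~~ (x <= a < y), ~~ (x <= c < y), x <= b < y & x <= d < y].
  move: cyc; have := ltn_ord a; have := ltn_ord b; have := ltn_ord c; have := ltn_ord d.
  move: (nat_of_ord a) (nat_of_ord b) (nat_of_ord c) (nat_of_ord d) => A B C D; clear; by if_lia.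
move: seg_cyc; move: #|S :&: _| #|seg n x y| #|down_arcs _ _ _| #|up_arcs _ _ _|; clear.
move=> s t u v.
by case: (x <= a < y); case: (x <= b < y); case: (x <= c < y); case: (x <= d < y) => /=; lia.
Qed.

(** Arcs stay in their class by [class_arc], and crossing arcs share it since classes do not cross;
    so [p] and [s] lie in one class. By [class_arc] this class has equally many points in [[p, w p)]
    and in [[s, w s)], yet the second interval contains the first and also [s]. *)
Lemma uniform_classes_uncrossed p s y : ~~ is_crossed_alignment w p s y.
Proof.
apply/negP => /and4P[al yp ys h]; have [eq H1 H2] := U.
have [pn o1 o2 _ _] := pos_alignment al.
set q := cut_pos s in pn o1 o2; have qn z : 0 < q z <= n := cut_pos_gt0 s z.
have qi z t : q z = q t -> z = t := @cut_pos_inj n s z t.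
have qd := cut_pos_dist s; rewrite -/q in qd.
have qs : q s = n by rewrite /q /cut_pos eqxx.
have cE a b c d : q a < q b -> q b < q c -> q c < q d ->
    cyclically_ordered a b c d.
  rewrite /cyclically_ordered !qd; have := qn a; have := qn b; have := qn c; have := qn d.
  by move: (q a) (q b) (q c) (q d) => A B C D; clear; if_lia.
have nontriv x : w x != x -> [/\ e x (w x), 0 < r x < #|[set z | e x z]| &
     #|[set z | e x z && (cyc_dist x z < cyc_dist x (w x))]| = r x].
  move=> wx; have [h1 h2] := class_arc U wx; split=> //.
  have cwx : 0 < cyc_dist x (w x).
    rewrite lt0n; apply: contraNneq wx; rewrite cyc_distE => h0; apply/eqP/val_inj.
    by move: h0; have := ltn_ord x; have := ltn_ord (w x) => /=; if_lia.
  rewrite -h2; apply/andP; split.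
    by apply/card_gt0P; exists x; rewrite inE e_refl cyc_distE leqnn subnn.
  apply: proper_card; apply/properP; split; first by apply/subsetP => z; rewrite !inE => /andP[].
  by exists (w x); rewrite !inE ?h1 // ltnn andbF.
have ne x z : q x < q z -> x != z by apply: contraTneq => ->; rewrite ltnn.
have qne x z : x != z -> q x <> q z by move=> h1 /qi; apply/eqP.
have crs a b c d : q a < q b -> q b < q c -> q c < q d -> e a c -> e b d ->
    0 < r a < #|[set z | e a z]| -> 0 < r b < #|[set z | e b z]| -> e a b.
  by move=> h1 h2 h3; apply: classes_noncrossing; apply: cE.
have inI a b z : q a <= q b -> (z \in cyc_interval a b) = (q a <= q z <= q b).
  move=> ab; rewrite in_cyc_interval !qd ab; have := qn a; have := qn b; have := qn z.
  by move: ab; move: (q a) (q b) (q z) => A B Z; clear; if_lia.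
have wne x z : x != z -> w x != w z by rewrite (inj_eq perm_inj).
have wsn : q (w s) <= q s by rewrite qs; case/andP: (qn (w s)).
(* The arc [y] may share endpoints with the alignment, as in [y = w s] or [w y = p]. Such
   coincidences give the class relation at once; otherwise four points are in strict cyclic
   order. *)
have [eps wp ws] : [/\ e p s, w p != p & w s != s].
  move: h; rewrite !inI // => h.
  have nwy : w y != y.
    by case/orP: h => /andP[/andP[h1 h2] /andP[h3 h4]]; [|rewrite eq_sym]; apply: ne; lia.
  have wyp := wne _ _ yp; have wys := wne _ _ ys.
  have qyp := qne _ _ yp; have qys := qne _ _ ys; have qwyp := qne _ _ wyp; have qwys := qne _ _ wys.
  have np : w p != p by rewrite eq_sym; apply: ne; case/orP: h => /andP[/andP[h1 h2] /andP[h3 h4]]; lia.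
  have nsw : w s != s by apply: ne; case/orP: h => /andP[/andP[h1 h2] /andP[h3 h4]]; lia.
  have [ey ry _] := nontriv y nwy; have [ep rp _] := nontriv p np; have [es rs _] := nontriv s nsw.
  have rw x : e x (w x) -> r (w x) = r x /\ #|[set z | e (w x) z]| = #|[set z | e x z]|.
    move=> ex; split.
      rewrite -!(H2 _ _ (min_base w)); apply: eq_card => z; rewrite !inE.
      by rewrite -(e_trans _ ex).
    by apply: eq_card => z; rewrite !inE -(e_trans _ ex).
  have [ry' cy'] := rw y ey; have [rs' cs'] := rw s es.
  have nwy' : 0 < r (w y) < #|[set z | e (w y) z]| by rewrite ry' cy'.
  have nws' : 0 < r (w s) < #|[set z | e (w s) z]| by rewrite rs' cs'.
  have ltq a b : q a <= q b -> q a <> q b -> q a < q b.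
    by move=> h1 /eqP h2; rewrite ltn_neqAle h2.
  split=> //; case/orP: h => /andP[/andP[h1 h2] /andP[h3 h4]].
    have f1 := ltq _ _ h4 qwyp; have f2 := ltq _ _ h2 qys; have f3 := leq_ltn_trans h4 o2.
    have e1 : e y s.
      have [/qi ->|/eqP/nesym h5] := eqVneq (q y) (q (w s)).
        by rewrite e_sym.
      have h6 := ltq _ _ h1 h5.
      have : e (w y) (w s) by apply: (crs _ _ y s); rewrite // e_sym.
      by rewrite -(e_trans _ ey) e_sym -(e_trans _ es) e_sym.
    have e2 : e y p.
      have [/qi e2|/eqP/nesym h5] := eqVneq (q (w y)) (q p).
        by rewrite -e2.
      have h6 := ltq _ _ h3 h5; have h7 := leq_trans o2 h1.
      have : e p (w y) by apply: (crs _ _ (w p) y); rewrite // e_sym.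
      by rewrite e_sym -(e_trans _ ey).
    by rewrite -(e_trans _ e2).
  have f1 := ltq _ _ h3 (nesym qwys); have f2 := ltq _ _ h1 (nesym qyp).
  have f3 := leq_ltn_trans h2 o2; have f4 := ltn_trans o2 f1.
  have e1 : e y p.
    have [/qi ->|/eqP h5] := eqVneq (q y) (q (w p)).
      by rewrite e_sym.
    have h6 := ltq _ _ h2 h5.
    by rewrite e_sym; apply: (crs _ _ (w p) (w y)).
  have e2 : e y s.
    have [/qi e2|/eqP h5] := eqVneq (q (w y)) (q s).
      by rewrite -e2.
    have h6 := ltq _ _ h4 h5.
    have : e y (w s) by apply: (crs _ _ (w y) s); rewrite // e_sym.
    by rewrite e_sym -(e_trans _ es) e_sym.
  by rewrite -(e_trans _ e1).
have [_ _ rp] := nontriv p wp; have [_ _ rs] := nontriv s ws.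
have : r p < r s.
  rewrite -rp -rs; apply: proper_card; apply/properP; split.
    apply/subsetP => z; rewrite !inE -(e_trans _ eps) => /andP[-> /=].
    have := qne _ _ ws; rewrite !qd qs; have := qn p; have := qn z; have := qn (w p); have := qn (w s).
    by move: o1 o2 pn; move: (q p) (q z) (q (w p)) (q (w s)) => A B C D; clear; if_lia.
  exists s; rewrite !inE ?e_refl.
    rewrite !qd qs; have := qn (w s); have := qne _ _ ws; rewrite qs.
    by move: (q (w s)) => A; clear; if_lia.
  rewrite !qd qs; have := qn p; have := qn (w p); rewrite negb_and.
  by move: o1 o2 pn; move: (q p) (q (w p)) (q (w s)) => A B C; clear; if_lia.
suff -> : r p = r s by rewrite ltnn.
rewrite -!(H2 _ _ (min_base w)); apply: eq_card => z; rewrite !inE.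
by rewrite -(e_trans _ eps).
Qed.
End Crossing.
End Uniform.

(** * Degrees in the Johnson graph *)

Section Degree.
Variables (n : nat) (w : decperm n).
Implicit Types (J : {set 'I_n}) (P : {set {set 'I_n}}).

Lemma degree_nonbases J : J \in arc_bases w ->
  #|[set I in arc_bases w | #|I :&: J|.+1 == #|J|]| + #|adjacent_nonbases w J| = #|J| * (n - #|J|).
Proof.
move=> JM; have -> : #|J| * (n - #|J|) = #|setX J (~: J)|.
  by rewrite cardsX; congr (_ * _); have := cardsC J; rewrite card_ord; lia.
rewrite -[RHS](card_pair_split _ (fun q => q.2 |: (J :\ q.1) \in arc_bases w)); congr (_ + _).
  transitivity #|[set I | [&& I \in arc_bases w, #|I| == #|J| & #|I :&: J|.+1 == #|J|]]|.
    apply: eq_card => I; rewrite !inE; case: (boolP (I \in arc_bases w)) => //= /arc_basesP[-> _].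
    by move/arc_basesP: JM => [-> _]; rewrite eqxx.
  by rewrite (card_exchange J (mem (arc_bases w))); apply: eq_card => q; rewrite !inE andbA.
rewrite (card_exchange J [predC (arc_bases w)]); apply: eq_card => q; by rewrite !inE andbA.
Qed.

Lemma direct_sum_uniform_classes P (r : {set 'I_n} -> nat) : partition P [set: 'I_n] ->
  arc_bases w = direct_sum_bases P (fun B => uniform_bases (r B) B) ->
  uniform_classes w (fun x y => pblock P x == pblock P y) (fun x => r (pblock P x)).
Proof.
move=> PT e; have memM I : (I \in arc_bases w) = [forall B in P, #|I :&: B| == r B].
  by rewrite e mem_direct_sum.
split.
- by move=> x y z; split=> // /eqP ->.
- move=> J c d; rewrite memM => /forall_inP H cJ dJ.
  have E B : B \in P -> #|(d |: (J :\ c)) :&: B| + (c \in B) = (d \in B) + r B.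
    move=> BP; rewrite card_exchangeI // -addnA -(eqP (H B BP)); congr (_ + _).
    by rewrite [RHS](cardsD1 c) inE cJ addnC.
  rewrite memM; apply/forall_inP/eqP => [H'|cd B BP].
    have := E _ (pblock_in PT d); rewrite (eqP (H' _ (pblock_in PT d))) mem_pblockT //.
    rewrite addnC => /addIn; rewrite (mem_partition PT _ (pblock_in PT d)).
    by case: eqP.
  have := E B BP; rewrite !(mem_partition PT _ BP) cd addnC => /addnI ->.
  by [].
move=> J x; rewrite memM => /forall_inP /(_ _ (pblock_in PT x)) /eqP <-.
apply: eq_card => y; rewrite !inE; congr (_ && _).
by rewrite (mem_same_pblock PT y (pblock_in PT x) (mem_pblockT PT x)).
Qed.

Lemma same_block_pairs P J : partition P [set: 'I_n] ->
  #|[set q : 'I_n * 'I_n | [&& q.1 \in J, q.2 \notin J & pblock P q.1 == pblock P q.2]]|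
  = \sum_(B in P) #|J :&: B| * (#|B| - #|J :&: B|).
Proof.
move=> PT; rewrite -sum1_card.
rewrite (eq_bigl (fun q => (q.1 \in J) && ((q.2 \notin J) && (pblock P q.1 == pblock P q.2)))); last first.
  by move=> q; rewrite inE.
rewrite -(pair_big_dep (mem J) (fun x y => (y \notin J) && (pblock P x == pblock P y)) (fun _ _ => 1)) /=.
rewrite (eq_bigr (fun x => #|pblock P x :\: J|)); last first.
  move=> x _; rewrite -sum1_card; apply: eq_bigl => y; rewrite inE.
  by rewrite (mem_same_pblock PT y (pblock_in PT x) (mem_pblockT PT x)).
rewrite (eq_bigl (fun x => (x \in [set: 'I_n]) && (x \in J))); last by move=> x; rewrite inE.
rewrite (set_partition_big_cond _ PT) /=; apply: eq_bigr => B BP.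
rewrite (eq_bigr (fun=> #|B :\: J|)); last first.
  by move=> x /andP[xB _]; move: xB; rewrite (mem_partition PT _ BP) => /eqP ->.
rewrite (eq_bigl (mem (J :&: B))); last by move=> x; rewrite !inE andbC.
by rewrite sum_nat_const cardsD setIC.
Qed.

(** The number of exchanges inside blocks depends only on the sizes [#|J :&: B|], which agree with
    those for [down w], and so does the number of all exchanges. Hence the pairs across blocks,
    which are the exchanges leading to non-bases, are as many for [J] as for [down w]. *)
Lemma direct_sum_adjacent_nonbases P J : partition P [set: 'I_n] ->
  arc_bases w = direct_sum_bases P (fun B => uniform_bases #|down w :&: B| B) ->
  J \in arc_bases w -> #|adjacent_nonbases w J| =
   #|[set q : 'I_n * 'I_n | [&& q.1 \in down w, q.2 \notin down w & ~~ (pblock P q.1 == pblock P q.2)]]|.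
Proof.
move=> PT e JM; have [_ H _] := direct_sum_uniform_classes PT e.
have cJ : forall B, B \in P -> #|J :&: B| = #|down w :&: B|.
  by move: (JM); rewrite e mem_direct_sum // => /forall_inP H' B BP; apply/eqP/H'.
have tot (A : {set 'I_n}) :
    #|[set q : 'I_n * 'I_n | [&& q.1 \in A, q.2 \notin A & pblock P q.1 == pblock P q.2]]|
  + #|[set q : 'I_n * 'I_n | [&& q.1 \in A, q.2 \notin A & ~~ (pblock P q.1 == pblock P q.2)]]|
  = #|A| * (n - #|A|).
  have -> : #|A| * (n - #|A|) = #|setX A (~: A)|.
    by rewrite cardsX; congr (_ * _); have := cardsC A; rewrite card_ord; lia.
  rewrite -[RHS](card_pair_split _ (fun q => pblock P q.1 == pblock P q.2)).
  by congr (_ + _); apply: eq_card => q; rewrite !inE andbA.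
have -> : #|adjacent_nonbases w J| =
  #|[set q : 'I_n * 'I_n | [&& q.1 \in J, q.2 \notin J & ~~ (pblock P q.1 == pblock P q.2)]]|.
  rewrite (card_exchange J [predC (arc_bases w)]); apply: eq_card => -[c d]; rewrite !inE /=.
  case: (boolP (c \in J)) => //= cJ'; case: (boolP (d \in J)) => //= dJ'.
  by rewrite H.
have := tot J; have := tot (down w).
have cVJ : #|J| = #|down w| by have [] := arc_basesP _ _ JM.
rewrite !same_block_pairs // cVJ => <- /eqP.
rewrite (eq_bigr (fun B => #|down w :&: B| * (#|B| - #|down w :&: B|))).
  by rewrite eqn_add2l => /eqP.
by move=> B BP; rewrite cJ.
Qed.

Lemma spirographs_data : disjoint_union_of_spirographs w -> exists P,
  [/\ partition P [set: 'I_n],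
      arc_bases w = direct_sum_bases P (fun B => uniform_bases #|down w :&: B| B)
    & forall J, J \in arc_bases w -> #|adjacent_nonbases w J| = #|alignments w|].
Proof.
move=> [P [PT ncP H]]; exists P.
have wP B x : B \in P -> (w x \in B) = (x \in B).
  by move=> /H[e _]; rewrite -{1}e mem_imset //; apply: perm_inj.
have sP B : B \in P -> exists r, shift_block w B r.
  move=> BP; have [_ [z zr zs]] := H B BP; apply: (spirograph_shift_block _ zr zs).
  by apply: contraTneq BP => ->; have /and3P[] := PT.
have e := arc_bases_direct_sum PT ncP wP sP.
split=> // J JM; rewrite (direct_sum_adjacent_nonbases PT e JM).
by rewrite (card_alignments_blocks PT ncP wP sP).
Qed.

End Degree.

(** * The Jacobian matrix *)

Section Line.
Import GRing.Theory.
Local Open Scope ring_scope.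
Variables (K : fieldType) (m : nat) (a e : 'I_m -> K).

(** The restriction of [p] to the line [a + X e]. Its linear coefficient is the derivative in
    direction [e], so derivatives of minors can be read off from determinants over [{poly K}]. *)
Definition on_line (p : {mpoly K[m]}) : {poly K} := mmap polyC (fun c => (a c)%:P + e c *: 'X) p.

Lemma on_line_coef p : (on_line p)`_0 = p.@[a] /\
  (on_line p)`_1 = \sum_c p^`M(c).@[a] * e c.
Proof.
pose Q (p : {mpoly K[m]}) := (on_line p)`_0 = p.@[a] /\
  (on_line p)`_1 = \sum_c p^`M(c).@[a] * e c.
have QC c : Q c%:MP.
  rewrite /Q /on_line mmapC mevalC !coefC; split=> //=.
  by rewrite big1 // => i _; rewrite mderivC meval0 mul0r.
have QX i : Q 'X_i.
  rewrite /Q /on_line mmapX mmap1U mevalXU !coefD !coefC !coefZ !coefX /= mulr0 addr0 add0r mulr1; split=> //.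
  rewrite (bigD1 i) //= big1 => [|j ji]; rewrite mderivX ?mnm1E.
    rewrite eqxx scale1r (_ : (U_(i) - U_(i))%MM = 0%MM).
      by rewrite mpolyX0 meval1 mul1r addr0.
    by apply/mnmP => j; rewrite mnmBE subnn mnm0E.
  by rewrite eq_sym (negbTE ji) scale0r meval0 mul0r.
have QD f g : Q f -> Q g -> Q (f + g).
  move=> [p0 p1] [q0 q1]; rewrite /Q /on_line rmorphD mevalD !coefD p0 q0 p1 q1; split=> //.
  by rewrite -big_split; apply: eq_bigr => c _; rewrite mderivD mevalD mulrDl.
have QM f g : Q f -> Q g -> Q (f * g).
  move=> [p0 p1] [q0 q1]; rewrite /Q /on_line rmorphM mevalM !coefM !big_ord_recl !big_ord0 /=.
  rewrite !addr0 p0 q0 p1 q1; split=> //.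
  rewrite mulr_sumr mulr_suml -big_split; apply: eq_bigr => c _.
  by rewrite mderivM mevalD !mevalM mulrDl addrC !mulrA; congr (_ + _); rewrite mulrAC.
rewrite -/(Q p) [p]mpolyE; apply: (big_ind Q) => //.
  by rewrite -mpolyC0; apply: (QC).
move=> mm _; rewrite -mul_mpolyC; apply: (QM) => //; rewrite mpolyXE_id.
apply: (big_ind Q) => [|p' q'|i _]; [by rewrite -mpolyC1; apply: (QC) | exact: (QM) |].
elim: (mm i) => [|l IH]; first by rewrite expr0 -mpolyC1; apply: (QC).
by rewrite exprS; apply: (QM).
Qed.

End Line.

Section Plucker.
Import GRing.Theory.
Local Open Scope ring_scope.
Variables (K : fieldType) (n k : nat).
Implicit Types (A E : 'M[K]_(k, n)).

Definition line_mx A E : 'M[{poly K}]_(k, n) := map_mx polyC A + 'X *: map_mx polyC E.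

Lemma plucker_line A E (I : ksubset n k) :
  \sum_c (plucker (generic_mx K n k) I)^`M(c).@[mxvec A 0] * mxvec E 0 c
  = (plucker (line_mx A E) I)`_1.
Proof.
have [_ <-] := on_line_coef (mxvec A 0) (mxvec E 0) (plucker (generic_mx K n k) I).
rewrite /plucker /on_line -det_map_mx; set X := map_mx _ _.
suff -> : X = colsub (ksubset_nth I) (line_mx A E) by [].
apply/matrixP => i j; rewrite !mxE /= mmapX mmap1U !mxvecE.
by rewrite -mul_polyC mulrC.
Qed.

Lemma plucker_line0 A E (I : ksubset n k) j :
  col (ksubset_nth I j) A = 0 -> col (ksubset_nth I j) E = 0 -> plucker (line_mx A E) I = 0.
Proof.
move=> /colP hA /colP hE; rewrite /plucker (expand_det_col _ j) big1 // => i _.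
have := hA i; have := hE i; rewrite !mxE => -> ->.
by rewrite polyC0 mulr0 addr0 mul0r.
Qed.

Lemma plucker_line_const A E (I : ksubset n k) :
  (forall j, col (ksubset_nth I j) E = 0) -> (plucker (line_mx A E) I)`_1 = 0.
Proof.
move=> hE; have -> : plucker (line_mx A E) I = (plucker A I)%:P.
  rewrite /plucker -det_map_mx; congr (\det _); apply/matrixP => i j; rewrite !mxE.
  by have /colP/(_ i) := hE j; rewrite !mxE => ->; rewrite polyC0 mulr0 addr0.
by rewrite coefC.
Qed.

(** The determinant is linear in column [j0], the only one that depends on [X], so the coefficient
    of [X] is the minor with this column replaced. *)
Lemma plucker_line_col A E (I : ksubset n k) j0 (g : 'I_k -> 'I_n) c :
  (forall j, j != j0 -> col (ksubset_nth I j) E = 0) ->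
  col (ksubset_nth I j0) E = col c A ->
  (forall j, g j = if j == j0 then c else ksubset_nth I j) ->
  (plucker (line_mx A E) I)`_1 = \det (colsub g A).
Proof.
move=> h1 h2 gE; rewrite /plucker -det_tr.
set X := (_^T); pose B := (map_mx polyC (colsub (ksubset_nth I) A))^T.
pose C := (map_mx polyC (colsub g A))^T.
rewrite (@determinant_multilinear _ _ X B C j0 1 'X).
- by rewrite mul1r !det_tr !det_map_mx coefD coefXM coefC /= add0r coefC.
- apply/rowP => i; rewrite !mxE gE eqxx mul1r; congr (_ + _ * _%:P).
  by have /colP/(_ i) := h2; rewrite !mxE.
- apply/matrixP => j i; rewrite !mxE.
  have /colP/(_ i) : col (ksubset_nth I (lift j0 j)) E = 0 by rewrite h1 // eq_sym neq_lift.
  rewrite !mxE => ->.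
  by rewrite polyC0 mulr0 addr0.
apply/matrixP => j i; rewrite !mxE gE eq_sym (negbTE (neq_lift _ _)).
have /colP/(_ i) : col (ksubset_nth I (lift j0 j)) E = 0 by rewrite h1 // eq_sym neq_lift.
  rewrite !mxE => ->.
by rewrite polyC0 mulr0 addr0.
Qed.

Lemma ksubset_nth_inj (I : ksubset n k) : injective (ksubset_nth I).
Proof. by move=> i j /enum_val_inj /cast_ord_inj. Qed.

Lemma ksubset_nthP (I : ksubset n k) x : reflect (exists j, x = ksubset_nth I j) (x \in val I).
Proof.
apply: (iffP idP) => [xI|[j ->]]; last exact: enum_valP.
exists (cast_ord (eqP (valP I)) (enum_rank_in xI x)).
by rewrite /ksubset_nth cast_ordK enum_rankK_in.
Qed.

Lemma det_colsub_neq0 A (f g : 'I_k -> 'I_n) : \det (colsub f A) != 0 ->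
  (forall j, exists i, g i = f j) -> \det (colsub g A) != 0.
Proof.
move=> df H; have hP (j : 'I_k) : exists i, g i == f j.
  by have [i gi] := H j; exists i; apply/eqP.
pose h (j : 'I_k) := xchoose (hP j).
have E : colsub f A = colsub g A *m colsub h 1%:M.
  apply/matrixP => i j; rewrite mulmx_colsub mulmx1 !mxE; congr (A _ _).
  by apply/esym/eqP; exact: (xchooseP (hP j)).
by apply: contraNneq df => d0; rewrite E det_mulmx d0 mul0r.
Qed.

Lemma det_colsub_eq0 A (g : 'I_k -> 'I_n) i j : i != j -> g i = g j -> \det (colsub g A) = 0.
Proof.
move=> ij gij; rewrite -det_tr; apply: (determinant_alternate ij) => l.
by rewrite !mxE gij.
Qed.

Lemma rank_le_rows m p (B : 'M[K]_(m, p)) (S : {set 'I_m}) :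
  (forall i, i \notin S -> row i B = 0) -> (\rank B <= #|S|)%N.
Proof.
move=> H; apply: leq_trans (rank_leq_row (rowsub (enum_val : 'I_#|S| -> 'I_m) B)).
apply: mxrankS; apply/row_subP => i; have [iS|/H ->] := boolP (i \in S); last exact: sub0mx.
suff -> : row i B = row (enum_rank_in iS i) (rowsub (enum_val : 'I_#|S| -> 'I_m) B) by apply: row_sub.
by apply/rowP => j; rewrite !mxE enum_rankK_in.
Qed.

Lemma rank_ge_rows m p (B : 'M[K]_(m, p)) (S : {set 'I_m}) (T : 'M[K]_(p, m)) :
  (forall i j, i \in S -> j \in S -> i != j -> (B *m T) i j = 0) ->
  (forall i, i \in S -> (B *m T) i i != 0) -> (#|S| <= \rank B)%N.
Proof.
move=> H0 H1; pose f : 'I_#|S| -> 'I_m := enum_val.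
pose D := mxsub f f (B *m T).
have DE i j : D i j = (B *m T) (f i) (f j) by rewrite mxE.
have dD : D = diag_mx (\row_i D i i).
  apply/matrixP => i j; rewrite [RHS]mxE [in RHS]mxE; case: (i =P j) => [->|/eqP ij].
    by rewrite mulr1n.
  by rewrite mulr0n DE H0 ?enum_valP // (inj_eq enum_val_inj).
have uD : D \in unitmx.
  rewrite unitmxE dD det_diag unitfE; apply/prodf_neq0 => i _.
  by rewrite mxE DE H1 ?enum_valP.
have -> : #|S| = \rank D by rewrite mxrank_unit.
have -> : D = rowsub f B *m colsub f T.
  by apply/matrixP => i j; rewrite !mxE; apply: eq_bigr => l _; rewrite !mxE.
apply: leq_trans (mxrankM_maxl _ _) _; apply: mxrankS; apply/row_subP => i.
by rewrite row_rowsub row_sub.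
Qed.
End Plucker.

Section Smooth.
Import GRing.Theory.
Variables (R : realType) (n k : nat) (M : {set {set 'I_n}}).
Local Notation K := R[i].
Implicit Types (A : 'M[K]_(k, n)) (J : ksubset n k).

Definition adjacent_rows J : {set 'I_#|nonbases k M|} :=
  [set r | #|val (enum_val r) :&: val J|.+1 == k].

Lemma card_adjacent_rows J : #|adjacent_rows J| =
  #|[set I : {set 'I_n} | [&& I \notin M, #|I| == k & #|I :&: val J|.+1 == k]]|.
Proof.
have vi : injective (fun r : 'I_#|nonbases k M| => val (enum_val r)).
  by move=> r r' /val_inj /enum_val_inj.
rewrite -(card_imset _ vi); apply: eq_card => I; rewrite inE.
apply/imsetP/and3P => [[r]|[IM cI adj]].
  rewrite inE => h ->; split=> //; first by have := enum_valP r; rewrite inE.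
  exact: valP (enum_val r).
have IN : (exist _ I cI : ksubset n k) \in nonbases k M by rewrite inE.
by exists (enum_rank_in IN (exist _ I cI)); rewrite ?inE enum_rankK_in.
Qed.

Lemma card_ksubset (I : ksubset n k) : #|val I| = k.
Proof. exact: eqP (valP I). Qed.

Lemma jacobian_line A (E : 'M[K]_(k, n)) r :
  (\sum_c jacobian M A r c * mxvec E 0 c = (plucker (line_mx A E) (enum_val r))`_1)%R.
Proof. by rewrite -plucker_line; apply: eq_bigr => c _; rewrite mxE. Qed.

Lemma adjacent_sets J (I : ksubset n k) : #|val I :&: val J|.+1 == k ->
  exists c d, val J :\: val I = [set c] /\ val I :\: val J = [set d].
Proof.
move=> h; have := cardsID (val I) (val J); have := cardsID (val J) (val I).
rewrite !card_ksubset [val J :&: _]setIC => e1 e2.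
have /cards1P[d dE] : #|val I :\: val J| == 1 by rewrite -(eqn_add2l #|val I :&: val J|) e1 addn1 eq_sym.
have /cards1P[c cE] : #|val J :\: val I| == 1 by rewrite -(eqn_add2l #|val I :&: val J|) e2 addn1 eq_sym.
by exists c, d.
Qed.

(** For an adjacent [I = d |: (J :\ c)] the test direction copies column [c] of [A] into column [d].
    Along it the derivative of the minor of [I] is, up to sign, the minor of [J]. Every other
    adjacent minor has derivative zero: either it does not use column [d], or it already contains
    column [c], which then occurs twice. *)
Lemma rank_jacobian_ge A J : plucker A J != 0%R ->
  #|adjacent_rows J| <= \rank (jacobian M A).
Proof.
move=> AJ; pose E (r : 'I_#|nonbases k M|) : 'M[K]_(k, n) :=
  if [pick q : 'I_n * 'I_n | (val J :\: val (enum_val r) == [set q.1])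
        && (val (enum_val r) :\: val J == [set q.2])] is Some q
  then (\matrix_(i, j) if j == q.2 then A i q.1 else 0)%R else 0%R.
have EP r : r \in adjacent_rows J -> exists c d, [/\ val J :\: val (enum_val r) = [set c],
    val (enum_val r) :\: val J = [set d] & E r = (\matrix_(i, j) if j == d then A i c else 0)%R].
  rewrite inE => h; rewrite /E; case: pickP => [[c d] /= /andP[/eqP h1 /eqP h2]|none].
    by exists c, d.
  have [c [d [h1 h2]]] := adjacent_sets h.
  by have := none (c, d); rewrite /= h1 h2 !eqxx.
pose T : 'M[K]_(k * n, #|nonbases k M|) := (\matrix_(c, r) mxvec (E r) 0 c)%R.
have JT r r' : ((jacobian M A *m T) r r' = (plucker (line_mx A (E r')) (enum_val r))`_1)%R.
  by rewrite -jacobian_line mxE; apply: eq_bigr => c _; rewrite [in LHS](mxE _ _ c).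
apply: (rank_ge_rows (T := T)) => [r r' rS r'S nr|r rS]; rewrite JT.
  have [c [d [Jc Id _]]] := EP r rS; have [c' [d' [Jc' Id' ->]]] := EP r' r'S.
  set I := enum_val r in Jc Id *; set I' := enum_val r' in Jc' Id'.
  have c'J : c' \in val J by have := set11 c'; rewrite -Jc' inE => /andP[].
  have [d'I|d'I] := boolP (d' \in val I); last first.
    apply: plucker_line_const => j; apply/colP => i; rewrite !mxE.
    by case: eqP => // e; case/negP: d'I; rewrite -e; apply/ksubset_nthP; exists j.
  have d'J : d' \notin val J by have := set11 d'; rewrite -Id' inE => /andP[].
  have d'd : d' = d by apply/set1P; rewrite -Id inE d'J.
  have c'c : c' != c.
    apply: contraNneq nr => cc; apply/eqP; apply: enum_val_inj; apply: val_inj.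
    rewrite -/I -/I' -[val I](setID _ (val J)) -[val I'](setID _ (val J)) Id Id' d'd; congr (_ :|: _).
    apply/setP => x; have /setP/(_ x) := Jc; have /setP/(_ x) := Jc'; rewrite cc !inE => <-.
    by case: (x \in val I); case: (x \in val I'); case: (x \in val J).
  have [j0 d'j] := ksubset_nthP _ _ d'I.
  have c'I : c' \in val I.
    by apply/negPn/negP => h; case/negP: c'c; rewrite -in_set1 -Jc inE h.
  have [j1 c'j] := ksubset_nthP _ _ c'I.
  have j10 : j1 != j0 by apply: contraNneq d'J => e; rewrite d'j -e -c'j.
  rewrite (@plucker_line_col _ _ _ _ _ _ j0 (fun j => if j == j0 then c' else ksubset_nth I j) c') //.
  - by apply: (det_colsub_eq0 _ j10); rewrite (negbTE j10) eqxx.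
  - move=> j jj; apply/colP => i; rewrite !mxE d'j (inj_eq (@ksubset_nth_inj _ _ I)) (negbTE jj) //.
  - by apply/colP => i; rewrite !mxE -d'j eqxx.
have [c [d [Jc Id ->]]] := EP r rS; set I := enum_val r in Jc Id *.
have dI : d \in val I by have := set11 d; rewrite -Id inE => /andP[].
have dJ : d \notin val J by have := set11 d; rewrite -Id inE => /andP[].
have [j0 dj] := ksubset_nthP _ _ dI.
rewrite (@plucker_line_col _ _ _ _ _ _ j0 (fun j => if j == j0 then c else ksubset_nth I j) c) //.
- apply: (det_colsub_neq0 AJ) => j.
  have xJ : ksubset_nth J j \in val J by apply/ksubset_nthP; exists j.
  have [xc|xc] := eqVneq (ksubset_nth J j) c; first by exists j0; rewrite eqxx.
  have xI : ksubset_nth J j \in val I.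
    by apply/negPn/negP => h; case/negP: xc; rewrite -in_set1 -Jc inE h.
  have [j1 e] := ksubset_nthP _ _ xI; exists j1.
  by case: eqP => // j10; move: dJ; rewrite dj -j10 -e xJ.
- move=> j jj; apply/colP => i; rewrite !mxE dj (inj_eq (@ksubset_nth_inj _ _ I)) (negbTE jj) //.
- by apply/colP => i; rewrite !mxE -dj eqxx.
Qed.

Definition coordinate_point J : 'M[K]_(k, n) := (\matrix_(i, j) (ksubset_nth J i == j)%:R)%R.

Lemma coordinate_point_col J x : x \notin val J -> (col x (coordinate_point J) = 0)%R.
Proof.
move=> xJ; apply/colP => i; rewrite !mxE; case: eqP => // e.
by case/negP: xJ; rewrite -e; apply/ksubset_nthP; exists i.
Qed.

Lemma coordinate_point_in J : val J \in M -> in_positroid_variety M (coordinate_point J).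
Proof.
move=> JM; split.
  apply/row_freeP; exists (colsub (ksubset_nth J) 1%:M)%R.
  rewrite mulmx_colsub mulmx1; apply/matrixP => i j; rewrite !mxE (inj_eq (@ksubset_nth_inj _ _ J)).
  by [].
move=> I; rewrite inE => IM.
have : ~~ (val I \subset val J).
  apply: contra IM => h; suff -> : val I = val J by [].
  by apply/eqP; rewrite eqEcard h !card_ksubset leqnn.
case/subsetPn => x xI xJ; have [j e] := ksubset_nthP _ _ xI.
rewrite /plucker (expand_det_col _ j) big1 // => i _.
by have /colP/(_ i) := coordinate_point_col xJ; rewrite !mxE -e => ->; rewrite mul0r.
Qed.

(** If a non-basis [I] is not adjacent to [J], at least two of its columns vanish at the coordinate
    point. Varying a single entry leaves one of them zero, so all partial derivatives of this minor
    vanish. *)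
Lemma rank_jacobian_coordinate J : val J \in M ->
  \rank (jacobian M (coordinate_point J)) <= #|adjacent_rows J|.
Proof.
move=> JM; apply: rank_le_rows => r; rewrite inE => nadj; apply/rowP => c; rewrite [LHS]mxE [RHS]mxE.
have := enum_valP r; set I := enum_val r in nadj *; rewrite inE => IM.
case/mxvec_indexP: c => i0 d0.
have := jacobian_line (coordinate_point J) (delta_mx i0 d0) r; rewrite mxvec_delta.
rewrite (bigD1 (mxvec_index i0 d0)) //= big1 => [|c cne]; last first.
  by rewrite [X in (_ * X)%R]mxE (negbTE cne) andbF mulr0.
rewrite [X in (_ * X)%R]mxE !eqxx mulr1 addr0 => ->.
have [x xI] : exists2 x, x \in val I :\: val J & x != d0.
  have cI := card_ksubset I; have cJ := card_ksubset J.
  have : #|val I :\: val J| > 1.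
    have h1 : #|val I :&: val J| <= k by apply: leq_trans (eq_leq cI); rewrite subset_leq_card ?subsetIl.
    have h2 : #|val I :&: val J| != k.
      apply: contraNneq IM => e; suff -> : val I = val J by [].
      apply/eqP; rewrite eqEcard cI cJ leqnn andbT.
      by apply/setIidPl/eqP; rewrite eqEcard subsetIl cI e leqnn.
    have := cardsID (val J) (val I); rewrite cI; move: nadj h1 h2.
    move: #|val I :&: val J| #|val I :\: val J| => a b; lia.
  rewrite (cardsD1 d0) => h; have : 0 < #|(val I :\: val J) :\ d0|.
    by rewrite lt0n; apply: contraTneq h => ->; rewrite addn0 -leqNgt leq_b1.
  by case/card_gt0P => x; rewrite in_setD1 => /andP[h1 h2]; exists x.
move=> xd0; move: xI; rewrite in_setD => /andP[xJ xI].
have [j e] := ksubset_nthP _ _ xI.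
rewrite (@plucker_line0 _ _ _ _ _ _ j) ?coef0 // -e; first exact: coordinate_point_col.
by apply/colP => i; rewrite !mxE (negbTE xd0) andbF.
Qed.

Lemma nonzero_plucker A : row_free A -> exists J, plucker A J != 0%R.
Proof.
move=> fA; have fT : row_full (A^T)%R by rewrite /row_full mxrank_tr; exact: fA.
pose f := fullrankfun fT; have fi : injective f := @fullrankfun_inj _ _ _ _ fT.
have df : (\det (colsub f A) != 0)%R.
  by rewrite -det_tr trmx_mxsub -unitfE -unitmxE; apply: fullrowsub_unit.
have cJ : #|f @: 'I_k| == k by rewrite card_imset ?card_ord.
exists (exist _ (f @: 'I_k) cJ); apply: (det_colsub_neq0 df) => j.
have /ksubset_nthP[i e] : f j \in val (exist _ (f @: 'I_k) cJ : ksubset n k) by rewrite /= imset_f.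
by exists i.
Qed.

Lemma smooth_criterion (c : nat) : smooth_variety R k M c <->
  forall J, val J \in M -> c <= #|adjacent_rows J|.
Proof.
split=> [sm J JM|H [A [[fA vA] rk]]].
  rewrite leqNgt; apply/negP => h; apply: sm; exists (coordinate_point J); split.
    exact: coordinate_point_in.
  exact: leq_ltn_trans (rank_jacobian_coordinate JM) h.
have [J AJ] := nonzero_plucker fA.
have JM : val J \in M.
  by apply: contraNT AJ => JM; apply/eqP/vA; rewrite inE.
by have := leq_ltn_trans (rank_jacobian_ge AJ) rk; rewrite ltnNge H.
Qed.
End Smooth.

Theorem theorem1p7 (R : realType) (n k : nat) (w : decperm n) (u v : 'S_n)
    (M : {set {set 'I_n}})
    (hw : has_type k w)
    (huv : grassmann_interval k w u v)
    (hM : M = positroid k u v) :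
  [<->
    smooth_positroid_variety R k w M;
    forall y : 'S_n, y \in bruhat_interval u v ->
      (#|[set I in M | #|I :&: prefix_set y k|.+1 == k]|%:Z
        = (perm_length v)%:Z - (perm_length u)%:Z)%R;
    forall J : {set 'I_n}, J \in M ->
      (#|[set I in M | #|I :&: J|.+1 == k]|%:Z
        = (k * (n - k))%N%:Z - #|alignments w|%:Z)%R;
    johnson_regular k M
      /\ (forall J : {set 'I_n}, J \in M ->
            ((johnson_degree k M J)%:Z
              = (perm_length v)%:Z - (perm_length u)%:Z)%R);
    ~ (exists p s x : 'I_n, is_crossed_alignment w p s x);
    disjoint_union_of_spirographs w;
    direct_sum_of_uniform M ].
Proof.
have cV := card_down hw; have Me : M = arc_bases w by rewrite hM (positroidE hw huv).
have len : #|alignments w| + perm_length v = k * (n - k) + perm_length u.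
  have [gv vV ->] := huv; rewrite -cV; apply: (card_alignments_length (k := k)) => //.
  exact: grassmann_interval_prefix huv.
have cM J : J \in M -> #|J| = k by rewrite Me => /arc_basesP[-> _].
have dE J : #|[set I in M | #|I :&: J|.+1 == k]| = johnson_degree k M J by [].
have deg J : J \in M ->
    johnson_degree k M J + #|adjacent_nonbases w J| = k * (n - k).
  move=> JM; have := degree_nonbases (w := w) (J := J).
  by rewrite -Me (cM J JM) dE; apply.
have sm : smooth_positroid_variety R k w M <->
    forall J, J \in M -> #|alignments w| <= #|adjacent_nonbases w J|.
  have E (J : ksubset n k) : val J \in M -> #|adjacent_rows M J| = #|adjacent_nonbases w (val J)|.
    move=> JM; rewrite card_adjacent_rows; apply: eq_card => I.
    by rewrite !inE Me (card_ksubset J).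
  split=> [/smooth_criterion H J JM|H]; last first.
    by apply/smooth_criterion => J JM; rewrite E //; apply: H.
  have cJ : #|J| == k by rewrite cM.
  by rewrite -(E (exist _ J cJ)) //; apply: H.
have crossed p s x : is_crossed_alignment w p s x ->
    exists2 J, J \in M & #|adjacent_nonbases w J| < #|alignments w|.
  by rewrite Me; apply: crossed_small_degree.
have balanced : (forall p s x, ~~ is_crossed_alignment w p s x) ->
    forall J, J \in M -> #|adjacent_nonbases w J| = #|alignments w|.
  by rewrite Me => /uncrossed_spirographs /spirographs_data[P []].
have uncrossed : (forall J, J \in M -> #|alignments w| <= #|adjacent_nonbases w J|) ->
    forall p s x, ~~ is_crossed_alignment w p s x.
  by move=> H p s x; apply/negP => /crossed[J /H]; rewrite leqNgt => /negP.
tfae.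
(* Smoothness only bounds the adjacent non-bases from below; the exact number comes from the absence
   of crossed alignments, through [balanced]. *)
- move=> /sm/uncrossed/balanced H y yuv.
  have yM : prefix_set y k \in M by rewrite hM imset_f.
  by have := deg _ yM; rewrite H // dE; lia.
- move=> H J JM; have /imsetP[y yuv Jy] : J \in positroid k u v by rewrite -hM.
  by have := H y yuv; rewrite -Jy !dE; lia.
- move=> H; have d J : J \in M ->
      ((johnson_degree k M J)%:Z = (perm_length v)%:Z - (perm_length u)%:Z)%R.
    by move=> /H; rewrite dE; lia.
  split=> //; exists (perm_length v - perm_length u) => J /d; lia.
- move=> [_ H] [p [s [x /crossed[J JM]]]].
  by have := H J JM; have := deg J JM; lia.
- move=> H; apply: uncrossed_spirographs => p s x; apply/negP => h.
  by apply: H; exists p, s, x.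
- move=> /spirographs_data[P [PT e _]]; exists P, (fun B => #|down w :&: B|).
  by split=> [//|B _|]; rewrite ?Me // subset_leq_card ?subsetIr.
(* The given partition serves only to exclude crossed alignments; [balanced] then counts with the
   blocks built from [w]. *)
move=> [P [r [PT _ e]]]; apply/sm => J JM.
rewrite balanced // => p s x; apply: (@uniform_classes_uncrossed _ _ _ (fun x => r (pblock P x))).
by apply: direct_sum_uniform_classes; rewrite -?Me.
Qed.
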